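(* Let $k\geq 3$ be an odd integer, and let $\eta$ and $\xi$ be two vectors in $\mathbb{R}^k\setminus\mathbb{Z}^k$. Then the one-dimensional Fourier transform of the measure $$\sigma=\sum_{m\in\mathbb{Z}^k}\frac{e^{2\pi i\langle m,\xi\rangle}}{|m+\eta|}\big(\delta_{|m+\eta|}-\delta_{-|m+\eta|}\big)$$ on $\mathbb{R}$ is the distribution $$\widehat{\sigma}=-i\,e^{-2\pi i\langle\eta,\xi\rangle}\sum_{m\in\mathbb{Z}^k}\frac{e^{-2\pi i\langle m,\eta\rangle}}{|m+\xi|^{k-2}}\Big[\sum_{j=0}^{(k-3)/2}\beta_{j,k}\,|m+\xi|^j\Big((-1)^j\,\delta^{(j)}_{|m+\xi|}-\delta^{(j)}_{-|m+\xi|}\Big)\Big],$$ where $$\beta_{j,k}=\frac{(-1)^j\,(k-j-3)!}{j!\,(k-2j-3)!!}\Big(\frac{1}{2\pi}\Big)^{(k-3)/2}\quad (0\leq j\leq (k-3)/2).$$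
   Context: Here $|\cdot|$ is the Euclidean norm, $\langle\cdot,\cdot\rangle$ between vectors is the standard inner product on $\mathbb{R}^k$, $\delta_x$ is the unit mass at $x$, and $\delta_x^{(j)}$ is its $j$-th distributional derivative, $\langle\delta_x^{(j)},\varphi\rangle=(-1)^j\varphi^{(j)}(x)$. Infinite sums of distributions supported on a locally finite set (one with no finite accumulation points) are understood via their action on compactly supported smooth test functions. The Fourier transform of a Schwartz function on $\mathbb{R}$ is $\widehat{\varphi}(t)=\int_{\mathbb{R}}\varphi(x)e^{-2\pi i t x}\,dx$, and the Fourier transform of a temperate distribution is defined by $\langle\widehat{\sigma},\varphi\rangle=\langle\sigma,\widehat{\varphi}\rangle$ (bilinear pairing, no conjugation). The double factorial is $n!!=n(n-2)(n-4)\cdots$ (ending in $1$ or $2$), with $0!!=1$. *)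

(* Defs.v *)
From mathcomp Require Import all_boot all_order all_algebra.
From mathcomp Require Import all_classical all_reals all_analysis.
From mathcomp Require Export complex.

Set Implicit Arguments.
Unset Strict Implicit.
Unset Printing Implicit Defensive.

Import Order.TTheory GRing.Theory Num.Theory.
Import numFieldNormedType.Exports.

Local Open Scope classical_set_scope.
Local Open Scope ring_scope.
Local Open Scope complex_scope.

Section Vectors.
Context {R : realType} {k : nat}.

Definition zvec (m : 'rV[int]_k) : 'rV[R]_k := map_mx intr m.

Definition dotv (u v : 'rV[R]_k) : R := \sum_(i < k) u 0 i * v 0 i.

(* The norm `|u| of the library on matrices is the maximum norm. *)
Definition enorm (u : 'rV[R]_k) : R := Num.sqrt (dotv u u).

End Vectors.

Section TestFunctions.
Context {R : realType}.
Implicit Types (f : R -> R) (phi : R -> R[i]).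

Definition smooth_real f := forall (n : nat) (x : R), derivable (derive1n n f) x 1.

Definition smooth phi :=
  smooth_real (fun x => complex.Re (phi x)) /\ smooth_real (fun x => complex.Im (phi x)).

(* R[i] is not an instance of normedModType R, so derivatives and integrals
   of complex-valued functions of a real variable are taken componentwise. *)
Definition cderiv (n : nat) phi (x : R) : R[i] :=
  derive1n n (fun y => complex.Re (phi y)) x +i* derive1n n (fun y => complex.Im (phi y)) x.

Definition cintegral phi : R[i] :=
  (\int[lebesgue_measure]_(x in [set: R]) complex.Re (phi x)) +i*
  (\int[lebesgue_measure]_(x in [set: R]) complex.Im (phi x)).

Definition test_function phi :=
  smooth phi /\ compact (closure [set x | phi x != 0]).

Definition weighted_deriv (a b : nat) phi (x : R) : R :=
  `|x| ^+ a * ComplexField.Normc.normc (cderiv b phi x).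

Definition schwartz phi :=
  smooth phi /\ forall a b : nat, has_ubound (range (weighted_deriv a b phi)).

Definition schwartz_seminorm (a b : nat) phi : R :=
  sup (range (weighted_deriv a b phi)).

(* e^{i t} *)
Definition expi (t : R) : R[i] := cos t +i* sin t.

Definition fourier phi (t : R) : R[i] :=
  cintegral (fun x => phi x * expi (- (2 * pi * t * x))).

End TestFunctions.

Section Distributions.
Context {R : realType}.

(* Only the values on test functions (for distributions) or on Schwartz
   functions (for temperate distributions) are meaningful. *)
Definition functional : Type := (R -> R[i]) -> R[i]^o.

(* delta j x is the j-th derivative of the unit mass at x *)
Definition delta (j : nat) (x : R) : functional :=
  fun phi => (-1) ^+ j * cderiv j phi x.

(* The sum is finitely supported: \sum_(m \in A) is 0 by convention when
   infinitely many terms are nonzero, which does not happen on a test function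
   when the supports of the S m form a locally finite family. *)
Definition dsum {I : choiceType} (S : I -> functional) : functional :=
  fun phi => \sum_(m \in [set: I]) S m phi.

(* A linear functional on the Schwartz space that is continuous for the
   topology of the Schwartz seminorms. *)
Definition temperate (T : functional) :=
  (forall (a : R[i]) (phi psi : R -> R[i]), schwartz phi -> schwartz psi ->
     T (fun x => a * phi x + psi x) = a * T phi + T psi) /\
  (exists (M : R) (N : nat), forall phi : R -> R[i], schwartz phi ->
     ComplexField.Normc.normc (T phi) <=
       M * \sum_(a < N) \sum_(b < N) schwartz_seminorm a b phi).

Definition eq_distribution (S T : functional) :=
  forall phi : R -> R[i], test_function phi -> S phi = T phi.

Definition fourier_distribution (T : functional) : functional :=
  fun phi => T (fourier phi).

(* The distribution S is (the restriction to test functions of) a temperate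
   distribution T, which is unique because the test functions are dense in the
   Schwartz space, and the Fourier transform of T is S'. *)
Definition has_fourier_transform (S S' : functional) :=
  exists T : functional,
    [/\ temperate T, eq_distribution T S &
        eq_distribution (fourier_distribution T) S'].

End Distributions.
Arguments functional R : clear implicits.

Fixpoint double_fact (n : nat) : nat :=
  if n is n'.+2 then (n * double_fact n')%N else 1%N.

Definition beta_coef {R : realType} (j k : nat) : R :=
  (-1) ^+ j * ((k - j - 3)`!)%N%:R / ((j`!)%:R * (double_fact (k - 2 * j - 3)%N)%:R)
  * (1 / (2 * pi)) ^+ ((k - 3) %/ 2)%N.

Section Sigma.
Context {R : realType} {k : nat}.

Definition sigma (eta xi : 'rV[R]_k) : functional R :=
  dsum (fun m : 'rV[int]_k =>
    let r := enorm (zvec m + eta) in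
    (expi (2 * pi * dotv (zvec m) xi) / r%:C) *: (delta 0 r - delta 0 (- r))).

Definition sigma_hat (eta xi : 'rV[R]_k) : functional R :=
  (- 'i%C * expi (- (2 * pi * dotv eta xi))) *:
  dsum (fun m : 'rV[int]_k =>
    let r := enorm (zvec m + xi) in
    (expi (- (2 * pi * dotv (zvec m) eta)) / r%:C ^+ (k - 2)%N) *:
    \sum_(0 <= j < ((k - 3) %/ 2)%N.+1)
      (beta_coef j k * r ^+ j)%:C *:
        ((-1) ^+ j *: delta j r - delta j (- r))).

End Sigma.

(* Main.v *)
Require Import Defs.
From mathcomp Require Import all_boot all_order all_algebra.
From mathcomp Require Import all_classical all_reals all_analysis.
From mathcomp Require Import measurable_realfun lebesgue_integral_under.
From mathcomp Require Import ring lra zify.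

Set Implicit Arguments.
Unset Strict Implicit.
Unset Printing Implicit Defensive.

Import Order.TTheory GRing.Theory Num.Theory.
Import numFieldNormedType.Exports.

Local Open Scope classical_set_scope.
Local Open Scope ring_scope.
Local Open Scope complex_scope.


(** Write e(x) = exp(2 pi i x) and k = 2 n + 3.  Pairing sigma with the Fourier
    transform of a test function phi only involves the odd function
    f(x) = phi(x) - phi(-x), through its sine transform
    S f(r) = int f(x) sin(2 pi r x) dx.  Write f(x) = x gamma_0(x) and let
    gamma_i be the i-th derivative of gamma_0 with respect to x^2, so that
    gamma_i'(x) = 2 x gamma_(i+1)(x).  The theorem then amounts to

      sum_m e(<m, xi>) S f(|m + eta|) / |m + eta|
        = e(- <eta, xi>) sum_m e(- <m, eta>) (- 1/pi)^n gamma_n(|m + xi|).  (P)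

    This is Poisson summation in R^k for a radial function.  The function
    gamma_0(|x|) on R^3 has the radial Fourier transform S f(r) / r, and if F(|x|)
    on R^d has the transform h(r), then - F'(|x|) / (2 pi |x|) on R^(d+2) has the
    same transform h(r); hence (- 1/pi)^n gamma_n(|x|) on R^k has the transform
    S f(r) / r.  The numbers beta_(j,k) are the coefficients that appear when
    - 1/(2 pi r) d/dr is iterated n times on f(r) / r (beta_identity).

    (P) is established from one-dimensional facts only.  For
    f(x) = x exp(- a x^2) both sides are products of k one-dimensional theta
    series, and (P) is their transformation formula (mtheta_transformation,
    poisson_gaussian).  The formula in one variable (theta_transformation) comes
    from Polya's finite identity: the average of e(- c y) cos(pi y)^(2m) over l
    equidistant points y is a sum of binomial coefficients C(2m, m + c + n l).
    When l^2 / m tends to a constant, the powers of the cosine and the binomial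
    coefficients become Gaussians, and dominated convergence turns the identity
    into an identity between theta series.

    A general f is reached by density.  In the variable u = exp(- x^2) the
    Weierstrass theorem yields combinations of the functions exp(- i x^2), i >= 2,
    that approximate gamma_0, ..., gamma_K at the same time, uniformly relative to
    exp(- 2 x^2) (gaussian_density).  Repeated integration by parts bounds S f(r)
    by r^(-K) times the size of gamma_0, ..., gamma_K (tower_decay), so both sides
    of (P) are continuous for this approximation (poisson_small,
    poisson_identity).

    Finally, the series for sigma converges absolutely on Schwartz functions and
    defines the required temperate distribution; on a test function the sum for
    the transform is finite, and its terms are those on the right of (P)
    (sigma_hat_term). *)

(** * Complex sequences and dominated sums *)
Section Complex_limits.
Context {R : realType}.
Implicit Types (u v : nat -> R[i]) (l : R[i]).

(** Componentwise, so that the theory of real limits applies to each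
    component. *)
Definition ccvg u l :=
  (fun n => complex.Re (u n)) @ \oo --> complex.Re l /\
  (fun n => complex.Im (u n)) @ \oo --> complex.Im l.

Definition clim u : R[i] :=
  lim ((fun n => complex.Re (u n)) @ \oo) +i* lim ((fun n => complex.Im (u n)) @ \oo).

Lemma ReD (x y : R[i]) : complex.Re (x + y) = complex.Re x + complex.Re y.
Proof. by case: x; case: y. Qed.

Lemma ImD (x y : R[i]) : complex.Im (x + y) = complex.Im x + complex.Im y.
Proof. by case: x; case: y. Qed.

Lemma ReM (x y : R[i]) : complex.Re (x * y) =
  complex.Re x * complex.Re y - complex.Im x * complex.Im y.
Proof. by case: x; case: y. Qed.

Lemma ImM (x y : R[i]) : complex.Im (x * y) =
  complex.Re x * complex.Im y + complex.Im x * complex.Re y.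
Proof. by case: x => a b; case: y. Qed.

Lemma ccvg_clim u l : ccvg u l -> clim u = l.
Proof. by case: l => a b [/cvg_lim /= ur /cvg_lim /= ui]; rewrite /clim ur ?ui. Qed.

Lemma ccvg_unique u l l' : ccvg u l -> ccvg u l' -> l = l'.
Proof. by move=> /ccvg_clim <- /ccvg_clim. Qed.

Lemma ccvgD u v l l' : ccvg u l -> ccvg v l' -> ccvg (fun n => u n + v n) (l + l').
Proof.
move=> [ur ui] [vr vi]; split.
- rewrite ReD; under eq_fun do rewrite ReD; exact: cvgD.
- rewrite ImD; under eq_fun do rewrite ImD; exact: cvgD.
Qed.

Lemma ccvgM u v l l' : ccvg u l -> ccvg v l' -> ccvg (fun n => u n * v n) (l * l').
Proof.
move=> [ur ui] [vr vi]; split.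
- rewrite ReM; under eq_fun do rewrite ReM; apply: cvgB; exact: cvgM.
- rewrite ImM; under eq_fun do rewrite ImM; apply: cvgD; exact: cvgM.
Qed.

Lemma ccvg_cst l : ccvg (fun=> l) l.
Proof. by split; exact: cvg_cst. Qed.

Lemma ccvgZ (a : R[i]) u l : ccvg u l -> ccvg (fun n => a * u n) (a * l).
Proof. exact/ccvgM/ccvg_cst. Qed.

Lemma ccvg_real (u : nat -> R) (l : R) : u @ \oo --> l ->
  ccvg (fun n => (u n)%:C) l%:C.
Proof. by move=> ul; split => //=; exact: cvg_cst. Qed.

Lemma ccvg_prod (I : Type) (s : seq I) (u : I -> nat -> R[i]) (l : I -> R[i]) :
  (forall i, ccvg (u i) (l i)) ->
  ccvg (fun n => \prod_(i <- s) u i n) (\prod_(i <- s) l i).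
Proof.
move=> ul; elim: s => [|i s IH].
  by rewrite big_nil; under eq_fun do rewrite big_nil; exact: ccvg_cst.
by rewrite big_cons; under eq_fun do rewrite big_cons; exact: ccvgM.
Qed.

Lemma near_ccvg u v l : (\forall n \near \oo, u n = v n) -> ccvg u l -> ccvg v l.
Proof.
move=> uv [ur ui]; split.
  by apply: cvg_trans ur; apply: near_eq_cvg; apply: filterS uv => n ->.
by apply: cvg_trans ui; apply: near_eq_cvg; apply: filterS uv => n ->.
Qed.

End Complex_limits.

Section Complex_abs.
Context {R : realType}.
Implicit Types x y : R[i].

(** The modulus as a real number: the norm [`|x|] takes its values in [R[i]]. *)
Definition cabs x : R := ComplexField.Normc.normc x.

Lemma cabsE x : `|x| = (cabs x)%:C.
Proof. by []. Qed.

Lemma cabs_ge0 x : 0 <= cabs x.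
Proof. by have := normr_ge0 x; rewrite cabsE lecR. Qed.

Lemma cabsM x y : cabs (x * y) = cabs x * cabs y.
Proof.
by have := normrM x y; rewrite !cabsE -rmorphM => /complexI.
Qed.

Lemma cabsD x y : cabs (x + y) <= cabs x + cabs y.
Proof. by have := ler_normD x y; rewrite !cabsE -rmorphD lecR. Qed.

Lemma cabsN x : cabs (- x) = cabs x.
Proof. by have := normrN x; rewrite !cabsE => /complexI. Qed.

Lemma cabsB x y : cabs (x - y) <= cabs x + cabs y.
Proof. by rewrite -(cabsN y) cabsD. Qed.

Lemma cabs0 : cabs 0 = 0.
Proof. by have := normr0 (R[i] : normedZmodType R[i]); rewrite cabsE => /complexI. Qed.

Lemma cabs_eq0 x : cabs x = 0 -> x = 0.
Proof. by move=> x0; apply/eqP; rewrite -normr_eq0 cabsE x0. Qed.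

Lemma cabsR (a : R) : cabs a%:C = `|a|.
Proof. by rewrite /cabs /= expr0n addr0 sqrtr_sqr. Qed.

Lemma cabs_Re x : `|complex.Re x| <= cabs x.
Proof.
case: x => a b; rewrite /cabs /= -sqrtr_sqr ler_wsqrtr// lerDl sqr_ge0//.
Qed.

Lemma cabs_Im x : `|complex.Im x| <= cabs x.
Proof.
case: x => a b; rewrite /cabs /= -sqrtr_sqr ler_wsqrtr// lerDr sqr_ge0//.
Qed.

Lemma cabs_le x : cabs x <= `|complex.Re x| + `|complex.Im x|.
Proof.
case: x => a b; rewrite /cabs /= -[leRHS]ger0_norm ?addr_ge0//.
rewrite -sqrtr_sqr ler_wsqrtr// sqrrD !real_normK ?num_real// lerD2r lerDl.
by rewrite mulrn_wge0// mulr_ge0.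
Qed.

Lemma cabs_sum (I : Type) (s : seq I) (F : I -> R[i]) :
  cabs (\sum_(i <- s) F i) <= \sum_(i <- s) cabs (F i).
Proof.
elim: s => [|i s IH]; first by rewrite !big_nil cabs0.
by rewrite !big_cons (le_trans (cabsD _ _))// lerD2l.
Qed.

Lemma cabs_expi (t : R) : cabs (expi t) = 1.
Proof. by rewrite /cabs /= cos2Dsin2 sqrtr1. Qed.

Lemma expiD (s t : R) : expi (s + t) = expi s * expi t :> R[i].
Proof.
by rewrite /expi cosD sinD; congr (_ +i* _); rewrite addrC.
Qed.

Lemma expi0 : expi 0 = 1 :> R[i].
Proof. by rewrite /expi cos0 sin0. Qed.

Lemma expi_sum (I : Type) (s : seq I) (F : I -> R) :
  expi (\sum_(i <- s) F i) = \prod_(i <- s) expi (F i).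
Proof.
elim: s => [|i s IH]; first by rewrite !big_nil expi0.
by rewrite !big_cons expiD IH.
Qed.

Lemma expiX (t : R) n : expi t ^+ n = expi (t *+ n).
Proof. by elim: n => [|n IH]; rewrite ?expi0// exprS mulrS expiD IH. Qed.

Lemma expi_2pi (n : int) : expi (2 * pi * n%:~R) = 1 :> R[i].
Proof.
have e1 : expi (2 * pi) = 1 :> R[i].
  by rewrite mulr_natl /expi cos2pi sin2pi.
have en (m : nat) : expi (2 * pi * m%:R) = 1 :> R[i].
  by rewrite mulr_natr -expiX e1 expr1n.
case: n => m; first exact: en.
rewrite NegzE mulrNz mulrN.
have : expi (- (2 * pi * m.+1%:R)) * expi (2 * pi * m.+1%:R) = 1 :> R[i].
  by rewrite -expiD addNr expi0.
by rewrite en mulr1.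
Qed.

End Complex_abs.

Section Exhaustion.
Context {R : realType} (I : eqType) (B : nat -> seq I).
Hypothesis B_uniq : forall N, uniq (B N).
Hypothesis B_incr : forall N i, i \in B N -> i \in B N.+1.

Lemma exhaustion_sub N M i : (N <= M)%N -> i \in B N -> i \in B M.
Proof.
by move=> /subnKC <-; elim: (M - N)%N => [|d IH]; rewrite ?addn0// addnS => /IH/B_incr.
Qed.

Lemma big_mem_subset (V : nmodType) (s1 s2 : seq I) (g : I -> V) :
  uniq s1 -> uniq s2 -> {subset s1 <= s2} ->
  \sum_(i <- s2 | i \in s1) g i = \sum_(i <- s1) g i.
Proof.
move=> u1 u2 s12; rewrite -(big_filter s2); apply: perm_big.
apply: uniq_perm; rewrite ?filter_uniq// => i; rewrite mem_filter.
by case: (boolP (i \in s1)) => //= /s12.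
Qed.

Lemma ler_sum_subset (s1 s2 : seq I) (g : I -> R) : uniq s1 -> uniq s2 ->
  {subset s1 <= s2} -> (forall i, 0 <= g i) ->
  \sum_(i <- s1) g i <= \sum_(i <- s2) g i.
Proof.
move=> u1 u2 s12 g0; rewrite [leRHS](bigID (mem s1))/= big_mem_subset//.
by rewrite lerDl sumr_ge0.
Qed.

Lemma sum_subset (V : nmodType) (s1 s2 : seq I) (g : I -> V) : uniq s1 -> uniq s2 ->
  {subset s1 <= s2} -> (forall i, i \notin s1 -> g i = 0) ->
  \sum_(i <- s1) g i = \sum_(i <- s2) g i.
Proof.
move=> u1 u2 s12 g0; rewrite [RHS](bigID (mem s1))/= big_mem_subset//.
by rewrite [X in _ + X]big1// addr0.
Qed.

Variables (w : I -> R) (M : R).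
Hypothesis w_ge0 : forall i, 0 <= w i.
Hypothesis w_sum : forall N, \sum_(i <- B N) w i <= M.

Lemma exhaustion_mono : {homo (fun N => \sum_(i <- B N) w i) : n m / (n <= m)%N >-> n <= m}.
Proof. by move=> n m nm; apply: ler_sum_subset => // i; exact: exhaustion_sub. Qed.

Lemma exhaustion_cvg_ge0 : cvg ((fun N => \sum_(i <- B N) w i) @ \oo).
Proof.
apply: nondecreasing_is_cvgn; first exact: exhaustion_mono.
by exists M => _ [N _ <-].
Qed.

End Exhaustion.

Section Dominated_sums.
Context {R : realType} (I : eqType) (B : nat -> seq I).
Hypothesis B_uniq : forall N, uniq (B N).
Hypothesis B_incr : forall N i, i \in B N -> i \in B N.+1.
Variables (w : I -> R) (M : R).
Hypothesis w_ge0 : forall i, 0 <= w i.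
Hypothesis w_sum : forall N, \sum_(i <- B N) w i <= M.

(** [f] is the difference of [f + C * w] and [C * w], whose terms are nonnegative
    and whose partial sums are bounded. *)
Lemma dominated_cvg (f : I -> R) (C : R) : (forall i, `|f i| <= C * w i) ->
  cvg ((fun N => \sum_(i <- B N) f i) @ \oo).
Proof.
move=> fw.
have w0 i : 0 <= C * w i by exact: le_trans (fw i).
have e : (fun N => \sum_(i <- B N) f i) =
    (fun N => \sum_(i <- B N) (f i + C * w i)) - (fun N => \sum_(i <- B N) (C * w i)).
  by apply/funext => N /=; rewrite fctE -sumrB; apply: eq_bigr => i _; rewrite addrK.
have Cw N : \sum_(i <- B N) C * w i <= `|C| * M.
  rewrite -mulr_sumr (@le_trans _ _ (`|C| * \sum_(i <- B N) w i))//.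
    by rewrite ler_wpM2r ?ler_norm// sumr_ge0.
  by rewrite ler_wpM2l.
rewrite e; apply: is_cvgB; last first.
  exact: (exhaustion_cvg_ge0 B_uniq B_incr w0 Cw).
apply: (@exhaustion_cvg_ge0 _ _ _ B_uniq B_incr _ (`|C| * M + `|C| * M)) => [i|N].
  by have := fw i; rewrite ler_norml => /andP[+ _]; rewrite -subr_ge0 opprK.
rewrite big_split/= lerD//; apply: le_trans (Cw N); apply: ler_sum => i _.
exact: le_trans (ler_norm _) (fw i).
Qed.

Lemma dominated_ccvg (f : I -> R[i]) (C : R) : (forall i, cabs (f i) <= C * w i) ->
  ccvg (fun N => \sum_(i <- B N) f i) (clim (fun N => \sum_(i <- B N) f i)).
Proof.
move=> fw.
have er N : complex.Re (\sum_(i <- B N) f i) = \sum_(i <- B N) complex.Re (f i).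
  by elim/big_ind2 : _ => // x a y b <- <-; rewrite ReD.
have ei N : complex.Im (\sum_(i <- B N) f i) = \sum_(i <- B N) complex.Im (f i).
  by elim/big_ind2 : _ => // x a y b <- <-; rewrite ImD.
split; rewrite /clim /=.
- under eq_fun do rewrite er.
  by apply: (@dominated_cvg _ C) => i; apply: le_trans (fw i); exact: cabs_Re.
- under eq_fun do rewrite ei.
  by apply: (@dominated_cvg _ C) => i; apply: le_trans (fw i); exact: cabs_Im.
Qed.

(** The factor 2 comes from bounding the real and imaginary parts separately;
    what matters later is that the bound is linear in [C]. *)
Lemma dominated_clim_bound (f : I -> R[i]) (C : R) : (forall i, cabs (f i) <= C * w i) ->
  cabs (clim (fun N => \sum_(i <- B N) f i)) <= 2 * (`|C| * M).
Proof.
move=> fw; have [cr ci] := dominated_ccvg fw.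
have CN N : cabs (\sum_(i <- B N) f i) <= `|C| * M.
  apply: (le_trans (cabs_sum _ _)); apply: (@le_trans _ _ (\sum_(i <- B N) `|C| * w i)).
    apply: ler_sum => i _; apply: (le_trans (fw i)).
    by rewrite ler_wpM2r// ler_norm.
  by rewrite -mulr_sumr ler_wpM2l.
apply: le_trans (cabs_le _) _; rewrite mulr_natl mulr2n; apply: lerD.
- rewrite -(cvg_lim _ (cvg_norm cr))//; apply: limr_le; first exact: cvgP (cvg_norm cr).
  by apply: nearW => N; exact: le_trans (cabs_Re _) _.
- rewrite -(cvg_lim _ (cvg_norm ci))//; apply: limr_le; first exact: cvgP (cvg_norm ci).
  by apply: nearW => N; exact: le_trans (cabs_Im _) _.
Qed.

End Dominated_sums.

Section Tannery.
Context {R : realType} (I : eqType) (B : nat -> seq I).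
Hypothesis B_uniq : forall N, uniq (B N).
Hypothesis B_incr : forall N i, i \in B N -> i \in B N.+1.
Variables (w : I -> R) (M : R).
Hypothesis w_ge0 : forall i, 0 <= w i.
Hypothesis w_sum : forall N, \sum_(i <- B N) w i <= M.
Variable K : nat -> nat.
Hypothesis K_infty : forall N, \forall h \near \oo, (N <= K h)%N.

Lemma sum_diff_le (f : I -> R) (C : R) N N' : (N <= N')%N -> (forall i, `|f i| <= C * w i) ->
  `|\sum_(i <- B N') f i - \sum_(i <- B N) f i| <=
  C * (\sum_(i <- B N') w i - \sum_(i <- B N) w i).
Proof.
move=> NN' fw.
have e (g : I -> R) : \sum_(i <- B N') g i - \sum_(i <- B N) g i =
    \sum_(i <- B N' | i \notin B N) g i.
  apply/eqP; rewrite subr_eq addrC; apply/eqP; rewrite (bigID (mem (B N)))/=.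
  by congr (_ + _); apply: big_mem_subset => // i; exact: exhaustion_sub.
rewrite !e mulr_sumr; apply: le_trans (ler_norm_sum _ _ _) _.
by apply: ler_sum => i _.
Qed.

(** Tannery's theorem, that is, dominated convergence for series: outside a large
    [B N0] both sums are small uniformly in [h], and on [B N0] the convergence is
    that of a finite sum. *)
Lemma tannery_real (f : nat -> I -> R) (l : I -> R) (C L : R) :
  (forall i, f^~ i @ \oo --> l i) ->
  (\forall h \near \oo, forall i, `|f h i| <= C * w i) ->
  (fun N => \sum_(i <- B N) l i) @ \oo --> L ->
  (fun h => \sum_(i <- B (K h)) f h i) @ \oo --> L.
Proof.
move=> fl fw lL.
have lw i : `|l i| <= `|C| * w i.
  rewrite -(cvg_lim _ (cvg_norm (fl i)))//; apply: limr_le.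
    exact: cvgP (cvg_norm (fl i)).
  apply: filterS fw => h /(_ i) /le_trans; apply.
  by rewrite ler_wpM2r// ler_norm.
have Wc := exhaustion_cvg_ge0 B_uniq B_incr w_ge0 w_sum.
set W := lim _ in Wc.
have WN N : \sum_(i <- B N) w i <= W.
  apply: (@nondecreasing_cvgn_le _ (fun N => \sum_(i <- B N) w i)); last exact: Wc.
  exact: exhaustion_mono.
apply/cvgrPdist_le => e e0.
(* Each of the two tails costs `|C| * d and the finite part costs d, out of
   e = `|C| * d + d + `|C| * d + d. *)
pose d := e / (2 * `|C| + 1 + 1).
have d0 : 0 < d by rewrite divr_gt0// -addrA ltr_wpDl// mulr_ge0.
have /cvgrPdist_le /(_ _ d0) [N0 _ N0W] := Wc.
have {}N0W : W - \sum_(i <- B N0) w i <= d.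
  exact: le_trans (ler_norm _) (N0W _ (leqnn _)).
have Ll : `|L - \sum_(i <- B N0) l i| <= `|C| * d.
  have c : (fun N => `|\sum_(i <- B N) l i - \sum_(i <- B N0) l i|) @ \oo -->
      `|L - \sum_(i <- B N0) l i|.
    by apply: cvg_norm; apply: cvgB => //; exact: cvg_cst.
  rewrite -(cvg_lim _ c)//; apply: limr_le; first exact: cvgP c.
  exists N0 => // N /= NN0; apply: le_trans (sum_diff_le NN0 lw) _.
  by rewrite ler_wpM2l// (le_trans _ N0W)// lerD2r.
have fin : (fun h => \sum_(i <- B N0) f h i) @ \oo --> \sum_(i <- B N0) l i.
  elim: (B N0) => [|i s IH].
    by rewrite big_nil; under eq_fun do rewrite big_nil; exact: cvg_cst.
  by rewrite big_cons; under eq_fun do rewrite big_cons; exact: cvgD (fl i) IH.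
have /cvgrPdist_le /(_ _ d0) fin' := fin.
near=> h.
have a1 : `|\sum_(i <- B N0) l i - \sum_(i <- B N0) f h i| <= d.
  by near: h.
have a2 : `|\sum_(i <- B (K h)) f h i - \sum_(i <- B N0) f h i| <= `|C| * d.
  have NK : (N0 <= K h)%N by near: h; exact: K_infty.
  have fh i : `|f h i| <= `|C| * w i.
    have : forall i, `|f h i| <= C * w i by near: h.
    by move=> /(_ i) /le_trans; apply; rewrite ler_wpM2r// ler_norm.
  apply: le_trans (sum_diff_le NK fh) _.
  by rewrite ler_wpM2l// (le_trans _ N0W)// lerD2r.
have -> : e = `|C| * d + d + `|C| * d + d.
  rewrite /d; field; apply: lt0r_neq0.
  by rewrite -addrA ltr_wpDl// mulr_ge0.
set x := L in Ll *; set y := \sum_(i <- B (K h)) _ in a2 *.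
have -> : x - y = (x - \sum_(i <- B N0) l i) +
   (\sum_(i <- B N0) l i - \sum_(i <- B N0) f h i) - (y - \sum_(i <- B N0) f h i).
  by ring.
apply: le_trans (ler_normB _ _) _; apply: ler_wpDr; first exact: ltW.
by apply: lerD => //; apply: le_trans (ler_normD _ _) _; exact: lerD.
Unshelve. all: by end_near. Qed.

Lemma tannery (f : nat -> I -> R[i]) (l : I -> R[i]) (C : R) (L : R[i]) :
  (forall i, ccvg (f^~ i) (l i)) ->
  (\forall h \near \oo, forall i, cabs (f h i) <= C * w i) ->
  ccvg (fun N => \sum_(i <- B N) l i) L ->
  ccvg (fun h => \sum_(i <- B (K h)) f h i) L.
Proof.
move=> fl fw [lr li].
have er (g : I -> R[i]) s : complex.Re (\sum_(i <- s) g i) = \sum_(i <- s) complex.Re (g i).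
  by elim/big_ind2 : _ => // x a y b <- <-; rewrite ReD.
have ei (g : I -> R[i]) s : complex.Im (\sum_(i <- s) g i) = \sum_(i <- s) complex.Im (g i).
  by elim/big_ind2 : _ => // x a y b <- <-; rewrite ImD.
split; [under eq_fun do rewrite er|under eq_fun do rewrite ei].
- apply: (@tannery_real _ (fun i => complex.Re (l i)) C) => [i||].
  + exact: (fl i).1.
  + by apply: filterS fw => h fh i; exact: le_trans (cabs_Re _) (fh i).
  + by under eq_fun do rewrite -er.
- apply: (@tannery_real _ (fun i => complex.Im (l i)) C) => [i||].
  + exact: (fl i).2.
  + by apply: filterS fw => h fh i; exact: le_trans (cabs_Im _) (fh i).
  + by under eq_fun do rewrite -ei.
Qed.

End Tannery.

(** * Boxes and summable weights on the lattice *)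
Section Boxes.
Context {R : realType}.

Definition zbox (N : nat) : seq int := [seq (nat_of_ord i)%:Z - N%:Z | i <- enum 'I_N.*2.+1].

(** Enumerated by finite functions, so that the sum over a box of a product over
    the coordinates factors by distributivity ([big_box_prod]). *)
Definition box (k N : nat) : seq 'rV[int]_k :=
  [seq (\row_i ((f i : nat)%:Z - N%:Z)) | f : {ffun 'I_k -> 'I_N.*2.+1}].

Lemma zbox_uniq N : uniq (zbox N).
Proof.
rewrite map_inj_uniq ?enum_uniq// => i j /addIr.
by case=> ij; exact: val_inj.
Qed.

Lemma mem_zbox N (n : int) : (n \in zbox N) = (`|n| <= N%:Z).
Proof.
apply/mapP/idP => [[i _ ->]|nN].
  by move: (nat_of_ord i) (ltn_ord i) => j jN; lia.
have lt : (`|(n + N%:Z)%R|%N < N.*2.+1)%N by lia.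
exists (Ordinal lt); rewrite ?mem_enum//=; lia.
Qed.

Lemma zbox_incr N n : n \in zbox N -> n \in zbox N.+1.
Proof. by rewrite !mem_zbox; lia. Qed.

Lemma big_zboxS (V : nmodType) N (F : int -> V) :
  \sum_(n <- zbox N.+1) F n =
  \sum_(n <- zbox N) F n + F N.+1%:Z + F (- N.+1%:Z).
Proof.
rewrite (perm_big [:: - N.+1%:Z, N.+1%:Z & zbox N]); last first.
  apply: uniq_perm; first exact: zbox_uniq.
    rewrite /= zbox_uniq !inE !mem_zbox !negb_or andbT -andbA; apply/and3P.
    by split; lia.
  by move=> n; rewrite !inE !mem_zbox; apply/idP/idP; lia.
by rewrite !big_cons [RHS]addrC; congr (_ + _); rewrite addrC.
Qed.

Lemma box_uniq k N : uniq (box k N).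
Proof.
rewrite map_inj_uniq ?enum_uniq// => f g /rowP fg.
apply/ffunP => i; have := fg i; rewrite !mxE => /addIr.
by case=> ij; exact: val_inj.
Qed.

Lemma mem_box k N (m : 'rV[int]_k) : (m \in box k N) = [forall i, m 0 i \in zbox N].
Proof.
apply/mapP/forallP => [[f _ ->] i|mN].
  by rewrite mxE; apply/mapP; exists (f i); rewrite ?mem_enum.
have h i : exists j : 'I_N.*2.+1, m 0 i = (j : nat)%:Z - N%:Z.
  by have /mapP[j _ ->] := mN i; exists j.
have [f fE] := choice h.
exists [ffun i => f i]; first by rewrite mem_enum.
by apply/rowP => i; rewrite mxE ffunE.
Qed.

Lemma box_incr k N m : m \in box k N -> m \in box k N.+1.
Proof. by rewrite !mem_box => /forallP mN; apply/forallP => i; exact/zbox_incr. Qed.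

Lemma big_box_prod (V : comNzRingType) k N (G : 'I_k -> int -> V) :
  \sum_(m <- box k N) \prod_i G i (m 0 i) = \prod_i \sum_(n <- zbox N) G i n.
Proof.
rewrite big_image/=; under [RHS]eq_bigr do rewrite big_map big_enum /=.
rewrite (bigA_distr_bigA (fun i (j : 'I_N.*2.+1) => G i ((j : nat)%:Z - N%:Z))).
by apply: eq_bigr => f _; apply: eq_bigr => i _; rewrite mxE.
Qed.

Definition zweight (n : int) : R := (1 + n%:~R ^+ 2)^-1.

(** A product over the coordinates, hence summable because [zweight] is. *)
Definition weight k (m : 'rV[int]_k) : R := \prod_i zweight (m 0 i).

Lemma zweight_gt0 n : 0 < zweight n.
Proof. by rewrite invr_gt0 ltr_wpDr// sqr_ge0. Qed.

Lemma zweight_ge0 n : 0 <= zweight n.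
Proof. exact/ltW/zweight_gt0. Qed.

Lemma weight_gt0 k (m : 'rV[int]_k) : 0 < weight m.
Proof. by apply: prodr_gt0 => i _; exact: zweight_gt0. Qed.

Lemma weight_ge0 k (m : 'rV[int]_k) : 0 <= weight m.
Proof. exact/ltW/weight_gt0. Qed.

(** The terms of index [n] and [- n], for [n >= 1], add up to at most
    [4 / n - 4 / (n + 1)], and these bounds telescope. *)
Lemma zweight_sum N : \sum_(n <- zbox N) zweight n <= 5.
Proof.
suff : \sum_(n <- zbox N) zweight n <= 5 - 4 / N.+1%:R.
  by move=> /le_trans; apply; rewrite gerBl divr_ge0.
elim: N => [|N IH].
  rewrite /zbox /= big_map enum_ordSl big_cons big_map /=.
  rewrite [X in _ + X]big1 ?addr0; last by move=> i; case: (i) => -[|?].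
  by rewrite /zweight mulr0z expr0n addr0 invr1; lra.
rewrite big_zboxS.
have -> : zweight (- N.+1%:Z) = zweight N.+1%:Z by rewrite /zweight mulrNz sqrrN.
have h : 2 * zweight N.+1%:Z <= 4 / N.+1%:R - 4 / N.+2%:R.
  rewrite /zweight -[N.+1%:Z%:~R]/(N.+1%:R) -subr_ge0 -[N.+2%:R]natr1 -[N.+1%:R]natr1.
  set x : R := N%:R; have x0 : 0 <= x by [].
  clearbody x.
  have -> : 4 / (x + 1) - 4 / (x + 1 + 1) - 2 * (1 + (x + 1) ^+ 2)^-1 =
    (2 * (x ^+ 2 + x + 2)) / ((x + 1) * (x + 1 + 1) * (1 + (x + 1) ^+ 2)).
    field; have x2 := sqr_ge0 (x + 1); apply/and3P; split; apply: lt0r_neq0; try lra.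
  have x2 := sqr_ge0 (x + 1); have x3 := sqr_ge0 x.
  by apply: divr_ge0; [lra|apply: mulr_ge0; [apply: mulr_ge0|]; rewrite ?addr_ge0 ?sqr_ge0].
move: IH h; set a := \sum_(n <- zbox N) _; set b := zweight N.+1%:Z.
by move: (4 / N.+1%:R) (4 / N.+2%:R) => p q; lra.
Qed.

Lemma weight_sum k N : \sum_(m <- box k N) weight m <= 5 ^+ k.
Proof.
rewrite (big_box_prod N (fun _ : 'I_k => zweight)) -[k in leRHS]card_ord -prodr_const.
by apply: ler_prod => i _; rewrite zweight_sum sumr_ge0// => n _; exact: zweight_ge0.
Qed.

End Boxes.

(** * Polya's identity *)
Section Roots_of_unity.
Context {R : realType}.

Definition e2pi (x : R) : R[i] := expi (2 * pi * x).

Lemma e2piD x y : e2pi (x + y) = e2pi x * e2pi y.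
Proof. by rewrite /e2pi mulrDr expiD. Qed.

Lemma e2pi0 : e2pi 0 = 1.
Proof. by rewrite /e2pi mulr0 expi0. Qed.

Lemma e2pi_int (n : int) : e2pi n%:~R = 1.
Proof. exact: expi_2pi. Qed.

Lemma e2piX x n : e2pi x ^+ n = e2pi (x * n%:R).
Proof. by rewrite expiX /e2pi; congr expi; rewrite -[LHS]mulr_natr mulrA. Qed.

Lemma cabs_e2pi x : cabs (e2pi x) = 1.
Proof. exact: cabs_expi. Qed.

Lemma e2pi_neq1 (d l : nat) : (0 < d < l)%N -> e2pi (d%:R / l%:R) != 1.
Proof.
move=> /andP[d0 dl]; apply/eqP => /(congr1 (@complex.Re R)) /=.
have -> : 2 * pi * (d%:R / l%:R) = pi * (d%:R / l%:R) *+ 2 :> R.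
  by move: (d%:R / l%:R) => q; ring.
rewrite cos_mulr2n => h.
have l0 : 0 < l%:R :> R by rewrite ltr0n (leq_trans _ dl).
have : 0 < sin (pi * (d%:R / l%:R) : R).
  apply: sin_gt0_pi; apply/andP; split.
    by rewrite mulr_gt0 ?pi_gt0// divr_gt0// ltr0n.
  by rewrite gtr_pMr ?pi_gt0// ltr_pdivrMr// mul1r ltr_nat.
move=> s0; have := cos2Dsin2 (pi * (d%:R / l%:R) : R); have := exprn_gt0 2 s0.
by move: h; rewrite -[1%C]/(1 : R); lra.
Qed.

(** A geometric sum whose ratio is an [l]-th root of unity, equal to 1 exactly
    when [l] divides [D]. *)
Lemma sum_roots_of_unity (l : nat) (D : int) (y : R) : (0 < l)%N ->
  \sum_(i < l) e2pi ((i%:R + y) * (D%:~R / l%:R)) =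
  if (l%:Z %| D)%Z then l%:R * e2pi (y * (D%:~R / l%:R)) else 0.
Proof.
move=> l0; have lR : l%:R != 0 :> R by rewrite pnatr_eq0 -lt0n.
have -> : \sum_(i < l) e2pi ((i%:R + y) * (D%:~R / l%:R)) =
    e2pi (y * (D%:~R / l%:R)) * \sum_(i < l) e2pi (D%:~R / l%:R) ^+ i.
  rewrite mulr_sumr; apply: eq_bigr => i _.
  by rewrite e2piX -e2piD; congr e2pi; ring.
case: ifPn => lD.
  have -> : e2pi (D%:~R / l%:R) = 1.
    have /dvdzP[n ->] := lD.
    by rewrite intrM -[l%:Z%:~R]/(l%:R) mulfK// e2pi_int.
  by under eq_bigr do rewrite expr1n; rewrite sumr_const card_ord mulrC.
have : (e2pi (D%:~R / l%:R) - 1) * \sum_(i < l) e2pi (D%:~R / l%:R) ^+ i = 0.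
  by rewrite -subrX1 e2piX mulfVK// e2pi_int subrr.
move/eqP; rewrite mulf_eq0 => /orP[|/eqP ->]; last by rewrite mulr0.
have lz : l%:Z != 0 by rewrite eqz_nat -lt0n.
rewrite subr_eq0 {1}(divz_eq D l) intrD intrM -[l%:Z%:~R]/(l%:R) mulrDl mulfK//.
rewrite e2piD e2pi_int mul1r.
have m0 := modz_ge0 D lz; have ml := ltz_pmod D (_ : 0 < l%:Z).
have md : (D %% l)%Z != 0 by apply: contra lD => /eqP /dvdz_mod0P.
have {m0} -> : (D %% l)%Z = `|(D %% l)%Z|%N by rewrite gez0_abs.
rewrite -[_%:Z%:~R]/(_%:R); move=> e1; exfalso; move: e1; apply/negP/e2pi_neq1.
by rewrite lt0n absz_eq0 md/= -ltz_nat gez0_abs ?modz_ge0// ltz_pmod.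
Qed.

(** The binomial theorem for [cos z = (expi (- z) + expi z) / 2]. *)
Lemma cos_pow_expand (y : R) m : (cos (pi * y) ^+ (m.*2))%:C =
  (4 ^+ m)^-1 * \sum_(q < m.*2.+1) 'C(m.*2, q)%:R * e2pi (y * (q%:R - m%:R)).
Proof.
rewrite rmorphXn /=.
have -> : (cos (pi * y))%:C = 2^-1 * (expi (- (pi * y)) + expi (pi * y)) :> R[i].
  rewrite /expi cosN sinN; apply/eqP; rewrite eq_complex /=; apply/andP.
  by split; apply/eqP; field.
rewrite exprMn exprDn -mul2n exprM exprVn expr2 -natrM; congr (_ * _).
  by rewrite exprVn.
apply: eq_bigr => q _; rewrite -mulr_natl; congr (_ * _).
have qm : (q <= 2 * m)%N by rewrite -ltnS ltn_ord.
rewrite !expiX -expiD; congr expi.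
rewrite -!(mulr_natl (_ * _)) -!(mulr_natr (- _)) natrB// natrM; ring.
Qed.

(** The binomial coefficients of row [2 m] indexed from the middle of the row, and
    extended by 0 to all integers. *)
Definition binZ (m : nat) (q : int) : R := 'C(m.*2, m + `|q|)%:R.

Lemma binZ_ord (m : nat) (q : 'I_m.*2.+1) : 'C(m.*2, q)%:R = binZ m (q%:Z - m%:Z).
Proof.
rewrite /binZ; case: q => q /= qm; have [mq|/ltnW mq] := leqP m q.
  by congr ('C(_, _)%:R); lia.
rewrite -bin_sub; last by lia.
by congr ('C(_, _)%:R); lia.
Qed.

Lemma binZ_out m q : (m < `|q|)%N -> binZ m q = 0.
Proof. by move=> mq; rewrite /binZ bin_small// -addnn ltn_add2l. Qed.

Lemma binZ_delta (m : nat) (q : int) :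
  binZ m q = \sum_(p < m.*2.+1) if p%:Z - m%:Z == q then 'C(m.*2, p)%:R else 0.
Proof.
have [mq|qm] := ltnP m `|q|.
  rewrite binZ_out// big1// => p _; case: ifPn => // /eqP pq.
  by move: mq; case: p pq => p /= pm pq; lia.
have lt : (`|(q + m%:Z)%R|%N < m.*2.+1)%N by lia.
rewrite (bigD1 (Ordinal lt))//= ifT; last by lia.
rewrite (binZ_ord (Ordinal lt))/= big1 ?addr0.
  by congr binZ; lia.
move=> p np; rewrite ifF//; apply: contra_neqF np => /eqP pq; apply: val_inj => /=.
lia.
Qed.

(** The finite form of the theta transformation.  After expansion of the powers of
    the cosine, the sum over the [l] equidistant points keeps the frequencies that
    are congruent to [c] modulo [l].  Both sides become theta series when [l ^ 2]
    and [m] grow proportionally. *)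
Theorem polya_identity (l m K : nat) (c j0 : int) (b : R) : (0 < l)%N ->
  (m + `|c| <= K)%N ->
  let y := fun i : nat => (i%:R + (j0%:~R + b)) / l%:R in
  \sum_(i < l) e2pi (- (y i * c%:~R)) * (cos (pi * y i) ^+ m.*2)%:C =
  l%:R / 4 ^+ m * \sum_(n <- zbox K) (binZ m (c + n * l%:Z))%:C * e2pi (n%:~R * b).
Proof.
move=> l0 mK y; have lR : l%:R != 0 :> R by rewrite pnatr_eq0 -lt0n.
under eq_bigr do rewrite cos_pow_expand mulrCA.
rewrite -mulr_sumr [l%:R / _]mulrC -mulrA; congr (_ * _).
transitivity (\sum_(q < m.*2.+1) 'C(m.*2, q)%:R *
    \sum_(i < l) e2pi ((i%:R + (j0%:~R + b)) * ((q%:Z - m%:Z - c)%:~R / l%:R))).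
  under eq_bigr do rewrite mulr_sumr.
  rewrite exchange_big/=; apply: eq_bigr => q _; rewrite mulr_sumr.
  apply: eq_bigr => i _; rewrite mulrCA -e2piD; congr (_ * e2pi _).
  by rewrite /y !rmorphB/= -!/(_%:R); field.
under [in RHS]eq_bigr do rewrite binZ_delta rmorph_sum/= mulr_suml.
rewrite exchange_big/= mulr_sumr; apply: eq_bigr => q _.
rewrite sum_roots_of_unity//; case: ifPn => [/dvdzP[n nE]|ndvd].
  have nK : n \in zbox K.
    rewrite mem_zbox; have qm := ltn_ord q.
    have : (`|n * l%:Z| <= m%:Z + `|c|)%R by rewrite -nE; move: (nat_of_ord q) qm => p pm; lia.
    have : (`|n| <= `|n * l%:Z|)%R by rewrite normrM ler_peMr.
    lia.
  rewrite (bigD1_seq n)//= ?zbox_uniq// ifT; last by rewrite -nE; apply/eqP; ring.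
  rewrite big1 ?addr0; last first.
    move=> n' nn; rewrite ifF ?mul0r//; apply: contra_neqF nn => /eqP qE.
    have /mulIf : l%:Z != 0 by rewrite eqz_nat -lt0n.
    by apply; rewrite -nE qE; ring.
  rewrite mulrCA; congr (_ * (_ * _)).
    by rewrite rmorph_nat.
  rewrite nE intrM -[l%:Z%:~R]/(l%:R) mulfK// mulrDl e2piD -intrM e2pi_int mul1r mulrC//.
rewrite mulr0 big1 ?mulr0// => n _; rewrite ifF ?mul0r//.
apply: contraNF ndvd => /eqP qE; apply/dvdzP; exists n; rewrite qE; ring.
Qed.

End Roots_of_unity.

(** * Gaussian limits of cosine powers and binomial coefficients *)
Section Calculus_helpers.
Context {R : realType}.

Lemma mvt_global (f df : R -> R) (a b : R) : (forall x : R, is_derive x 1 f (df x)) ->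
  a <= b -> exists2 c, a <= c <= b & f b - f a = df c * (b - a).
Proof.
move=> fdf ab; have [|c cab e] := @MVT_segment R f df a b ab (fun x _ => fdf x).
  by apply: derivable_within_continuous => x _; case: (fdf x).
by exists c => //; move: cab; rewrite in_itv.
Qed.

Lemma onem_le_expR (v : R) : 1 - v <= expR (- v).
Proof. exact: expR_ge1Dx. Qed.

Lemma expR_le_onem (v : R) : 0 <= v <= 1 / 2 -> expR (- (v + 2 * v ^+ 2)) <= 1 - v.
Proof.
move=> /andP[v0 v2]; rewrite expRN.
have w0 : 0 < 1 + (v + 2 * v ^+ 2) by rewrite ltr_wpDr// addr_ge0// mulr_ge0// sqr_ge0.
apply: (@le_trans _ _ (1 + (v + 2 * v ^+ 2))^-1).
  by rewrite lef_pV2 ?posrE ?expR_gt0// expR_ge1Dx.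
rewrite -div1r ler_pdivrMr//.
have -> : (1 - v) * (1 + (v + 2 * v ^+ 2)) = 1 + v ^+ 2 * (1 - 2 * v) by ring.
by rewrite lerDl mulr_ge0 ?sqr_ge0//; lra.
Qed.

Lemma cvg_expR_comp (u : nat -> R) (s : R) : u @ \oo --> s ->
  (fun m => expR (u m)) @ \oo --> expR s.
Proof. by move=> us; apply: (cvg_comp _ _ us); exact: continuous_expR. Qed.

Lemma cvg_invn : (fun m : nat => (m%:R : R)^-1) @ \oo --> (0 : R).
Proof.
apply/gtr0_cvgV0; last exact: cvgr_idn.
by exists 1%N => // m /=; rewrite ltr0n.
Qed.

Lemma near_eq_lim (u v : nat -> R) (l : R) : (\forall m \near \oo, u m = v m) ->
  u @ \oo --> l -> v @ \oo --> l.
Proof. by move=> uv; apply: cvg_trans; exact: near_eq_cvg. Qed.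

Lemma lim_mul (u v : nat -> R) (a b : R) : u @ \oo --> a -> v @ \oo --> b ->
  (fun n => u n * v n) @ \oo --> a * b.
Proof. exact: cvgM. Qed.

(** By the squeeze [expR (- (v + 2 * v ^+ 2)) <= 1 - v <= expR (- v)], valid for
    [0 <= v <= 1 / 2]. *)
Lemma onem_pow_cvg (v : nat -> R) (s : R) : (forall m, 0 <= v m) ->
  (fun m => m%:R * v m) @ \oo --> s -> (fun m => (1 - v m) ^+ m) @ \oo --> expR (- s).
Proof.
move=> v0 vs.
have vc : v @ \oo --> (0 : R).
  have := lim_mul cvg_invn vs; rewrite mul0r => hlim; apply: (near_eq_lim _ hlim).
  near=> m; rewrite mulrA mulVf ?mul1r// pnatr_eq0 -lt0n; near: m; exact: nbhs_infty_gt.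
have v2 : \forall m \near \oo, v m <= 1 / 2.
  by move/cvgr_le : vc; apply; lra.
apply: (@squeeze_cvgr _ _ _ _ (fun m => expR (- (m%:R * v m + 2 * (m%:R * v m * v m))))
  (fun m => expR (- (m%:R * v m)))).
- near=> m; have vm2 : v m <= 1 / 2 by near: m.
  have vm0 := v0 m; apply/andP; split.
    have -> : - (m%:R * v m + 2 * (m%:R * v m * v m)) = m%:R * - (v m + 2 * v m ^+ 2).
      by ring.
    by rewrite expRM_natl lerXn2r ?nnegrE ?expR_ge0 ?expR_le_onem ?v0//; lra.
  by rewrite -mulrN expRM_natl lerXn2r ?nnegrE ?expR_ge0 ?onem_le_expR//; lra.
- apply: cvg_expR_comp; apply: cvgN; rewrite -[s in X in _ --> X]addr0.
  apply: cvgD => //; rewrite -[X in _ --> X](mulr0 2); apply: cvgMr.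
  by rewrite -[X in _ --> X](mulr0 s); exact: cvgM.
- by apply: cvg_expR_comp; exact: cvgN.
Unshelve. all: by end_near. Qed.

Lemma sin_bounds (x : R) : 0 <= x <= pi / 2 -> x * cos x <= sin x <= x.
Proof.
move=> /andP[x0 x2].
have [c /andP[c0 cx]] := @mvt_global sin cos 0 x (@is_derive_sin R) x0.
rewrite sin0 !subr0 => ->; rewrite [x * _]mulrC; apply/andP; split.
  rewrite ler_wpM2r//; have [->//|cx'] := eqVneq c x.
  by rewrite ltW// ltr_cos ?lt_neqAle ?cx' ?cx// in_itv/=; have := pi_ge0 R; lra.
by rewrite -[leRHS]mul1r ler_wpM2r// cos_le1.
Qed.

Lemma sin_sqr_bounds (x : R) : `|x| <= pi / 2 ->
  x ^+ 2 * (1 - x ^+ 2) <= sin x ^+ 2 <= x ^+ 2.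
Proof.
move=> x2; have /sin_bounds /andP[h1 h2] : 0 <= `|x| <= pi / 2 by rewrite normr_ge0.
have -> : sin x ^+ 2 = sin `|x| ^+ 2.
  by rewrite !sin2cos2 cos_norm.
have -> : x ^+ 2 = `|x| ^+ 2 by rewrite real_normK// num_real.
move: (normr_ge0 x) x2 h1 h2; move: `|x| => {}x x0 x2 h1 h2.
have c0 : 0 <= cos x by apply: cos_ge0_pihalf; apply/andP; split=> //; lra.
have s0 : 0 <= sin x by apply: le_trans h1; exact: mulr_ge0.
have s2 : sin x ^+ 2 <= x ^+ 2 by rewrite lerXn2r.
rewrite s2 andbT; apply: (@le_trans _ _ (x ^+ 2 * cos x ^+ 2)).
  by rewrite ler_wpM2l ?sqr_ge0// cos2sin2; lra.
by rewrite -exprMn lerXn2r// nnegrE mulr_ge0.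
Qed.

(** For [0 <= x], [sin x = 2 * sin (x / 2) * cos (x / 2) >= x * cos (x / 2) ^+ 2],
    and [2 * cos (x / 2) ^+ 2 = 1 + cos x >= 1]. *)
Lemma sin_sqr_ge (x : R) : `|x| <= pi / 2 -> x ^+ 2 / 4 <= sin x ^+ 2.
Proof.
move=> x2.
have -> : sin x ^+ 2 = sin `|x| ^+ 2 by rewrite !sin2cos2 cos_norm.
have -> : x ^+ 2 = `|x| ^+ 2 by rewrite real_normK// num_real.
move: (normr_ge0 x) x2; move: `|x| => {}x x0 x2.
have /sin_bounds /andP[h1 _] : 0 <= x / 2 <= pi / 2 by lra.
have c0 : 0 <= cos x by apply: cos_ge0_pihalf; apply/andP; split=> //; lra.
have c2 : 0 <= cos (x / 2) by apply: cos_ge0_pihalf; apply/andP; split=> //; lra.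
have xx : x = (x / 2) *+ 2 by rewrite mulr2n; lra.
have : x / 2 <= sin x.
  rewrite [in leRHS]xx sin_mulr2n; move: c0; rewrite {1}xx cos_mulr2n => c0.
  apply: (@le_trans _ _ (cos (x / 2) * (x / 2 * cos (x / 2)) *+ 2)).
    have -> : cos (x / 2) * (x / 2 * cos (x / 2)) *+ 2 = x / 2 * (cos (x / 2) ^+ 2 *+ 2).
      by ring.
    by rewrite ler_peMr ?divr_ge0//; lra.
  by rewrite lerMn2r/= ler_wpM2l.
move=> h; have -> : x ^+ 2 / 4 = (x / 2) ^+ 2 by field.
by rewrite lerXn2r// ?nnegrE ?divr_ge0// (le_trans _ h)// divr_ge0.
Qed.

Lemma cos_even_pow (x : R) m : cos x ^+ m.*2 = (1 - sin x ^+ 2) ^+ m.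
Proof. by rewrite -mul2n exprM cos2sin2. Qed.

Lemma cos_pow_cvg (x : nat -> R) (s : R) :
  (fun m => m%:R * x m ^+ 2) @ \oo --> s ->
  (fun m => cos (x m) ^+ m.*2) @ \oo --> expR (- s).
Proof.
move=> xs; under eq_fun do rewrite cos_even_pow.
have x2 : (fun m => x m ^+ 2) @ \oo --> (0 : R).
  have := lim_mul cvg_invn xs; rewrite mul0r => hlim; apply: (near_eq_lim _ hlim).
  near=> m; rewrite mulrA mulVf ?mul1r// pnatr_eq0 -lt0n; near: m; exact: nbhs_infty_gt.
have x1 : \forall m \near \oo, x m ^+ 2 <= 1.
  by move/cvgr_le : x2; apply; lra.
apply: onem_pow_cvg => [m|]; first exact: sqr_ge0.
apply: (@squeeze_cvgr _ _ _ _ (fun m => m%:R * x m ^+ 2 * (1 - x m ^+ 2))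
  (fun m => m%:R * x m ^+ 2)) => //.
- near=> m; have /sin_sqr_bounds /andP[h1 h2] : `|x m| <= pi / 2.
    apply: le_trans (pihalf_ge1 R).
    rewrite -(@ler_pXn2r _ 2)// ?nnegrE// real_normK ?num_real// expr1n.
    by near: m.
  by rewrite -mulrA !ler_wpM2l.
- rewrite -[s in X in _ --> X]mulr1; apply: cvgM => //.
  rewrite -[X in _ --> X](subr0 1); apply: cvgB => //; exact: cvg_cst.
Unshelve. all: by end_near. Qed.

(** The domination that accompanies [cos_pow_cvg] when it is applied to the terms
    of a series. *)
Lemma cos_pow_le (x : R) m : `|x| <= pi / 2 -> cos x ^+ m.*2 <= expR (- (m%:R * (x ^+ 2 / 4))).
Proof.
move=> /sin_sqr_ge h; rewrite cos_even_pow -[- (m%:R * _)]mulrN expRM_natl.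
have c0 : 0 <= 1 - sin x ^+ 2 by rewrite -cos2sin2 sqr_ge0.
rewrite lerXn2r ?nnegrE ?expR_ge0//; apply: le_trans (onem_le_expR _) _.
by rewrite ler_expR lerN2.
Qed.

End Calculus_helpers.

Section Binomial_ratio.
Context {R : realType}.

Definition cbin (m : nat) : R := 'C(m.*2, m)%:R.

Lemma cbin_gt0 m : 0 < cbin m.
Proof. by rewrite ltr0n bin_gt0 -addnn leq_addr. Qed.

Lemma bin_step (m i : nat) : (i < m)%N ->
  'C(m.*2, m + i.+1)%:R =
  'C(m.*2, m + i)%:R * (1 - (2 * i%:R + 1) / (m%:R + i%:R + 1)) :> R.
Proof.
move=> im; have := mul_bin_left m.*2 (m + i); rewrite -addnS.
have -> : (m.*2 - (m + i) = m - i)%N by lia.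
move=> /(congr1 (fun n => n%:R : R)); rewrite !natrM natrB ?(ltnW im)// => e.
have p : 0 < m%:R + i%:R + 1 :> R by rewrite ltr_wpDl// addr_ge0.
apply: (mulfI (lt0r_neq0 p)).
have -> : m%:R + i%:R + 1 = (m + i.+1)%:R :> R by rewrite natrD -natr1 addrA.
rewrite e natrD -natr1; field.
by apply: lt0r_neq0; move: p; lra.
Qed.

(** By [bin_step], ['C(m.*2, m + i) / cbin m] is the product over [j < i] of
    [1 - (2 * j + 1) / (m + j + 1)]; each factor is at most
    [expR (- ((2 * j + 1) / (m + q)))] and the odd numbers [2 * j + 1] add up to
    [i ^+ 2].  The bound [q] on [i] keeps the denominator fixed in the
    induction. *)
Lemma bin_le_gauss (m i q : nat) : (i <= q)%N -> (0 < m)%N ->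
  'C(m.*2, m + i)%:R <= cbin m * expR (- (i%:R ^+ 2 / (m%:R + q%:R))).
Proof.
move=> + m0; elim: i => [_|i IH iq].
  by rewrite addn0 expr0n mul0r oppr0 expR0 mulr1.
have [mi|im] := leqP m i.
  by rewrite bin_small ?mulr_ge0 ?expR_ge0 ?ltW ?cbin_gt0//; lia.
rewrite bin_step//.
have p : 0 < m%:R + i%:R + 1 :> R by rewrite ltr_wpDl// addr_ge0.
have mq : 0 < m%:R + q%:R :> R by rewrite ltr_wpDr// ltr0n.
have -> : i.+1%:R ^+ 2 / (m%:R + q%:R) =
   i%:R ^+ 2 / (m%:R + q%:R) + (2 * i%:R + 1) / (m%:R + q%:R) :> R.
  by rewrite -natr1; field; apply: lt0r_neq0.
rewrite opprD expRD mulrA.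
have i1 : (2 * i%:R + 1) / (m%:R + i%:R + 1) <= 1 :> R.
  rewrite ler_pdivrMr// mul1r.
  by have : i%:R <= m%:R :> R; [rewrite ler_nat ltnW|lra].
apply: ler_pM => //; first by rewrite subr_ge0.
  exact/IH/ltnW.
apply: le_trans (onem_le_expR _) _; rewrite ler_expR lerN2.
rewrite ler_wpM2l ?addr_ge0 ?mulr_ge0// lef_pV2 ?posrE//.
by rewrite -addrA lerD2l natr1 ler_nat.
Qed.

(** The same product bounded from below by [expR (- (v + 2 * v ^+ 2)) <= 1 - v];
    since [v <= 2 * (q / m)], the quadratic terms cost at most
    [8 * (q / m) ^+ 2] for each factor. *)
Lemma bin_ge_gauss (m i q : nat) : (i <= q)%N -> (0 < m)%N -> (4 * q <= m)%N ->
  cbin m * expR (- (i%:R ^+ 2 / m%:R + 8 * (i%:R * (q%:R / m%:R) ^+ 2)))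
    <= 'C(m.*2, m + i)%:R.
Proof.
move=> + m0 qm; elim: i => [_|i IH iq].
  by rewrite addn0 expr0n /= !mul0r mulr0 addr0 oppr0 expR0 mulr1.
have im : (i < m)%N by lia.
rewrite bin_step//.
have p : 0 < m%:R + i%:R + 1 :> R by rewrite ltr_wpDl// addr_ge0.
have mp : 0 < m%:R :> R by rewrite ltr0n.
have q4 : 4 * q%:R <= m%:R :> R by rewrite -natrM ler_nat.
have iqR : i%:R + 1 <= q%:R :> R by rewrite natr1 ler_nat.
have i0 : 0 <= i%:R :> R by [].
set v := (2 * i%:R + 1) / (m%:R + i%:R + 1).
have vm : v <= (2 * i%:R + 1) / m%:R.
  by rewrite /v ler_wpM2l ?addr_ge0 ?mulr_ge0// lef_pV2 ?posrE//; lra.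
have v0 : 0 <= v by rewrite divr_ge0 ?addr_ge0 ?mulr_ge0// ltW.
have v2 : v <= 1 / 2 by apply: (le_trans vm); rewrite ler_pdivrMr//; lra.
have vq : v <= 2 * (q%:R / m%:R).
  by apply: (le_trans vm); rewrite mulrA ler_pdivrMr// mulfVK ?gt_eqF//; lra.
have e : i.+1%:R ^+ 2 / m%:R + 8 * (i.+1%:R * (q%:R / m%:R) ^+ 2) =
   (i%:R ^+ 2 / m%:R + 8 * (i%:R * (q%:R / m%:R) ^+ 2)) +
   ((2 * i%:R + 1) / m%:R + 8 * (q%:R / m%:R) ^+ 2) :> R.
  by rewrite -natr1; field; apply: lt0r_neq0.
rewrite e opprD expRD mulrA.
apply: ler_pM; rewrite ?expR_ge0 ?mulr_ge0 ?expR_ge0 ?(ltW (cbin_gt0 _))//.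
  exact/IH/ltnW.
apply: le_trans (@expR_le_onem _ v _); last by rewrite v0.
rewrite ler_expR lerN2 lerD//.
have : v ^+ 2 <= (2 * (q%:R / m%:R)) ^+ 2 by rewrite lerXn2r// nnegrE (le_trans v0).
by rewrite exprMn; lra.
Qed.

(** The de Moivre-Laplace limit, normalized by the central coefficient.  The size
    of the latter is found from the self-dual theta series ([scale_factor_pi]). *)
Lemma bin_ratio_cvg (q : nat -> nat) (s : R) :
  (fun m => (q m)%:R ^+ 2 / m%:R) @ \oo --> s ->
  (fun m => 'C(m.*2, m + q m)%:R / cbin m) @ \oo --> expR (- s).
Proof.
move=> qs.
have qm0 : (fun m => (q m)%:R / m%:R) @ \oo --> (0 : R).
  have h : (fun m => ((q m)%:R / m%:R) ^+ 2 : R) @ \oo --> (0 : R).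
    have := lim_mul qs cvg_invn; rewrite mulr0 => hlim; apply: (near_eq_lim _ hlim).
    by apply: nearW => m; rewrite /= exprMn expr2 -!mulrA.
  have hlim : (fun m => Num.sqrt (((q m)%:R / m%:R) ^+ 2) : R) @ \oo --> (Num.sqrt 0 : R).
    by apply: (cvg_comp _ _ h); exact: sqrt_continuous.
  move: hlim; rewrite sqrtr0 => hlim; apply: (near_eq_lim _ hlim).
  by apply: nearW => m /=; rewrite sqrtr_sqr ger0_norm// divr_ge0.
apply: (@squeeze_cvgr _ _ _ _
  (fun m => expR (- ((q m)%:R ^+ 2 / m%:R + 8 * ((q m)%:R * ((q m)%:R / m%:R) ^+ 2))))
  (fun m => expR (- ((q m)%:R ^+ 2 / (m%:R + (q m)%:R))))).
- near=> m.
  have m0 : (0 < m)%N by near: m; exact: nbhs_infty_gt.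
  have mp : 0 < m%:R :> R by rewrite ltr0n.
  have q4 : (4 * q m <= m)%N.
    rewrite -(ler_nat R) natrM.
    have : (q m)%:R / m%:R <= 4^-1 :> R.
      by near: m; move/cvgr_le : qm0; apply; lra.
    by rewrite ler_pdivrMr//; lra.
  rewrite ler_pdivlMr ?cbin_gt0// ler_pdivrMr ?cbin_gt0// ![expR _ * _]mulrC.
  by rewrite bin_ge_gauss// bin_le_gauss.
- apply: cvg_expR_comp; apply: cvgN; rewrite -[s in X in _ --> X]addr0.
  apply: cvgD => //; rewrite -[X in _ --> X](mulr0 8); apply: cvgMr.
  rewrite -[X in _ --> X](mulr0 s).
  have := lim_mul qs qm0 => hlim; apply: (near_eq_lim _ hlim).
  by apply: nearW => m /=; rewrite !exprMn !expr2; ring.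
- apply: cvg_expR_comp; apply: cvgN; rewrite -[s in X in _ --> X]divr1.
  have h1 : (fun m => 1 + (q m)%:R / m%:R) @ \oo --> (1 : R).
    by rewrite -[X in _ --> X]addr0; apply: cvgD => //; exact: cvg_cst.
  have h2 : (fun m => (1 + (q m)%:R / m%:R)^-1) @ \oo --> (1^-1 : R).
    by apply: cvgV => //; exact: oner_neq0.
  have hlim := lim_mul qs h2; apply: (near_eq_lim _ hlim).
  near=> m; have mp : 0 < m%:R :> R by rewrite ltr0n; near: m; exact: nbhs_infty_gt.
  have mq : 0 < m%:R + (q m)%:R :> R by rewrite ltr_wpDr.
  by rewrite /=; field; rewrite !gt_eqF.
Unshelve. all: by end_near. Qed.

End Binomial_ratio.

(** * The transformation formula of theta series *)
Section Gaussian_weights.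
Context {R : realType}.

Lemma gauss_zweight (kappa b : R) : 0 < kappa ->
  exists C : R, forall n : int, expR (- (kappa * (n%:~R + b) ^+ 2)) <= C * zweight n.
Proof.
move=> k0; pose C := 1 + 2 * b ^+ 2 + 2 / kappa.
exists C => n; rewrite expRN /zweight.
have y0 := sqr_ge0 (n%:~R + b); set y := (n%:~R + b) ^+ 2 in y0 *.
have e1 : 0 < 1 + kappa * y by rewrite ltr_wpDr// mulr_ge0// ltW.
apply: (@le_trans _ _ (1 + kappa * y)^-1).
  by rewrite lef_pV2 ?posrE ?expR_gt0// expR_ge1Dx.
have n0 : 0 < 1 + n%:~R ^+ 2 :> R by rewrite ltr_wpDr// sqr_ge0.
rewrite -[leLHS]mul1r ler_pdivlMr// mulrAC mul1r ler_pdivrMr//.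
have h : n%:~R ^+ 2 <= 2 * y + 2 * b ^+ 2.
  by have := sqr_ge0 (n%:~R + 2 * b); rewrite /y; lra.
have b0 := sqr_ge0 b.
have -> : C * (1 + kappa * y) = 1 + 2 * b ^+ 2 + 2 * y + 2 / kappa +
    (1 + 2 * b ^+ 2) * (kappa * y).
  by rewrite /C; field; apply: lt0r_neq0.
have : 0 <= (1 + 2 * b ^+ 2) * (kappa * y).
  by apply: mulr_ge0; [lra|rewrite mulr_ge0// ltW].
have : 0 <= 2 / kappa by rewrite divr_ge0// ltW.
lra.
Qed.

Lemma gauss_sum_ccvg (kappa b : R) (z : int -> R[i]) : 0 < kappa ->
  (forall n, cabs (z n) = 1) ->
  let u := fun N => \sum_(n <- zbox N) (expR (- (kappa * (n%:~R + b) ^+ 2)))%:C * z n in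
  ccvg u (clim u).
Proof.
move=> k0 z1; have [C hC] := gauss_zweight b k0.
apply: (@dominated_ccvg _ _ zbox zbox_uniq zbox_incr _ 5 zweight_ge0 zweight_sum _ C).
by move=> n; rewrite cabsM z1 mulr1 cabsR ger0_norm ?expR_ge0.
Qed.

End Gaussian_weights.

Lemma sqr_absz (R : realType) (z : int) : `|z|%N%:R ^+ 2 = z%:~R ^+ 2 :> R.
Proof. by rewrite natr_absz intr_norm real_normK// num_real. Qed.

Section Scaling.
Context {R : realType} (T : R).
Hypothesis T0 : 0 < T.

(** The number [len m] of points in Polya's identity is even and asymptotic to
    [Num.sqrt (m * T)]. *)
Definition half_len (m : nat) : nat := Num.trunc (Num.sqrt (m%:R * T) / 2).
Definition len (m : nat) : nat := (half_len m).*2.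

Lemma sqrtn_infty : (fun m => (Num.sqrt m%:R)^-1 : R) @ \oo --> (0 : R).
Proof.
have h : (fun m : nat => Num.sqrt ((m%:R)^-1) : R) @ \oo --> (Num.sqrt 0 : R).
  by apply: (cvg_comp _ _ (@cvg_invn R)); exact: sqrt_continuous.
move: h; rewrite sqrtr0 => h; apply: (near_eq_lim _ h).
by apply: nearW => m; rewrite sqrtrV.
Qed.

Lemma half_len_bounds m : `|(len m)%:R - Num.sqrt (m%:R * T)| <= 2.
Proof.
rewrite /len -mul2n natrM; set x := Num.sqrt _.
have x0 : 0 <= x / 2 by rewrite divr_ge0 ?sqrtr_ge0.
have := truncn_le (x / 2); rewrite x0 => h1; have h2 := truncnS_gt (x / 2).
rewrite /half_len -/x; move: h1 h2; rewrite -[(Num.trunc _).+1%:R]natr1.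
move: (Num.trunc _)%:R => n h1 h2.
by rewrite ler_norml; apply/andP; split; lra.
Qed.

Lemma len_ratio : (fun m => (len m)%:R / Num.sqrt m%:R) @ \oo --> Num.sqrt T.
Proof.
apply: (@squeeze_cvgr _ _ _ _ (fun m => Num.sqrt T - 2 * (Num.sqrt m%:R)^-1)
  (fun m => Num.sqrt T + 2 * (Num.sqrt m%:R)^-1)).
- near=> m; have m0 : (0 < m)%N by near: m; exact: nbhs_infty_gt.
  have s0 : 0 < Num.sqrt m%:R :> R by rewrite sqrtr_gt0 ltr0n.
  have := half_len_bounds m; rewrite sqrtrM// ler_distl => /andP[h1 h2].
  move: s0 h1 h2; move: (Num.sqrt m%:R) (Num.sqrt T) (len m)%:R => s t x s0 h1 h2.
  have -> : t - 2 * s^-1 = (s * t - 2) / s by field; rewrite gt_eqF.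
  have -> : t + 2 * s^-1 = (s * t + 2) / s by field; rewrite gt_eqF.
  by rewrite !ler_pM2r ?invr_gt0// h1 h2.
- rewrite -[X in _ --> X]subr0; apply: cvgB; first exact: cvg_cst.
  by rewrite -[X in _ --> X](mulr0 2); apply: cvgMr; exact: sqrtn_infty.
- rewrite -[X in _ --> X]addr0; apply: cvgD; first exact: cvg_cst.
  by rewrite -[X in _ --> X](mulr0 2); apply: cvgMr; exact: sqrtn_infty.
Unshelve. all: by end_near. Qed.

Lemma len_sqr_ratio : (fun m => (len m)%:R ^+ 2 / m%:R) @ \oo --> T.
Proof.
have := lim_mul len_ratio len_ratio; rewrite -expr2 sqr_sqrtr ?ltW// => h.
apply: (near_eq_lim _ h); apply: nearW => m.
by rewrite mulrACA -invfM -!expr2 sqr_sqrtr.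
Qed.

Lemma len_gt0 : \forall m \near \oo, (0 < len m)%N.
Proof.
have /cvgr_gt /(_ 0) := len_ratio; rewrite sqrtr_gt0 => /(_ T0).
apply: filterS => m; rewrite lt0n; apply: contraTneq => ->.
by rewrite mul0r ltxx.
Qed.

Lemma len_inv : (fun m => ((len m)%:R)^-1 : R) @ \oo --> (0 : R).
Proof.
have sT : Num.sqrt T != 0 by rewrite gt_eqF// sqrtr_gt0.
have h2 : (fun m => ((len m)%:R / Num.sqrt m%:R)^-1) @ \oo --> ((Num.sqrt T)^-1 : R).
  by apply: cvgV => //; exact: len_ratio.
have := lim_mul h2 sqrtn_infty; rewrite mulr0 => h; apply: (near_eq_lim _ h).
near=> m; have m0 : (0 < m)%N by near: m; exact: nbhs_infty_gt.
have s0 : 0 < Num.sqrt m%:R :> R by rewrite sqrtr_gt0 ltr0n.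
by rewrite invf_div mulrAC mulfV ?mul1r// gt_eqF.
Unshelve. all: by end_near. Qed.

(** The frequency in Polya's identity, such that [shift_len a m / len m] tends
    to [a]. *)
Definition shift_len (a : R) (m : nat) : int := Num.floor (a * (len m)%:R).

Lemma shift_len_ratio a : (fun m => (shift_len a m)%:~R / (len m)%:R) @ \oo --> a.
Proof.
apply: (@squeeze_cvgr _ _ _ _ (fun m => a - ((len m)%:R)^-1) (fun=> a)).
- near=> m; have l0 : (0 < len m)%N by near: m; exact: len_gt0.
  have l1 : 0 < (len m)%:R :> R by rewrite ltr0n.
  have /andP[h1 h2] := floor_itv (a * (len m)%:R).
  move: h2; rewrite intrD => h2.
  rewrite ler_pdivlMr// ler_pdivrMr// mulrBl mulVf ?gt_eqF//.
  by rewrite /shift_len h1 andbT lerBlDr ltW.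
- rewrite -[X in _ --> X]subr0; apply: cvgB; first exact: cvg_cst.
  exact: len_inv.
- exact: cvg_cst.
Unshelve. all: by end_near. Qed.

End Scaling.

Section Theta_sums.
Context {R : realType} (T a b : R).
Hypothesis T0 : 0 < T.

Local Notation l := (len T).
Local Notation c := (shift_len T a).

(** The [l m] integers from here on satisfy [`|j + b| <= l m / 2], so that the
    arguments of the cosines stay in [[- pi / 2, pi / 2]], where [cos_pow_le]
    applies. *)
Let window (m : nat) : int := - (half_len T m)%:Z - Num.floor b.

Let left_term (m : nat) (j : int) : R[i] :=
  if (window m <= j) && (j < window m + (l m)%:Z) then
    e2pi (- ((j%:~R + b) / (l m)%:R * (c m)%:~R)) *
    (cos (pi * ((j%:~R + b) / (l m)%:R)) ^+ m.*2)%:C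
  else 0.

Let right_term (m : nat) (n : int) : R[i] :=
  (binZ m (c m + n * (l m)%:Z) / cbin m)%:C * e2pi (n%:~R * b).

(** A box that contains both the window and all [n] whose binomial coefficient
    does not vanish. *)
Let K (m : nat) : nat := (m + `|c m| + half_len T m + `|Num.floor b|)%N.

Let K_infty N : \forall m \near \oo, (N <= K m)%N.
Proof. by exists N => // m /= Nm; rewrite /K -!addnA (leq_trans Nm)// leq_addr. Qed.

(** Its limit [Num.sqrt (T / pi)] is obtained from the case [T = pi], [a = b = 0],
    where the two limiting series are equal. *)
Definition scale_factor (m : nat) : R := (l m)%:R * (cbin m / 4 ^+ m).

Let terms_eq : \forall m \near \oo,
  \sum_(j <- zbox (K m)) left_term m j =
  (scale_factor m)%:C * \sum_(n <- zbox (K m)) right_term m n.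
Proof.
near=> m; have l0 : (0 < l m)%N by near: m; exact: len_gt0.
have mK : (m + `|c m| <= K m)%N by rewrite /K -!addnA leq_add2l leq_addr.
have := polya_identity (window m) b l0 mK; cbv beta zeta.
have -> : \sum_(i < l m) e2pi (- ((i%:R + ((window m)%:~R + b)) / (l m)%:R * (c m)%:~R)) *
     (cos (pi * ((i%:R + ((window m)%:~R + b)) / (l m)%:R)) ^+ m.*2)%:C =
   \sum_(j <- [seq window m + (nat_of_ord i)%:Z | i <- enum 'I_(l m)]) left_term m j.
  rewrite big_map big_enum/=; apply: eq_bigr => i _.
  rewrite /left_term lerDl lez_nat leq0n ltrD2l ltz_nat ltn_ord /=.
  by rewrite intrD -[(nat_of_ord i)%:Z%:~R]/(i%:R) addrAC addrC.
rewrite (@sum_subset _ _ _ (zbox (K m))); first last.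
- move=> j jW; rewrite /left_term ifF//; apply: contraNF jW => /andP[h1 h2].
  have lt : (`|(j - window m)%R|%N < l m)%N by lia.
  by apply/mapP; exists (Ordinal lt); rewrite ?mem_enum//=; lia.
- move=> _ /mapP[i _ ->]; rewrite mem_zbox /K /window.
  have := ltn_ord i; rewrite {2}/len; move: (nat_of_ord i) => p.
  by move: (Num.floor b) (half_len T m) (c m) => *; lia.
- exact: zbox_uniq.
- rewrite map_inj_uniq ?enum_uniq// => i j /addrI.
  by case=> ij; exact: val_inj.
move=> ->; rewrite /scale_factor /right_term mulr_sumr [RHS]mulr_sumr.
apply: eq_bigr => n _; rewrite [LHS]mulrA [RHS]mulrA; congr (_ * _).
have -> : (l m)%:R / 4 ^+ m = ((l m)%:R / 4 ^+ m)%:C :> R[i].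
  by rewrite rmorphM fmorphV rmorphXn !rmorph_nat.
rewrite -!rmorphM; congr (_%:C).
by field; rewrite expf_neq0//= gt_eqF// cbin_gt0.
Unshelve. all: by end_near. Qed.

Let left_lim (j : int) : ccvg (left_term^~ j)
  ((expR (- (pi ^+ 2 / T * (j%:~R + b) ^+ 2)))%:C * e2pi (- ((j%:~R + b) * a))).
Proof.
pose u m := e2pi (- ((j%:~R + b) / (l m)%:R * (c m)%:~R)) *
    (cos (pi * ((j%:~R + b) / (l m)%:R)) ^+ m.*2)%:C.
apply: (@near_ccvg _ u).
  have hw : \forall m \near \oo, ((`|j| + `|Num.floor b|).+1 < half_len T m)%N.
    have /cvgr_lt /(_ ((`|j| + `|Num.floor b|).+2.*2%:R)^-1) := len_inv T0.
    rewrite invr_gt0 ltr0n => /(_ isT).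
    move=> h; near=> m; have l0 : (0 < l m)%N by near: m; exact: len_gt0.
    have : ((l m)%:R)^-1 < ((`|j| + `|Num.floor b|).+2.*2%:R)^-1 :> R by near: m.
    rewrite ltf_pV2 ?posrE ?ltr0n// ltr_nat /len ltn_double; lia.
  apply: filterS hw => m hm; rewrite /left_term ifT// /window /len.
  move: hm; move: (half_len T m) (Num.floor b) => *; lia.
rewrite mulrC; apply: ccvgM.
  have h : (fun m => 2 * pi * - ((j%:~R + b) * ((c m)%:~R / (l m)%:R))) @ \oo -->
      (2 * pi * - ((j%:~R + b) * a) : R).
    by apply: cvgMr; apply: cvgN; apply: cvgMr; exact: shift_len_ratio.
  have e m : e2pi (- ((j%:~R + b) / (l m)%:R * (c m)%:~R)) =
      expi (2 * pi * - ((j%:~R + b) * ((c m)%:~R / (l m)%:R))) :> R[i].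
    by rewrite /e2pi; congr (expi (_ * - _)); rewrite mulrAC mulrA.
  split.
    under eq_fun do rewrite e; rewrite /=.
    by apply: (cvg_comp _ _ h); exact: continuous_cos.
  under eq_fun do rewrite e; rewrite /=.
  by apply: (cvg_comp _ _ h); exact: continuous_sin.
apply: ccvg_real; apply: cos_pow_cvg.
have h2 : (fun m => ((l m)%:R ^+ 2 / m%:R)^-1) @ \oo --> (T^-1 : R).
  by apply: cvgV; [rewrite gt_eqF|exact: len_sqr_ratio].
have h : (fun m => pi ^+ 2 * (j%:~R + b) ^+ 2 * ((l m)%:R ^+ 2 / m%:R)^-1) @ \oo -->
    (pi ^+ 2 / T * (j%:~R + b) ^+ 2 : R).
  by rewrite [X in _ --> X]mulrAC; apply: cvgMr; exact: h2.
apply: (near_eq_lim _ h); apply: nearW => m.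
by rewrite invf_div !exprMn exprVn; ring.
Unshelve. all: by end_near. Qed.

(** For large [m], [l ^ 2 / m <= 2 * T] turns the bound of [cos_pow_le] into the
    exponent [pi ^+ 2 / (8 * T)]. *)
Let left_bound : exists C, \forall m \near \oo, forall j,
  cabs (left_term m j) <= C * zweight j.
Proof.
have p0 : 0 < pi ^+ 2 / (8 * T) by rewrite divr_gt0 ?exprn_gt0 ?pi_gt0// mulr_gt0.
have [C hC] := gauss_zweight b p0; exists C; near=> m => j.
have l0 : (0 < l m)%N by near: m; exact: len_gt0.
have m0 : (0 < m)%N by near: m; exact: nbhs_infty_gt.
have lR : 0 < (l m)%:R :> R by rewrite ltr0n.
have mR : 0 < m%:R :> R by rewrite ltr0n.
have lT : (l m)%:R ^+ 2 / m%:R <= 2 * T.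
  by near: m; move/cvgr_le : (len_sqr_ratio T0); apply; rewrite ltr_pMl ?ltr1n.
apply: le_trans (hC j); rewrite /left_term; case: ifPn => [/andP[h1 h2]|_]; last first.
  by rewrite cabs0 expR_ge0.
have jb : `|j%:~R + b| <= (half_len T m)%:R.
  have /andP[f1 f2] := floor_itv b.
  have g1 : (- (half_len T m)%:Z - Num.floor b)%:~R <= j%:~R :> R by rewrite ler_int.
  have g2 : (j + 1)%:~R <= (- (half_len T m)%:Z - Num.floor b + (half_len T m).*2%:Z)%:~R :> R.
    by rewrite ler_int lezD1.
  move: f2 g1 g2; rewrite -mul2n PoszM !(intrD, intrN, intrB, intrM).
  rewrite -[_%:Z%:~R]/(_%:R); set h := _%:R => f2 g1 g2.
  by rewrite ler_norml; apply/andP; split; lra.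
rewrite cabsM cabs_e2pi mul1r cabsR ger0_norm; last first.
  by rewrite cos_even_pow exprn_ge0// -cos2sin2 sqr_ge0.
apply: le_trans (cos_pow_le _ _) _.
  rewrite normrM (ger0_norm (pi_ge0 R)) ler_wpM2l ?pi_ge0//.
  rewrite normrM normfV (ger0_norm (ltW lR)) ler_pdivrMr// /len -mul2n natrM.
  by rewrite mulrA mulVf ?mul1r// pnatr_eq0.
rewrite ler_expR lerN2.
have -> : m%:R * ((pi * ((j%:~R + b) / (l m)%:R)) ^+ 2 / 4) =
    (pi ^+ 2 * (j%:~R + b) ^+ 2 / 4) * ((l m)%:R ^+ 2 / m%:R)^-1.
  by field; rewrite !gt_eqF.
have -> : pi ^+ 2 / (8 * T) * (j%:~R + b) ^+ 2 =
   (pi ^+ 2 * (j%:~R + b) ^+ 2 / 4) * (2 * T)^-1.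
  by field; rewrite gt_eqF.
apply: ler_wpM2l.
  by apply: divr_ge0 => //; apply: mulr_ge0; exact: sqr_ge0.
have P1 : 0 < 2 * T by rewrite mulr_gt0.
have P2 : 0 < (l m)%:R ^+ 2 / m%:R :> R by rewrite divr_gt0// exprn_gt0.
by rewrite lef_pV2 ?posrE.
Unshelve. all: by end_near. Qed.

Let right_lim (n : int) : ccvg (right_term^~ n)
  ((expR (- (T * (n%:~R + a) ^+ 2)))%:C * e2pi (n%:~R * b)).
Proof.
apply: ccvgM; last exact: ccvg_cst.
apply: ccvg_real; apply: (@bin_ratio_cvg _ (fun m => `|(c m + n * (l m)%:Z)%R|%N)).
have h1 : (fun m => (c m)%:~R / (l m)%:R + n%:~R) @ \oo --> (a + n%:~R : R).
  by apply: cvgD; [exact: shift_len_ratio|exact: cvg_cst].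
have := lim_mul (len_sqr_ratio T0) (lim_mul h1 h1).
rewrite -expr2 addrC => h; apply: (near_eq_lim _ h).
near=> m; have l0 : (0 < l m)%N by near: m; exact: len_gt0.
have m0 : (0 < m)%N by near: m; exact: nbhs_infty_gt.
have lR : (l m)%:R != 0 :> R by rewrite pnatr_eq0 -lt0n.
have mR : m%:R != 0 :> R by rewrite pnatr_eq0 -lt0n.
rewrite sqr_absz intrD intrM -[(l m)%:Z%:~R]/((l m)%:R).
by field; rewrite lR mR.
Unshelve. all: by end_near. Qed.

(** For large [m], [l ^ 2 / m >= T / 2] and [m + q <= 2 * m] give the exponent
    [T / 4 * (c / l + n) ^+ 2]; replacing [c / l] by [a], at distance at most 1,
    halves the exponent and costs the factor [expR (T / 4)]. *)
Let right_bound : exists C, \forall m \near \oo, forall n,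
  cabs (right_term m n) <= C * zweight n.
Proof.
have p0 : 0 < T / 8 by rewrite divr_gt0.
have [C hC] := gauss_zweight a p0; exists (expR (T / 4) * C); near=> m => n.
have l0 : (0 < l m)%N by near: m; exact: len_gt0.
have m0 : (0 < m)%N by near: m; exact: nbhs_infty_gt.
have lR : 0 < (l m)%:R :> R by rewrite ltr0n.
have mR : 0 < m%:R :> R by rewrite ltr0n.
have lT : T / 2 <= (l m)%:R ^+ 2 / m%:R.
  by near: m; move/cvgr_ge : (len_sqr_ratio T0); apply; lra.
have ca : `|a - (c m)%:~R / (l m)%:R| <= 1.
  by near: m; move/cvgrPdist_le : (@shift_len_ratio _ _ T0 a); exact.
apply: (@le_trans _ _ (expR (T / 4) * expR (- (T / 8 * (n%:~R + a) ^+ 2)))); last first.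
  by rewrite -[leRHS]mulrA ler_wpM2l ?expR_ge0.
rewrite cabsM cabs_e2pi mulr1 cabsR ger0_norm; last by rewrite divr_ge0 ?ler0n.
rewrite ler_pdivrMr ?cbin_gt0// [leRHS]mulrC /binZ.
set q := `|_|%N; have [qm|mq] := leqP q m; last first.
  rewrite bin_small; last by rewrite -addnn ltn_add2l.
  by rewrite !mulr_ge0 ?expR_ge0// ler0n.
apply: le_trans (bin_le_gauss (leqnn q) m0) _.
rewrite ler_wpM2l ?(ltW (cbin_gt0 _))// -expRD ler_expR.
have q2 : q%:R ^+ 2 = (l m)%:R ^+ 2 * ((c m)%:~R / (l m)%:R + n%:~R) ^+ 2 :> R.
  rewrite /q sqr_absz intrD intrM -[(l m)%:Z%:~R]/((l m)%:R).
  by field; rewrite gt_eqF.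
have qmR : q%:R <= m%:R :> R by rewrite ler_nat.
have : q%:R ^+ 2 / (2 * m%:R) <= q%:R ^+ 2 / (m%:R + q%:R) :> R.
  rewrite ler_wpM2l ?sqr_ge0// lef_pV2 ?posrE ?mulr_gt0//; first by lra.
  by rewrite ltr_wpDr.
have : q%:R ^+ 2 / (2 * m%:R) = ((l m)%:R ^+ 2 / m%:R) / 2 *
   ((c m)%:~R / (l m)%:R + n%:~R) ^+ 2 :> R.
  by rewrite q2; field; rewrite !gt_eqF.
move: ca; set x := (c m)%:~R / _ => ca -> h.
have xa : (a - x) ^+ 2 <= 1.
  by rewrite -(expr1n R 2) -real_normK ?num_real// lerXn2r// nnegrE.
have h3 : T / 2 / 2 * (x + n%:~R) ^+ 2 <= (l m)%:R ^+ 2 / m%:R / 2 * (x + n%:~R) ^+ 2.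
  by rewrite ler_wpM2r ?sqr_ge0// ler_pM2r.
have h4 : 0 <= T * ((x + n%:~R) ^+ 2 - (n%:~R + a) ^+ 2 / 2 + 1).
  apply: mulr_ge0; first exact: ltW.
  by have := sqr_ge0 (2 * x - a + n%:~R); lra.
by lra.
Unshelve. all: by end_near. Qed.

Lemma theta_limits :
  let SL := clim (fun N => \sum_(j <- zbox N)
    (expR (- (pi ^+ 2 / T * (j%:~R + b) ^+ 2)))%:C * e2pi (- ((j%:~R + b) * a))) in
  let SR := clim (fun N => \sum_(n <- zbox N)
    (expR (- (T * (n%:~R + a) ^+ 2)))%:C * e2pi (n%:~R * b)) in
  exists u v : nat -> R[i],
  [/\ ccvg u SL, ccvg v SR & \forall m \near \oo, u m = (scale_factor m)%:C * v m].
Proof.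
move=> SL SR.
exists (fun m => \sum_(j <- zbox (K m)) left_term m j).
exists (fun m => \sum_(n <- zbox (K m)) right_term m n).
have p0 : 0 < pi ^+ 2 / T by rewrite divr_gt0 ?exprn_gt0 ?pi_gt0.
split; last exact: terms_eq.
- have [C hC] := left_bound.
  apply: (tannery (@zbox_uniq) zbox_incr zweight_ge0 zweight_sum K_infty left_lim hC).
  by apply: (gauss_sum_ccvg _ p0) => n; exact: cabs_e2pi.
- have [C hC] := right_bound.
  apply: (tannery (@zbox_uniq) zbox_incr zweight_ge0 zweight_sum K_infty right_lim hC).
  by apply: (gauss_sum_ccvg _ T0) => n; exact: cabs_e2pi.
Qed.

End Theta_sums.

Section Theta.
Context {R : realType}.

Definition theta_term (t a b : R) (n : int) : R[i] :=
  (expR (- (pi * t * (n%:~R + a) ^+ 2)))%:C * e2pi (n%:~R * b).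

Definition theta_sum (t a b : R) (N : nat) : R[i] := \sum_(n <- zbox N) theta_term t a b n.

Lemma theta_sum_ccvg (t a b : R) : 0 < t -> ccvg (theta_sum t a b) (clim (theta_sum t a b)).
Proof.
move=> t0; have p0 : 0 < pi * t by rewrite mulr_gt0 ?pi_gt0.
by apply: (gauss_sum_ccvg a p0) => n; exact: cabs_e2pi.
Qed.

Lemma theta00_real (N : nat) (t : R) :
  theta_sum t 0 0 N = (\sum_(n <- zbox N) expR (- (pi * t * n%:~R ^+ 2)))%:C.
Proof.
rewrite rmorph_sum /theta_sum; apply: eq_bigr => n _.
by rewrite /theta_term mulr0 e2pi0 mulr1 addr0.
Qed.

Lemma theta00_gt0 (t : R) : 0 < t -> 0 < complex.Re (clim (theta_sum t 0 0)).
Proof.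
move=> t0; have [h _] := theta_sum_ccvg 0 0 t0.
apply: (@lt_le_trans _ _ 1) => //; rewrite -(cvg_lim _ h)//.
apply: limr_ge; first exact: cvgP h.
apply: nearW => N; rewrite theta00_real /=.
have z0 : 0 \in zbox N by rewrite mem_zbox.
rewrite (bigD1_seq 0) ?zbox_uniq//= expr0n mulr0 oppr0 expR0 lerDl.
by apply: sumr_ge0 => n _; exact: expR_ge0.
Qed.

(** For [T = pi] and [a = b = 0] both series converge to the same positive
    number. *)
Lemma scale_factor_pi : scale_factor pi @ \oo --> (1 : R).
Proof.
have [u [v [uS vS uv]]] := theta_limits 0 0 (pi_gt0 R).
set SL := clim _ in uS; set SR := clim _ in vS.
have e1 : SL = clim (theta_sum 1 0 0).
  congr clim; apply/funext => N; apply: eq_bigr => n _; rewrite /theta_term.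
  by rewrite !mulr0 oppr0 e2pi0 !mulr1 expr2 mulfK ?gt_eqF ?pi_gt0.
have e2 : SR = clim (theta_sum 1 0 0).
  congr clim; apply/funext => N; apply: eq_bigr => n _; rewrite /theta_term.
  by rewrite mulr1.
move: uS vS; rewrite e1 e2; move: (theta00_gt0 (@ltr01 R)).
move: (clim _) => S S0 [ur _] [vr _].
have h2 : (fun m => (complex.Re (v m))^-1) @ \oo --> ((complex.Re S)^-1 : R).
  by apply: cvgV => //; rewrite gt_eqF.
have := lim_mul ur h2; rewrite mulfV ?gt_eqF// => h; apply: (near_eq_lim _ h).
have vp : \forall m \near \oo, 0 < complex.Re (v m) by move/cvgr_gt : vr; exact.
near=> m; have -> : u m = (scale_factor pi m)%:C * v m by near: m.
have v0 : 0 < complex.Re (v m) by near: m.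
move: v0; case: (v m) => x y /= x0; rewrite mul0r subr0 mulfK ?gt_eqF//.
Unshelve. all: by end_near. Qed.

(** [scale_factor T m] depends on [T] through the factor [len T m] only, which is
    asymptotic to [Num.sqrt (m * T)]. *)
Lemma scale_factor_cvg (t : R) : 0 < t -> scale_factor (pi * t) @ \oo --> Num.sqrt t.
Proof.
move=> t0; have p0 := pi_gt0 R.
have pt0 : 0 < pi * t by rewrite mulr_gt0.
have sp : Num.sqrt pi != 0 :> R by rewrite gt_eqF// sqrtr_gt0.
have h2 : (fun m => ((len (pi : R) m)%:R / Num.sqrt m%:R)^-1 : R) @ \oo --> ((Num.sqrt (pi : R))^-1 : R).
  by apply: cvgV => //; exact: len_ratio.
have := lim_mul scale_factor_pi (lim_mul h2 (@len_ratio _ (pi * t))).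
rewrite mul1r sqrtrM ?ltW// mulrA mulVf// mul1r => h; apply: (near_eq_lim _ h).
near=> m.
have m0 : (0 < m)%N by near: m; exact: nbhs_infty_gt.
have s0 : Num.sqrt m%:R != 0 :> R by rewrite gt_eqF// sqrtr_gt0 ltr0n.
have l0 : (len (pi : R) m)%:R != 0 :> R.
  by rewrite pnatr_eq0 -lt0n; near: m; exact: (len_gt0 p0).
by rewrite /scale_factor; field; rewrite s0 l0 expf_neq0.
Unshelve. all: by end_near. Qed.

(** The limit of Polya's identity, where [scale_factor_cvg] supplies the constant. *)
Theorem theta_transformation (t a b : R) : 0 < t ->
  clim (theta_sum t^-1 b (- a)) = (Num.sqrt t)%:C * e2pi (a * b) * clim (theta_sum t a b).
Proof.
move=> t0; have p0 := pi_gt0 R.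
have pt0 : 0 < pi * t by rewrite mulr_gt0.
have [u [v [uS vS uv]]] := theta_limits a b pt0.
move: uS vS; set SL := clim _; set SR := clim _ => uS vS.
have e1 : SL = e2pi (- (a * b)) * clim (theta_sum t^-1 b (- a)).
  apply: ccvg_clim.
  have := ccvgZ (e2pi (- (a * b))) (@theta_sum_ccvg t^-1 b (- a) _).
  rewrite invr_gt0 => /(_ t0); congr ccvg; apply/funext => N.
  rewrite /theta_sum mulr_sumr; apply: eq_bigr => n _; rewrite /theta_term mulrCA -e2piD.
  have -> : - (a * b) + n%:~R * - a = - ((n%:~R + b) * a) by ring.
  have -> : pi * t^-1 = pi ^+ 2 / (pi * t).
    by rewrite expr2 invfM mulrA mulfK ?gt_eqF.
  done.
have e2 : SR = clim (theta_sum t a b) by [].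
have : ccvg u ((Num.sqrt t)%:C * SR).
  apply: (@near_ccvg _ (fun m => (scale_factor (pi * t) m)%:C * v m)).
    by apply: filterS uv => m ->.
  by apply: ccvgM => //; apply: ccvg_real; exact: scale_factor_cvg.
move/(ccvg_unique uS); rewrite e1 e2 => h.
rewrite mulrAC -h mulrAC -e2piD addNr e2pi0 mul1r//.
Qed.

End Theta.

Section Theta_multi.
Context {R : realType} {k : nat}.
Implicit Types (eta xi : 'rV[R]_k).

Definition mtheta_term (t : R) (eta xi : 'rV[R]_k) (m : 'rV[int]_k) : R[i] :=
  (expR (- (pi * t * enorm (zvec m + eta) ^+ 2)))%:C * e2pi (dotv (zvec m) xi).

Lemma dotv_ge0 (u : 'rV[R]_k) : 0 <= dotv u u.
Proof. by apply: sumr_ge0 => i _; rewrite -expr2 sqr_ge0. Qed.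

Lemma enorm_sqr (u : 'rV[R]_k) : enorm u ^+ 2 = \sum_i u 0 i ^+ 2.
Proof. by rewrite sqr_sqrtr ?dotv_ge0//; apply: eq_bigr => i _; rewrite expr2. Qed.

Lemma mtheta_term_prod t eta xi m :
  mtheta_term t eta xi m = \prod_i theta_term t (eta 0 i) (xi 0 i) (m 0 i).
Proof.
rewrite big_split/= /mtheta_term -rmorph_prod/= -expR_sum; congr (_%:C * _).
  rewrite sumrN -mulr_sumr enorm_sqr; congr (expR (- (_ * _))).
  by apply: eq_bigr => i _; rewrite !mxE.
rewrite /e2pi -expi_sum -mulr_sumr; congr (expi (_ * _)).
by apply: eq_bigr => i _; rewrite !mxE.
Qed.

Lemma mtheta_ccvg t eta xi : 0 < t ->
  ccvg (fun N => \sum_(m <- box k N) mtheta_term t eta xi m)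
       (\prod_i clim (theta_sum t (eta 0 i) (xi 0 i))).
Proof.
move=> t0.
have e N : \sum_(m <- box k N) mtheta_term t eta xi m =
    \prod_i theta_sum t (eta 0 i) (xi 0 i) N.
  rewrite -(big_box_prod N (fun i => theta_term t (eta 0 i) (xi 0 i))).
  by apply: eq_bigr => m _; exact: mtheta_term_prod.
under eq_fun do rewrite e.
by apply: ccvg_prod => i; exact: theta_sum_ccvg.
Qed.

Theorem mtheta_transformation t eta xi : 0 < t ->
  \prod_i clim (theta_sum t^-1 (xi 0 i) ((- eta) 0 i)) =
  (Num.sqrt t ^+ k)%:C * e2pi (dotv eta xi) *
  \prod_i clim (theta_sum t (eta 0 i) (xi 0 i)).
Proof.
move=> t0; under eq_bigr do rewrite mxE theta_transformation//.
rewrite big_split/= big_split/= prodr_const card_ord rmorphXn/=; congr (_ * _ * _).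
by rewrite /e2pi -expi_sum -mulr_sumr.
Qed.

End Theta_multi.

(** * Integrals of functions dominated by a Gaussian *)
Section Derivative_rules.
Context {R : realType}.
Implicit Types (f g : R -> R) (x a b : R).

Lemma derD f g x a b : is_derive x (1 : R) f a -> is_derive x (1 : R) g b ->
  is_derive x (1 : R) (fun y => f y + g y) (a + b).
Proof. by move=> fa gb; exact: is_deriveD. Qed.

Lemma derB f g x a b : is_derive x (1 : R) f a -> is_derive x (1 : R) g b ->
  is_derive x (1 : R) (fun y => f y - g y) (a - b).
Proof. by move=> fa gb; exact: is_deriveB. Qed.

Lemma derM f g x a b : is_derive x (1 : R) f a -> is_derive x (1 : R) g b ->
  is_derive x (1 : R) (fun y => f y * g y) (a * g x + f x * b).
Proof.
move=> fa gb; have := is_deriveM fa gb => h.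
by apply: (is_derive_eq h); rewrite addrC mulrC; congr (_ + _); rewrite mulrC.
Qed.

Lemma der_cst x c : is_derive x (1 : R) (fun=> c : R) 0.
Proof. exact: is_derive_cst. Qed.

Lemma der_id x : is_derive x (1 : R) (fun y : R => y) 1.
Proof. exact: is_derive_id. Qed.

Lemma derZ f x a c : is_derive x (1 : R) f a -> is_derive x (1 : R) (fun y => c * f y) (c * a).
Proof.
by move=> fa; apply: (is_derive_eq (derM (der_cst x c) fa)); rewrite mul0r add0r.
Qed.

Lemma derX x n : is_derive x (1 : R) (fun y : R => y ^+ n) (n%:R * x ^+ n.-1).
Proof.
elim: n => [|n IH].
  rewrite mul0r; have -> : (fun y : R => y ^+ 0) = (fun=> 1) by apply/funext => y.
  exact: der_cst.
have -> : (fun y : R => y ^+ n.+1) = (fun y => y * y ^+ n).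
  by apply/funext => y; rewrite exprS.
apply: (is_derive_eq (derM (der_id x) IH)).
rewrite mul1r mulrCA -natr1 mulrDl mul1r /= addrC; congr (_ + _).
by case: n {IH} => [|n]; rewrite ?mul0r//= -exprS.
Qed.

Lemma der_comp f g x a b : is_derive (g x) (1 : R) f a -> is_derive x (1 : R) g b ->
  is_derive x (1 : R) (fun y => f (g y)) (a * b).
Proof. by move=> fa gb; exact: is_derive1_comp. Qed.

Lemma der_scale x c : is_derive x (1 : R) (fun y => c * y) c.
Proof. by apply: (is_derive_eq (derZ c (der_id x))); rewrite mulr1. Qed.

Lemma der_gauss x c : is_derive x (1 : R) (fun y => expR (- (c * y ^+ 2)))
  (- (2 * c * x) * expR (- (c * x ^+ 2))).
Proof.
have h : is_derive x (1 : R) (fun y => (- c) * y ^+ 2) ((- c) * (2%:R * x ^+ 1)).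
  by apply: derZ; exact: derX.
have := der_comp (is_derive_expR _) h => k.
have e : (fun y : R => expR (- (c * y ^+ 2))) = (fun y => expR (- c * y ^+ 2)).
  by apply/funext => y; rewrite mulNr.
rewrite e; apply: (is_derive_eq k); rewrite mulNr expr1; ring.
Qed.

Lemma der_continuous f (f' : R -> R) : (forall x, is_derive x (1 : R) f (f' x)) -> continuous f.
Proof.
move=> h x; apply: differentiable_continuous; apply/derivable1_diffP.
by case: (h x).
Qed.

Lemma der_derivable f x a : is_derive x (1 : R) f a -> derivable f x 1.
Proof. by case. Qed.

Lemma der_val f x a : is_derive x (1 : R) f a -> derive1 f x = a.
Proof. by move=> h; rewrite derive1E; case: h. Qed.

Lemma der_unique f x a b : is_derive x (1 : R) f a -> is_derive x (1 : R) f b -> a = b.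
Proof. by move=> /der_val <- /der_val. Qed.

End Derivative_rules.

Section Gaussian_dominated.
Context {R : realType}.
Local Notation mu := (@lebesgue_measure R).

(** One hypothesis that yields integrability on the line, vanishing boundary terms
    and a bound on the integral. *)
Definition gdom (f : R -> R) (C : R) :=
  continuous f /\ forall x, `|f x| <= C * gauss_fun x.

Lemma gdom_integrable f C : gdom f C -> mu.-integrable [set: R] (EFin \o f).
Proof.
move=> [cf fC].
apply: (le_integrable measurableT _ _ (integrableZl measurableT C (@integrableT_gauss R))).
- by apply/measurable_EFinP; exact: continuous_measurable_fun.
- by move=> x _; rewrite /= lee_fin (le_trans (fC x))// ler_norm.
Qed.

Lemma gdom_bound f C : gdom f C -> `|\int[mu]_x f x| <= C * Num.sqrt pi.
Proof.
move=> fC; have fi := gdom_integrable fC.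
apply: le_trans (le_normr_Rintegral _ fi) _ => //.
have -> : C * Num.sqrt pi = \int[mu]_x (C * gauss_fun x).
  rewrite RintegralZl//; last exact: integrableT_gauss.
  by rewrite /Rintegral integralT_gauss.
apply: le_Rintegral => //.
- exact: integrable_norm.
- by apply: (integrableZl measurableT C (@integrableT_gauss R)).
- by move=> x _; exact: fC.2.
Qed.

Lemma gdomD f g C C' : gdom f C -> gdom g C' -> gdom (fun x => f x + g x) (C + C').
Proof.
move=> [cf hf] [cg hg]; split=> [x|x]; first by apply: cvgD; [exact: cf|exact: cg].
by apply: (le_trans (ler_normD _ _)); rewrite mulrDl lerD.
Qed.

Lemma gdomB f g C C' : gdom f C -> gdom g C' -> gdom (fun x => f x - g x) (C + C').
Proof.
move=> [cf hf] [cg hg]; split=> [x|x]; first by apply: cvgB; [exact: cf|exact: cg].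
by apply: (le_trans (ler_normB _ _)); rewrite mulrDl lerD.
Qed.

Lemma gdomM f h C : gdom f C -> continuous h -> (forall x, `|h x| <= 1) ->
  gdom (fun x => f x * h x) C.
Proof.
move=> [cf hf] ch h1; split=> [x|x]; first by apply: cvgM; [exact: cf|exact: ch].
by rewrite normrM -[leRHS]mulr1 ler_pM.
Qed.

Lemma gdomZ f C c : gdom f C -> gdom (fun x => c * f x) (`|c| * C).
Proof.
move=> [cf hf]; split=> [x|x]; first by apply: cvgMr; exact: cf.
by rewrite normrM -mulrA ler_wpM2l.
Qed.

(** Reduces the integral over the line to compact intervals, where the fundamental
    theorem of calculus and the change of variables take place. *)
Lemma gdom_trunc f C : gdom f C ->
  (fun n : nat => \int[mu]_(x in `[- n%:R, n%:R]) f x) @ \oo --> \int[mu]_x f x.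
Proof.
move=> fC; have fi := gdom_integrable fC; have [cf hf] := fC.
have mf : measurable_fun [set: R] f by exact: continuous_measurable_fun.
pose D n := `[- n%:R, n%:R]%classic : set R.
have ig : mu.-integrable [set: R] (EFin \o (fun x => C * gauss_fun x)).
  by apply: (integrableZl measurableT C (@integrableT_gauss R)).
have mD n : measurable (D n) by exact: measurable_itv.
have C0 : 0 <= C.
  have := le_trans (normr_ge0 _) (hf 0); rewrite pmulr_lge0// expR_gt0//.
have [] := @dominated_convergence _ _ _ mu setT measurableT
  (fun n x => ((f \_ (D n)) x)%:E) (EFin \o f) (EFin \o (fun x => C * gauss_fun x)).
- move=> n; apply/measurable_EFinP.
  by apply/(measurable_restrictT f (mD n)); exact: measurable_funTS.
- exact/measurable_EFinP.
- apply: aeW => x _; apply: cvg_near_cst.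
  exists (Num.trunc `|x|).+1 => // n /= xn.
  rewrite patchE mem_set//= /D /= in_itv/= -ler_norml.
  apply: le_trans (ltW (truncnS_gt _)) _.
  by rewrite ler_nat.
- exact: ig.
- apply: aeW => x n _ /=; rewrite lee_fin patchE; case: ifPn => // _.
  by rewrite normr0 mulr_ge0// gauss_fun_ge0.
move=> _ _ /= h.
have e : (\int[mu]_x (f x)%:E = (\int[mu]_x f x)%:E)%E.
  by rewrite fineK//; exact: integrable_fin_num.
have {}h : (\int[mu]_x ((f \_ (D n)) x)%:E)%E @[n --> \oo] --> (\int[mu]_x f x)%:E.
  by rewrite -e.
have h' := fine_cvg h; apply: near_eq_lim (h' _); apply: nearW => n.
by rewrite [RHS]Rintegral_mkcond.
Qed.

Lemma gauss_fun_cvg0 C : (fun n : nat => C * gauss_fun (n%:R : R)) @ \oo --> (0 : R).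
Proof.
have h : (fun n : nat => gauss_fun (n%:R : R)) @ \oo --> (0 : R).
  by apply: (cvg_comp _ _ (@cvgr_idn R)); exact: cvg_gauss_fun.
by rewrite -[X in _ --> X](mulr0 C); apply: cvgMr.
Qed.

Lemma integral_derivative_gdom F f C C' : (forall x, is_derive x (1 : R) F (f x)) ->
  gdom F C -> gdom f C' -> \int[mu]_x f x = 0.
Proof.
move=> Ff [cF hF] fC; have [cf _] := fC.
have h := gdom_trunc fC.
have F0 : (fun n : nat => F n%:R - F (- n%:R)) @ \oo --> (0 : R).
  have z : (fun n : nat => - ((C + C) * gauss_fun (n%:R : R))) @ \oo --> (0 : R).
    by rewrite -oppr0; apply: cvgN; exact: gauss_fun_cvg0.
  apply: (squeeze_cvgr _ z (gauss_fun_cvg0 (C + C))).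
  apply: nearW => n; rewrite -ler_norml mulrDl.
  apply: (le_trans (ler_normB _ _)); apply: lerD; first exact: hF.
  by apply: (le_trans (hF _)); rewrite /gauss_fun sqrrN.
apply: (cvg_unique _ h); first exact: norm_hausdorff.
apply: near_eq_lim F0; exists 1%N => // n /= n1.
have n0 : - n%:R < n%:R :> R by rewrite gtrN// ltr0n.
rewrite /Rintegral (@continuous_FTC2 _ f F)//.
- by apply: continuous_subspaceT; exact: cf.
- split.
  + by move=> x _; case: (Ff x).
  + by apply: cvg_at_right_filter; exact: cF.
  + by apply: cvg_at_left_filter; exact: cF.
- by move=> x _; exact: der_val.
Qed.

Lemma integral_reflection f C : gdom f C -> \int[mu]_x f (- x) = \int[mu]_x f x.
Proof.
move=> fC; have [cf hf] := fC.
have gC : gdom (fun x => f (- x)) C.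
  split=> [x|x]; first by apply: continuous_comp; [exact: oppr_continuous|exact: cf].
  by apply: (le_trans (hf _)); rewrite /gauss_fun sqrrN.
apply: (cvg_unique _ (gdom_trunc gC)); first exact: norm_hausdorff.
apply: near_eq_lim (gdom_trunc fC); apply: nearW => n.
have n0 : - n%:R <= n%:R :> R by rewrite ge0_cp.
rewrite /Rintegral; congr fine.
have := @integration_by_substitution_oppr R f (- n%:R) n%:R n0.
rewrite opprK; apply.
by apply: continuous_subspaceT; exact: cf.
Qed.

End Gaussian_dominated.

(** * Sine and cosine transforms *)
Section Gaussian_transform.
Context {R : realType}.
Local Notation mu := (@lebesgue_measure R).
Implicit Types (a r x : R).

Definition sint (f : R -> R) (r : R) : R := \int[mu]_x (f x * sin (2 * pi * r * x)).
Definition cost (f : R -> R) (r : R) : R := \int[mu]_x (f x * cos (2 * pi * r * x)).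

Lemma scale_continuous (c : R) : continuous (fun x : R => c * x).
Proof. by apply: der_continuous => x; exact: der_scale. Qed.

Lemma sin_scale_continuous (c : R) : continuous (fun x : R => sin (c * x)).
Proof.
by move=> x; apply: continuous_comp; [exact: scale_continuous|exact: continuous_sin].
Qed.

Lemma cos_scale_continuous (c : R) : continuous (fun x : R => cos (c * x)).
Proof.
by move=> x; apply: continuous_comp; [exact: scale_continuous|exact: continuous_cos].
Qed.

Lemma gdom_sin f C c : gdom f C -> gdom (fun x : R => f x * sin (c * x)) C.
Proof.
by move=> fC; apply: gdomM => //; [exact: sin_scale_continuous|move=> x; exact: sin_max].
Qed.

Lemma gdom_cos f C c : gdom f C -> gdom (fun x : R => f x * cos (c * x)) C.
Proof.
by move=> fC; apply: gdomM => //; [exact: cos_scale_continuous|move=> x; exact: cos_max].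
Qed.

Lemma der_sin x c : is_derive x (1 : R) (fun y => sin (c * y)) (c * cos (c * x)).
Proof.
by rewrite mulrC; apply: (der_comp (is_derive_sin _)); exact: der_scale.
Qed.

Lemma der_cos x c : is_derive x (1 : R) (fun y => cos (c * y)) (- (c * sin (c * x))).
Proof.
by rewrite mulrC -mulNr; apply: (der_comp (is_derive_cos _)); exact: der_scale.
Qed.

Lemma ibp_cos (f f' : R -> R) (C C' r : R) : (forall x, is_derive x (1 : R) f (f' x)) ->
  gdom f C -> gdom f' C' -> 2 * pi * r * sint f r = cost f' r.
Proof.
move=> ff fC fC'; apply/eqP; rewrite eq_sym -subr_eq0; apply/eqP.
have i1 := gdom_cos (2 * pi * r) fC'; have i2 := gdom_sin (2 * pi * r) fC.
have i3 := gdomZ (2 * pi * r) i2.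
rewrite -RintegralZl// -?RintegralB//; [|exact: gdom_integrable i1|
  exact: gdom_integrable i3|exact: gdom_integrable i2].
apply: (@integral_derivative_gdom _ (fun x => f x * cos (2 * pi * r * x))); last first.
- exact: gdomB i1 i3.
- exact: (gdom_cos _ fC).
- move=> x; apply: (is_derive_eq (derM (ff x) (der_cos x (2 * pi * r)))).
  by rewrite mulrN mulrCA.
Qed.

Lemma ibp_sin (f f' : R -> R) (C C' r : R) : (forall x, is_derive x (1 : R) f (f' x)) ->
  gdom f C -> gdom f' C' -> 2 * pi * r * cost f r = - sint f' r.
Proof.
move=> ff fC fC'; apply/eqP; rewrite eq_sym -subr_eq0 -opprD oppr_eq0; apply/eqP.
have i1 := gdom_sin (2 * pi * r) fC'; have i2 := gdom_cos (2 * pi * r) fC.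
have i3 := gdomZ (2 * pi * r) i2.
rewrite -RintegralZl// -?RintegralD//; [|exact: gdom_integrable i1|
  exact: gdom_integrable i3|exact: gdom_integrable i2].
apply: (@integral_derivative_gdom _ (fun x => f x * sin (2 * pi * r * x))); last first.
- exact: gdomD i1 i3.
- exact: (gdom_sin _ fC).
- move=> x; apply: (is_derive_eq (derM (ff x) (der_sin x (2 * pi * r)))).
  by rewrite [f x * _]mulrCA.
Qed.

Lemma sqr_pow_le_expR n x : x ^+ n.*2 <= n`!%:R * expR (x ^+ 2).
Proof.
case: n => [|n]; first by rewrite expr0 fact0 mul1r -expR0 ler_expR sqr_ge0.
have := expR_ge1Dxn n (sqr_ge0 x); rewrite -exprM mul2n => h.
have f0 : 0 < n.+1`!%:R :> R by rewrite ltr0n fact_gt0.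
rewrite mulrC -ler_pdivrMr//; apply: le_trans h.
by rewrite lerDr.
Qed.

Lemma normX_le_expR n x : `|x| ^+ n <= (1 + n`!%:R) * expR (x ^+ 2).
Proof.
have e1 : 1 <= expR (x ^+ 2) by rewrite -expR0 ler_expR sqr_ge0.
rewrite mulrDl mul1r; apply: (@le_trans _ _ (1 + x ^+ n.*2)); last first.
  by rewrite lerD// sqr_pow_le_expR.
rewrite -mul2n exprM -[x ^+ 2]real_normK ?num_real// -exprM mul2n.
have [x1|x1] := leP `|x| 1.
  apply: (@le_trans _ _ 1); first by rewrite exprn_ile1.
  by rewrite lerDl exprn_ge0.
apply: (@le_trans _ _ (`|x| ^+ n.*2)); last by rewrite lerDr.
by rewrite ler_weXn2l ?(ltW x1)// -addnn leq_addr.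
Qed.

Definition gfun (a x : R) : R := expR (- (a * x ^+ 2)).

Lemma gfun_continuous a : continuous (gfun a).
Proof. by apply: der_continuous => x; exact: der_gauss. Qed.

Lemma pow_continuous n : continuous (fun x : R => x ^+ n).
Proof. by apply: der_continuous => x; exact: derX. Qed.

(** One of the two factors [expR (- x ^+ 2)] in [gfun 2 x] absorbs the power of
    [x].  For this reason errors are measured against [gfun 2] throughout. *)
Lemma gdom_pow_mul n (f : R -> R) (e : R) : continuous f ->
  (forall x, `|f x| <= e * gfun 2 x) ->
  gdom (fun x => x ^+ n * f x) ((1 + n`!%:R) * e).
Proof.
move=> cf fe; split=> [x|x]; first by apply: cvgM; [exact: pow_continuous|exact: cf].
rewrite normrM normrX.
apply: (@le_trans _ _ ((1 + n`!%:R) * expR (x ^+ 2) * (e * gfun 2 x))).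
  by rewrite ler_pM ?exprn_ge0 ?normX_le_expR.
rewrite /gfun mulrACA -expRD.
by have -> : x ^+ 2 + - (2 * x ^+ 2) = - x ^+ 2 by ring.
Qed.

Lemma gfun_le2 a x : 2 <= a -> gfun a x <= gfun 2 x.
Proof. by move=> a2; rewrite ler_expR lerN2 ler_wpM2r// sqr_ge0. Qed.

Lemma gdom_pow_gfun n a : 2 <= a -> gdom (fun x => x ^+ n * gfun a x) (1 + n`!%:R).
Proof.
move=> a2; rewrite -[1 + _]mulr1; apply: gdom_pow_mul; first exact: gfun_continuous.
by move=> x; rewrite mul1r ger0_norm ?expR_ge0// gfun_le2.
Qed.

Lemma gdom_gfun a : 2 <= a -> gdom (gfun a) 1.
Proof.
move=> a2; split; first exact: gfun_continuous.
move=> x; rewrite mul1r ger0_norm ?expR_ge0//; apply: (le_trans (gfun_le2 _ a2)).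
by rewrite ler_expR lerN2 ler_peMl ?sqr_ge0//; lra.
Qed.

Lemma sint_xgfun a r : 2 <= a -> sint (fun x => x * gfun a x) r = pi * r / a * cost (gfun a) r.
Proof.
move=> a2; have a0 : 0 < a by lra.
have g1 := @gdom_pow_gfun 1 a a2.
have g2 : gdom (fun x => - (2 * a * x) * gfun a x) (`|- (2 * a)| * (1 + 1`!%:R)).
  have -> : (fun x => - (2 * a * x) * gfun a x) = (fun x => - (2 * a) * (x ^+ 1 * gfun a x)).
    by apply/funext => x; ring.
  exact: gdomZ.
have := @ibp_sin _ _ _ _ r (fun x => der_gauss x a) (gdom_gfun a2) g2.
have -> : sint (fun x => - (2 * a * x) * expR (- (a * x ^+ 2))) r =
    - (2 * a) * sint (fun x => x * gfun a x) r.
  rewrite /sint -RintegralZl//; last first.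
    exact: (gdom_integrable (gdom_sin (2 * pi * r) g1)).
  by apply: eq_Rintegral => x _; rewrite /gfun; ring.
rewrite -/(gfun a) mulNr opprK => h.
have a2' : 2 * a != 0 by rewrite gt_eqF// mulr_gt0.
by apply: (mulfI a2'); rewrite -h; field; rewrite gt_eqF.
Qed.

Lemma der_cost_gfun a r : 2 <= a ->
  is_derive r (1 : R) (cost (gfun a)) (- (2 * pi) * sint (fun x => x * gfun a x) r).
Proof.
move=> a2.
pose f := fun r x : R => gfun a x * cos (2 * pi * r * x).
have g1 := @gdom_pow_gfun 1 a a2.
have df (y s : R) : is_derive s (1 : R) (f^~ y) (gfun a y * - (2 * pi * y * sin (2 * pi * s * y))).
  apply: derZ.
  have -> : (fun s : R => cos (2 * pi * s * y)) = (fun s => cos (2 * pi * y * s)).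
    by apply/funext => z; congr cos; ring.
  have -> : 2 * pi * s * y = 2 * pi * y * s by ring.
  exact: der_cos.
have Ir : `](r - 1), (r + 1)[%classic r by rewrite /= in_itv/=; apply/andP; split; lra.
have G_int : mu.-integrable [set: R]
    (EFin \o (fun x => (2 * pi * (1 + 1`!%:R)) * gauss_fun x)).
  exact: (integrableZl measurableT (2 * pi * (1 + 1`!%:R)) (@integrableT_gauss R)).
have G_ge0 (x : R) : 0 <= 2 * pi * (1 + 1`!%:R) * gauss_fun x :> R.
  by rewrite mulr_ge0 ?gauss_fun_ge0// mulr_ge0// mulr_ge0 ?pi_ge0.
have fint s : `](r - 1), (r + 1)[%classic s -> mu.-integrable [set: R] (EFin \o f s).
  by move=> _; exact: (gdom_integrable (gdom_cos (2 * pi * s) (gdom_gfun a2))).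
have fder s y : `](r - 1), (r + 1)[%classic s -> [set: R] y -> derivable (f^~ y) s 1.
  by move=> _ _; exact: der_derivable (df y s).
have p1 s y : partial1of2 f s y = gfun a y * - (2 * pi * y * sin (2 * pi * s * y)).
  by rewrite /partial1of2 (der_val (df y s)).
have fub s y : `](r - 1), (r + 1)[%classic s -> [set: R] y ->
    `|partial1of2 f s y| <= 2 * pi * (1 + 1`!%:R) * gauss_fun y.
  move=> _ _; rewrite p1.
  have -> : gfun a y * - (2 * pi * y * sin (2 * pi * s * y)) =
    - (2 * pi) * (y ^+ 1 * gfun a y * sin (2 * pi * s * y)) by ring.
  have p2 : 0 <= 2 * pi :> R by rewrite mulr_ge0 ?pi_ge0.
  have -> : 2 * pi * (1 + 1`!%:R) * gauss_fun y = 2 * pi * ((1 + 1`!%:R) * gauss_fun y).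
    by rewrite mulrA.
  rewrite normrM normrN (ger0_norm p2); apply: (ler_wpM2l p2).
  exact: (gdom_sin (2 * pi * s) g1).2.
have h1 := derivable_under_integral measurableT Ir fint fder G_ge0 G_int fub.
have h2 := differentiation_under_integral measurableT Ir fint fder G_ge0 G_int fub.
apply: DeriveDef; first exact: h1.
rewrite -derive1E [LHS]h2 /sint -RintegralZl//; last first.
  exact: (gdom_integrable (gdom_sin (2 * pi * r) g1)).
by apply: eq_Rintegral => x _; rewrite p1; ring.
Qed.

Lemma integral_gfun a : 2 <= a -> \int[mu]_x gfun a x = Num.sqrt (pi / a).
Proof.
move=> a2; have a0 : 0 < a by lra.
have s0 : 0 < Num.sqrt a by rewrite sqrtr_gt0.
have dF (x : R) : derive1 (fun y : R => Num.sqrt a * y) x = Num.sqrt a.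
  by apply: der_val; exact: der_scale.
have dF' : derive1 (fun y : R => Num.sqrt a * y) = fun=> Num.sqrt a.
  by apply/funext.
have := @increasing_ge0_integration_by_substitutionT R (fun x => Num.sqrt a * x) (@gauss_fun R).
rewrite dF' integralT_gauss => h.
have {}h : ((Num.sqrt pi)%:E = \int[mu]_x ((Num.sqrt a * gfun a x)%:E))%E.
  rewrite h.
  - apply: eq_integral => x _; congr (_%:E)%E.
    transitivity (gauss_fun (Num.sqrt a * x) * Num.sqrt a) => //.
    by rewrite /gfun /gauss_fun exprMn sqr_sqrtr ?ltW// mulrC.
  - by move=> x y xy; rewrite ltr_pM2l.
  - by move=> x; exact: cvg_cst.
  - exact: is_cvg_cst.
  - exact: is_cvg_cst.
  - by move=> x; exact: der_derivable (der_scale x _).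
  - by apply: gt0_cvgMrNy => //; exact: cvg_id.
  - by apply: gt0_cvgMry => //; exact: cvg_id.
  - exact: continuous_gauss_fun.
  - by move=> x; exact: gauss_fun_ge0.
have {}h : Num.sqrt pi = Num.sqrt a * \int[mu]_x gfun a x.
  rewrite -RintegralZl//; last exact: (gdom_integrable (gdom_gfun a2)).
  by rewrite /Rintegral -h.
apply: (mulfI (lt0r_neq0 s0)); rewrite -h -sqrtrM ?ltW//.
by rewrite mulrC mulfVK ?gt_eqF.
Qed.

(** As a function of [r], [cost (gfun a)] solves
    [y' = - (2 * pi ^+ 2 / a) * r * y], by differentiation under the integral and
    one integration by parts. *)
Lemma cost_gfun a r : 2 <= a ->
  cost (gfun a) r = Num.sqrt (pi / a) * expR (- (pi ^+ 2 / a * r ^+ 2)).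
Proof.
move=> a2; have a0 : 0 < a by lra.
pose h r := cost (gfun a) r * expR (- (- (pi ^+ 2 / a) * r ^+ 2)).
have dh (s : R) : is_derive s (1 : R) h 0.
  apply: (is_derive_eq (derM (der_cost_gfun s a2) (der_gauss s _))).
  by rewrite sint_xgfun//; field; rewrite gt_eqF.
have h0 : h r = h 0 := is_derive_0_is_cst _ _ dh.
have : h 0 = Num.sqrt (pi / a).
  rewrite /h expr0n mulr0 oppr0 expR0 mulr1 -integral_gfun//.
  by apply: eq_Rintegral => x _; rewrite mulr0 mul0r cos0 mulr1.
rewrite -h0 /h => <-; rewrite -[RHS]mulrA -expRD.
by rewrite -[LHS]mulr1 -expR0; congr (_ * expR _); ring.
Qed.

Lemma sint_gaussian a r : 2 <= a -> sint (fun x => x * gfun a x) r =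
  r * (pi / a) * Num.sqrt (pi / a) * expR (- (pi ^+ 2 / a * r ^+ 2)).
Proof. by move=> a2; rewrite sint_xgfun// cost_gfun//; ring. Qed.

End Gaussian_transform.

Section Tower_decay.
Context {R : realType}.

(** Since [d/d(x^2) = (2 x)^-1 d/dx], [gamma i] is the [i]-th derivative of
    [gamma 0] with respect to [x ^+ 2], up to order [K].  The form without division
    is meaningful at [x = 0]. *)
Definition tower (K : nat) (gamma : nat -> R -> R) :=
  (forall i, (i < K)%N -> forall x, is_derive x (1 : R) (gamma i) (2 * x * gamma i.+1 x)) /\
  continuous (gamma K).

Lemma tower_continuous K gamma i : tower K gamma -> (i <= K)%N -> continuous (gamma i).
Proof.
move=> [tg tK]; rewrite leq_eqVlt => /predU1P[->//|iK].
exact: der_continuous (tg i iK).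
Qed.

(** An integration by parts gains a factor [1 / r] and replaces
    [x ^+ a * gamma i x] by
    [a * x ^+ a.-1 * gamma i x + 2 * x ^+ a.+1 * gamma i.+1 x], which is again of
    this form.  That [C] depends on [N] and [a] only makes the sine transform
    continuous with respect to [e]. *)
Lemma tower_decay (N a : nat) : exists C : R, 0 <= C /\
  forall K gamma (e : R), tower K gamma -> 0 <= e ->
    (forall i, (i <= K)%N -> forall x, `|gamma i x| <= e * gfun 2 x) ->
    forall i (r : R), (i + N <= K)%N -> 0 < r ->
    `|sint (fun x => x ^+ a * gamma i x) r| <= C * e / r ^+ N /\
    `|cost (fun x => x ^+ a * gamma i x) r| <= C * e / r ^+ N.
Proof.
elim: N a => [|N IH] a.
  exists ((1 + a`!%:R) * Num.sqrt pi); split.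
    by rewrite mulr_ge0 ?sqrtr_ge0// addr_ge0.
  move=> K gamma e tg e0 ge i r; rewrite addn0 => iK r0.
  have g := gdom_pow_mul a (tower_continuous tg iK) (ge i iK).
  rewrite expr0 divr1 mulrAC; split.
  - exact: gdom_bound (gdom_sin (2 * pi * r) g).
  - exact: gdom_bound (gdom_cos (2 * pi * r) g).
(* For a = 0 the truncated a.-1 occurs with the coefficient a = 0. *)
have [C1 [C10 h1]] := IH a.-1; have [C2 [C20 h2]] := IH a.+1.
exists ((a%:R * C1 + 2 * C2) / (2 * pi)); split.
  by rewrite divr_ge0 ?addr_ge0 ?mulr_ge0 ?pi_ge0.
move=> K gamma e tg e0 ge i r iNK r0.
have iK : (i < K)%N by apply: leq_trans iNK; rewrite -[i.+1]addn1 leq_add2l.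
have iK' := ltnW iK.
have i1 : (i + N <= K)%N by apply: leq_trans iNK; rewrite leq_add2l.
have i2 : (i.+1 + N <= K)%N by rewrite addSnnS.
have [b1 b2] := h1 K gamma e tg e0 ge i r i1 r0.
have [b3 b4] := h2 K gamma e tg e0 ge i.+1 r i2 r0.
pose f x := x ^+ a * gamma i x.
pose f1 x := x ^+ a.-1 * gamma i x; pose f2 x := x ^+ a.+1 * gamma i.+1 x.
have gf := gdom_pow_mul a (tower_continuous tg iK') (ge i iK').
have gf1 := gdom_pow_mul a.-1 (tower_continuous tg iK') (ge i iK').
have gf2 := gdom_pow_mul a.+1 (tower_continuous tg iK) (ge i.+1 iK).
have df x : is_derive x (1 : R) f (a%:R * f1 x + 2 * f2 x).
  apply: (is_derive_eq (derM (derX x a) (tg.1 i iK x))).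
  by rewrite /f1 /f2 exprS; ring.
have gf' := gdomD (gdomZ a%:R gf1) (gdomZ 2 gf2).
have p2 : 0 < 2 * pi :> R by rewrite mulr_gt0// pi_gt0.
have pr : 0 < 2 * pi * r by rewrite mulr_gt0.
have rN : 0 < r ^+ N by rewrite exprn_gt0.
have key (u v w : R) : 2 * pi * r * u = a%:R * v + 2 * w ->
    `|v| <= C1 * e / r ^+ N -> `|w| <= C2 * e / r ^+ N ->
    `|u| <= (a%:R * C1 + 2 * C2) / (2 * pi) * e / r ^+ N.+1.
  move=> uE v1 w1.
  have -> : u = (a%:R * v + 2 * w) / (2 * pi * r) by rewrite -uE mulrC mulKf// gt_eqF.
  rewrite normrM normfV (gtr0_norm pr) ler_pdivrMr//.
  have -> : (a%:R * C1 + 2 * C2) / (2 * pi) * e / r ^+ N.+1 * (2 * pi * r) =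
     a%:R * (C1 * e / r ^+ N) + 2 * (C2 * e / r ^+ N).
    rewrite exprS; move: (@pi R) (pi_gt0 R) => p p0.
    by field; rewrite !gt_eqF.
  apply: (le_trans (ler_normD _ _)); rewrite !normrM.
  rewrite (ger0_norm (ler0n _ a)) (ger0_norm (ler0n _ 2)).
  by apply: lerD; apply: ler_wpM2l.
split.
- apply: key b2 b4; rewrite (ibp_cos r df gf gf') /cost -!RintegralZl//.
  + rewrite -RintegralD//; first by apply: eq_Rintegral => x _; rewrite mulrDl !mulrA.
    * exact: (gdom_integrable (gdomZ _ (gdom_cos (2 * pi * r) gf1))).
    * exact: (gdom_integrable (gdomZ _ (gdom_cos (2 * pi * r) gf2))).
  + exact: (gdom_integrable (gdom_cos (2 * pi * r) gf2)).
  + exact: (gdom_integrable (gdom_cos (2 * pi * r) gf1)).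
- rewrite -(normrN (cost _ _)); apply: key b1 b3.
  rewrite mulrN (ibp_sin r df gf gf') opprK /sint -!RintegralZl//.
  + rewrite -RintegralD//; first by apply: eq_Rintegral => x _; rewrite mulrDl !mulrA.
    * exact: (gdom_integrable (gdomZ _ (gdom_sin (2 * pi * r) gf1))).
    * exact: (gdom_integrable (gdomZ _ (gdom_sin (2 * pi * r) gf2))).
  + exact: (gdom_integrable (gdom_sin (2 * pi * r) gf2)).
  + exact: (gdom_integrable (gdom_sin (2 * pi * r) gf1)).
Qed.

End Tower_decay.

(** * Smooth quotients of odd functions by x *)
Section Hadamard.
Context {R : realType}.
Local Notation mu := (@lebesgue_measure R).

Lemma smooth_derive (f : R -> R) n (x : R) : smooth_real f ->
  is_derive x (1 : R) (derive1n n f) (derive1n n.+1 f x).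
Proof.
move=> sf; apply: DeriveDef; first exact: sf.
by rewrite derive1nS derive1E.
Qed.

Lemma smooth_continuous (f : R -> R) n : smooth_real f -> continuous (derive1n n f).
Proof. by move=> sf; apply: der_continuous => x; exact: smooth_derive. Qed.

Lemma smooth_derive1 (f : R -> R) : smooth_real f -> smooth_real (derive1 f).
Proof. by move=> sf n x; rewrite -derive1Sn; exact: sf. Qed.

(** [moment 0 (derive1 g) x] is the quotient [(g x - g 0) / x] in Hadamard's form,
    which is smooth across [x = 0]; differentiation in [x] produces the higher
    powers [u ^+ a]. *)
Definition moment (a : nat) (f : R -> R) (x : R) : R :=
  \int[mu]_(u in `[0, 1]) (u ^+ a * f (x * u)).

Lemma moment_integrand_continuous a (f : R -> R) (x : R) : continuous f ->
  continuous (fun u : R => u ^+ a * f (x * u)).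
Proof.
move=> cf u; apply: cvgM; first exact: pow_continuous.
by apply: continuous_comp; [exact: scale_continuous|exact: cf].
Qed.

Lemma moment_integrable a (f : R -> R) (x : R) : continuous f ->
  mu.-integrable `[0, 1] (EFin \o (fun u : R => u ^+ a * f (x * u))).
Proof.
move=> cf; apply: continuous_compact_integrable; first exact: segment_compact.
by apply: continuous_subspaceT => u; exact: moment_integrand_continuous.
Qed.

Lemma continuous_bounded (f : R -> R) (A : R) : continuous f -> 0 <= A ->
  exists2 M : R, 0 <= M & forall x : R, `|x| <= A -> `|f x| <= M.
Proof.
move=> cf A0.
have cn : {within `[- A, A], continuous (fun x => `|f x|)}.
  by apply: continuous_subspaceT => x; apply: continuous_comp; [exact: cf|exact: norm_continuous].
have AA : - A <= A by rewrite ge0_cp.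
have [c _ h] := EVT_max AA cn; exists `|f c| => // x xA.
by apply: h; rewrite in_itv/= -ler_norml.
Qed.

Lemma moment_derive a (f : R -> R) (x : R) : smooth_real f ->
  is_derive x (1 : R) (moment a f) (moment a.+1 (derive1 f) x).
Proof.
move=> sf.
have f0 : continuous f by exact: (smooth_continuous (n := 0) sf).
have f1 : continuous (derive1 f) by exact: (smooth_continuous (n := 1) sf).
pose g := fun x u : R => u ^+ a * f (x * u).
have dg (u s : R) : is_derive s (1 : R) (g^~ u) (u ^+ a.+1 * derive1 f (s * u)).
  have h : is_derive s (1 : R) (fun s : R => f (s * u)) (derive1 f (s * u) * u).
    apply: (der_comp (smooth_derive 0 _ sf)).
    have -> : (fun s : R => s * u) = (fun s => u * s) by apply/funext => z; rewrite mulrC.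
    exact: der_scale.
  by apply: (is_derive_eq (derZ (u ^+ a) h)); rewrite exprSr; ring.
have A0 : 0 <= `|x| + 1 by rewrite addr_ge0.
have [M M0 hM] := continuous_bounded f1 A0.
have Ix : `](x - 1), (x + 1)[%classic x by rewrite /= in_itv/=; apply/andP; split; lra.
have mI : measurable (`[0, 1]%classic : set (measurableTypeR R)) by exact: measurable_itv.
have iM : mu.-integrable `[0, 1] (EFin \o (fun=> M)).
  apply: continuous_compact_integrable; first exact: segment_compact.
  by apply: continuous_subspaceT => u; exact: cvg_cst.
have gi (s : R) : `](x - 1), (x + 1)[%classic s -> mu.-integrable `[0, 1] (EFin \o g s).
  by move=> _; exact: moment_integrable.
have gd (s u : R) : `](x - 1), (x + 1)[%classic s -> `[0, 1]%classic u -> derivable (g^~ u) s 1.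
  by move=> _ _; exact: der_derivable (dg u s).
have p1 (s u : R) : partial1of2 g s u = u ^+ a.+1 * derive1 f (s * u).
  by rewrite /partial1of2 (der_val (dg u s)).
have gb (s u : R) : `](x - 1), (x + 1)[%classic s -> `[0, 1]%classic u -> `|partial1of2 g s u| <= M.
  rewrite /= !in_itv/= => /andP[s1 s2] /andP[u0 u1]; rewrite p1 normrM -[leRHS]mul1r.
  apply: ler_pM => //; first by rewrite normrX exprn_ile1// ger0_norm.
  apply: hM; rewrite normrM (ger0_norm u0).
  apply: (@le_trans _ _ `|s|); first by rewrite ler_piMr.
  rewrite ler_norml; have := ler_norm x; have := ler_norm (- x); rewrite normrN => h1 h2.
  by apply/andP; split; lra.
have M0' (y : measurableTypeR R) : 0 <= M by [].
have h1 := @derivable_under_integral R _ (measurableTypeR R) mu g _ mI x _ _ Ix gi gd _ M0' iM gb.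
have h2 := @differentiation_under_integral R _ (measurableTypeR R) mu g _ mI x _ _ Ix gi gd _ M0' iM gb.
apply: DeriveDef; first exact: h1.
by rewrite -derive1E [LHS]h2; apply: eq_Rintegral => u _; rewrite p1.
Qed.

Lemma moment_derive1n a (f : R -> R) n : smooth_real f ->
  derive1n n (moment a f) = moment (a + n) (derive1n n f).
Proof.
elim: n a f => [|n IH] a f sf; first by rewrite addn0.
rewrite derive1Sn.
have -> : derive1 (moment a f) = moment a.+1 (derive1 f).
  by apply/funext => x; exact: der_val (moment_derive a x sf).
rewrite IH; last exact: smooth_derive1.
by rewrite addSnnS derive1Sn.
Qed.

Lemma moment_smooth a (f : R -> R) : smooth_real f -> smooth_real (moment a f).
Proof.
move=> sf n x; rewrite moment_derive1n//.
have sn : smooth_real (derive1n n f).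
  by elim: n => [|n IH]; [exact: sf|rewrite derive1nS; exact: smooth_derive1].
exact: der_derivable (moment_derive _ x sn).
Qed.

Lemma hadamard (f : R -> R) (x : R) : smooth_real f ->
  x * moment 0 (derive1 f) x = f x - f 0.
Proof.
move=> sf.
have f0 : continuous f by exact: (smooth_continuous (n := 0) sf).
have f1 : continuous (derive1 f) by exact: (smooth_continuous (n := 1) sf).
rewrite /moment -RintegralZl//; last exact: (moment_integrable 0 x f1).
pose F u := f (x * u).
have dF (u : R) : is_derive u (1 : R) F (x * (u ^+ 0 * derive1 f (x * u))).
  rewrite mul1r mulrC; apply: (der_comp (smooth_derive 0 _ sf)); exact: der_scale.
rewrite /Rintegral (@continuous_FTC2 _ (fun u => x * (u ^+ 0 * derive1 f (x * u))) F)//=.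
- by rewrite /F mulr1 mulr0.
- apply: continuous_subspaceT => u; apply: cvgMr.
  exact: moment_integrand_continuous.
- split.
  + by move=> u _; exact: der_derivable (dF u).
  + by apply: cvg_at_right_filter; exact: (der_continuous dF).
  + by apply: cvg_at_left_filter; exact: (der_continuous dF).
- by move=> u _; exact: der_val (dF u).
Qed.

Definition evenf (f : R -> R) := forall x, f (- x) = f x.
Definition oddf (f : R -> R) := forall x, f (- x) = - f x.

Lemma der_reflect (f : R -> R) (x a : R) : is_derive (- x) (1 : R) f a ->
  is_derive x (1 : R) (fun y => f (- y)) (- a).
Proof.
move=> h; have d : is_derive x (1 : R) (fun y : R => - y) (- 1).
  by apply: is_deriveN; exact: der_id.
by apply: (is_derive_eq (der_comp h d)); rewrite mulrN1.
Qed.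

Lemma even_derive1 (f : R -> R) : smooth_real f -> evenf f -> oddf (derive1 f).
Proof.
move=> sf ef x.
have e : (fun y => f (- y)) = f by apply/funext => y; exact: ef.
have := der_reflect (smooth_derive 0 (- x) sf); rewrite e => k.
by rewrite (der_val k) opprK.
Qed.

Lemma odd_derive1 (f : R -> R) : smooth_real f -> oddf f -> evenf (derive1 f).
Proof.
move=> sf of_ x; have k := der_reflect (smooth_derive 0 (- x) sf).
have e : (fun y => f (- y)) = (fun y => - f y) by apply/funext => y; exact: of_.
rewrite e in k.
have k2 : is_derive x (1 : R) (fun y => - f y) (- derive1 f x).
  by apply: is_deriveN; exact: (smooth_derive 0 x sf).
by have := der_unique k k2 => /oppr_inj.
Qed.

Lemma even_moment (f : R -> R) : evenf f -> evenf (moment 0 f).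
Proof. by move=> ef x; apply: eq_Rintegral => u _; rewrite mulNr ef. Qed.

Lemma derive1_vanish (f : R -> R) (A : R) : (forall x, A < `|x| -> f x = 0) ->
  forall x, A < `|x| -> derive1 f x = 0.
Proof.
move=> f0 x Ax; apply: der_val; apply: (near_eq_is_derive (f := fun=> 0)) (der_cst x 0).
have : \forall y \near x, A < `|y|.
  by have := @norm_continuous _ _ x; move/cvgr_gt; exact.
by apply: filterS => y /f0 ->.
Qed.

(** [f / x], followed by the iterated quotients [g' / x]; the integral formula in
    place of a division gives their smoothness at 0. *)
Fixpoint quotients (f : R -> R) (i : nat) : R -> R :=
  if i is j.+1 then moment 0 (derive1 (derive1 (quotients f j))) else moment 0 (derive1 f).

Section Odd_test.
Variables (f : R -> R) (A : R).
Hypotheses (sf : smooth_real f) (f_odd : oddf f) (A0 : 0 < A).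
Hypothesis f_supp : forall x, A < `|x| -> f x = 0.

Lemma quotients_smooth i : smooth_real (quotients f i).
Proof.
elim: i => [|i IH]; apply: moment_smooth; first exact: smooth_derive1.
by apply: smooth_derive1; exact: smooth_derive1.
Qed.

Lemma quotients_even i : evenf (quotients f i).
Proof.
elim: i => [|i IH]; apply: even_moment; first exact: odd_derive1.
apply: odd_derive1; first exact/smooth_derive1/quotients_smooth.
by apply: even_derive1 => //; exact: quotients_smooth.
Qed.

Lemma quotients0 x : x * quotients f 0 x = f x.
Proof.
rewrite /= hadamard//; suff -> : f 0 = 0 by rewrite subr0.
by have := f_odd 0; rewrite oppr0; lra.
Qed.

(** The derivative of an even function vanishes at 0, so [hadamard] divides it
    by [x]. *)
Lemma quotientsS i x : x * quotients f i.+1 x = derive1 (quotients f i) x.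
Proof.
rewrite /= hadamard; last exact/smooth_derive1/quotients_smooth.
have := even_derive1 (@quotients_smooth i) (@quotients_even i) 0.
rewrite oppr0; move: (derive1 _ 0) => y h.
have -> : y = 0 by lra.
by rewrite subr0.
Qed.

Lemma quotients_supp i x : A < `|x| -> quotients f i x = 0.
Proof.
elim: i x => [|i IH] x Ax.
  have x0 : x != 0 by rewrite -normr_gt0 (lt_trans A0).
  by apply: (mulfI x0); rewrite quotients0 f_supp// mulr0.
have x0 : x != 0 by rewrite -normr_gt0 (lt_trans A0).
by apply: (mulfI x0); rewrite quotientsS (derive1_vanish IH)// mulr0.
Qed.

(** The factor [2 ^- i] turns divisions by [x] into divisions by [2 * x]. *)
Definition ftower i x := 2 ^- i * quotients f i x.

Lemma ftower_derive i x : is_derive x (1 : R) (ftower i) (2 * x * ftower i.+1 x).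
Proof.
apply: (is_derive_eq (derZ _ (smooth_derive 0 x (@quotients_smooth i)))).
rewrite -[derive1n 1 _ x]/(derive1 (quotients f i) x) -quotientsS /ftower exprS.
have p0 : 2 ^+ i != 0 :> R by rewrite expf_neq0.
by field; rewrite p0.
Qed.

Lemma ftower_even i : evenf (ftower i).
Proof. by move=> x; rewrite /ftower quotients_even. Qed.

Lemma ftower_supp i x : A < `|x| -> ftower i x = 0.
Proof. by move=> Ax; rewrite /ftower quotients_supp// mulr0. Qed.

Lemma ftower0 x : x * ftower 0 x = f x.
Proof. by rewrite /ftower expr0 invr1 mul1r quotients0. Qed.

End Odd_test.

End Hadamard.

(** * Simultaneous approximation by Gaussians *)
Section Bernstein.
Context {R : realType}.
Implicit Types (f g : nat -> R) (u : R).

(** The Bernstein polynomial with values [f i] at the nodes, by de Casteljau's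
    recursion: monotonicity, linearity and the second moment are then direct
    inductions. *)
Fixpoint bernstein (n : nat) (f : nat -> R) : {poly R} :=
  if n is m.+1 then 'X * bernstein m (fun i => f i.+1) + (1 - 'X) * bernstein m f
  else (f 0%N)%:P.

Lemma bernsteinS n f u : (bernstein n.+1 f).[u] =
  u * (bernstein n (fun i => f i.+1)).[u] + (1 - u) * (bernstein n f).[u].
Proof. by rewrite /= !hornerE. Qed.

Lemma bernstein_le n f g u : 0 <= u <= 1 -> (forall i, (i <= n)%N -> f i <= g i) ->
  (bernstein n f).[u] <= (bernstein n g).[u].
Proof.
move=> /andP[u0 u1]; elim: n f g => [|n IH] f g fg; first by rewrite /= !hornerE fg.
rewrite !bernsteinS; apply: lerD; apply: ler_wpM2l; rewrite ?subr_ge0//.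
  by apply: IH => i iN; exact: fg.
by apply: IH => i iN; apply: fg; exact: leqW.
Qed.

Lemma bernstein_lin n f g (c d : R) u :
  (bernstein n (fun i => c * f i + d * g i)).[u] =
  c * (bernstein n f).[u] + d * (bernstein n g).[u].
Proof.
elim: n f g => [|n IH] f g; first by rewrite /= !hornerE.
by rewrite !bernsteinS (IH (fun i => f i.+1) (fun i => g i.+1)) IH; ring.
Qed.

Lemma bernstein_cst n (c : R) u : (bernstein n (fun=> c)).[u] = c.
Proof. by elim: n => [|n IH]; [rewrite /= hornerE|rewrite bernsteinS IH; ring]. Qed.

(** For [c = - (n%:R * u)] this is the variance [n * u * (1 - u)] of the binomial
    distribution. *)
Lemma bernstein_sqr n (c u : R) : (bernstein n (fun i => (i%:R + c) ^+ 2)).[u] =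
  (n%:R * u + c) ^+ 2 + n%:R * (u * (1 - u)).
Proof.
elim: n c => [|n IH] c; first by rewrite /= hornerE !mul0r !add0r addr0.
have e : bernstein n (fun i => (i.+1%:R + c) ^+ 2) = bernstein n (fun i => (i%:R + (c + 1)) ^+ 2).
  by congr bernstein; apply/funext => i; rewrite -natr1; congr (_ ^+ 2); ring.
by rewrite bernsteinS e !IH -natr1; ring.
Qed.

(** Bernstein's proof: [`|t| <= d + t ^+ 2 / d] with [t = u - i / n], and the
    average of [t ^+ 2] is [u * (1 - u) / n], at most [d ^+ 2] once
    [n >= d ^- 2]. *)
Theorem lipschitz_weierstrass (w : R -> R) (L e : R) : 0 < e -> 0 <= L ->
  (forall u v : R, 0 <= u <= 1 -> 0 <= v <= 1 -> `|w u - w v| <= L * `|u - v|) ->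
  exists Q : {poly R}, forall u : R, 0 <= u <= 1 -> `|w u - Q.[u]| <= e.
Proof.
move=> e0 L0 wL.
have L1 : 0 < L + 1 by rewrite ltr_wpDl.
have [d d0 dE] : exists2 d, 0 < d & e = d * (2 * (L + 1)).
  by exists (e / (2 * (L + 1))); rewrite ?divr_gt0 ?mulfVK ?mulr_gt0// gt_eqF// mulr_gt0.
have [n n0 dn] : exists2 n : nat, 0 < n%:R :> R & 1 <= d ^+ 2 * n%:R.
  exists (Num.trunc (d ^- 2)).+1; first by rewrite ltr0n.
  have := ler_wpM2l (ltW (exprn_gt0 2 d0)) (ltW (truncnS_gt (d ^- 2))).
  by rewrite mulfV// expf_neq0// gt_eqF.
exists (bernstein n (fun i => w (i%:R / n%:R))) => u u01.
have /andP[u0 u1] := u01.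
have bound (i : nat) : (i <= n)%N ->
    `|w u - w (i%:R / n%:R)| <= L * d + (L / (d * n%:R ^+ 2)) * (i%:R + - (n%:R * u)) ^+ 2.
  move=> iN; have i01 : 0 <= (i%:R / n%:R : R) <= 1.
    by rewrite divr_ge0//= ler_pdivrMr// mul1r ler_nat.
  apply: (le_trans (wL _ _ u01 i01)).
  have -> : L * d + L / (d * n%:R ^+ 2) * (i%:R + - (n%:R * u)) ^+ 2 =
     L * (d + (u - i%:R / n%:R) ^+ 2 / d) by field; rewrite !gt_eqF.
  apply: ler_wpM2l => //; move: (u - _) => t.
  have -> : t ^+ 2 = `|t| ^+ 2 by rewrite real_normK// num_real.
  move: (normr_ge0 t); move: `|t| => {}t t0.
  have -> : d + t ^+ 2 / d = t + (d ^+ 2 - t * d + t ^+ 2) / d by field; rewrite gt_eqF.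
  rewrite lerDl divr_ge0 ?(ltW d0)//.
  have -> : d ^+ 2 - t * d + t ^+ 2 = (d - t) ^+ 2 + t * d by ring.
  by rewrite addr_ge0 ?sqr_ge0// mulr_ge0// ltW.
pose B := (bernstein n (fun i => L * d * 1 +
   (L / (d * n%:R ^+ 2)) * (i%:R + - (n%:R * u)) ^+ 2)).[u].
have BE : B = L * d + L / (d * n%:R ^+ 2) * (n%:R * (u * (1 - u))).
  rewrite /B (bernstein_lin n (fun=> 1)) bernstein_cst bernstein_sqr.
  by rewrite subrr expr0n add0r mulr1.
have Be : B <= e.
  rewrite BE.
  have -> : e = L * d + d + (L + 1) * d by rewrite dE; ring.
  have uu : u * (1 - u) <= 1 by have := sqr_ge0 u; nra.
  have h : L / (d * n%:R ^+ 2) * (n%:R * (u * (1 - u))) <= L * d.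
    have -> : L / (d * n%:R ^+ 2) * (n%:R * (u * (1 - u))) = L * ((u * (1 - u)) / (d * n%:R)).
      by field; rewrite !gt_eqF.
    apply: ler_wpM2l => //; rewrite ler_pdivrMr ?mulr_gt0//.
    by apply: (le_trans uu); rewrite mulrA -expr2.
  by move: h; set x := _ * _; lra.
have wE : w u = (bernstein n (fun=> w u)).[u] by rewrite bernstein_cst.
rewrite -[X in X - _]mul1r {1}wE -mulN1r -bernstein_lin.
rewrite ler_norml; apply/andP; split.
  have -> : - e = (bernstein n (fun=> - e)).[u] by rewrite bernstein_cst.
  apply: (@le_trans _ _ (- B)); first by rewrite bernstein_cst lerN2.
  have -> : - B = (bernstein n (fun i => (-1) * (L * d * 1 +
     (L / (d * n%:R ^+ 2)) * (i%:R + - (n%:R * u)) ^+ 2) + 0 * 0)).[u].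
    by rewrite (bernstein_lin n _ (fun=> 0)) -/B mul0r addr0 mulN1r.
  apply: bernstein_le => // i /bound; rewrite ler_norml => /andP[h _].
  by move: h; rewrite mul0r addr0 mulr1 mulN1r mul1r mulN1r.
apply: le_trans Be; apply: bernstein_le => // i /bound; rewrite ler_norml => /andP[_ h].
by move: h; rewrite mulr1 mul1r mulN1r.
Qed.

End Bernstein.

Section Gaussian_density.
Context {R : realType}.
Variables (gamma : nat -> R -> R) (A : R) (K : nat).
Hypothesis gd : forall i (x : R), is_derive x (1 : R) (gamma i) (2 * x * gamma i.+1 x).
Hypothesis ge : forall i, evenf (gamma i).
Hypothesis A0 : 0 < A.
Hypothesis gs : forall i x, A < `|x| -> gamma i x = 0.

Lemma nonincreasing_limit_ge0 (f f' : R -> R) : (forall x : R, is_derive x (1 : R) f (f' x)) ->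
  (forall x, 0 <= x -> f' x <= 0) -> (fun n : nat => f n%:R) @ \oo --> (0 : R) ->
  forall x, 0 <= x -> 0 <= f x.
Proof.
move=> df f'0 f0 x x0; rewrite -(cvg_lim _ f0)//; apply: limr_le; first exact: cvgP f0.
exists (Num.trunc x).+1 => // n /= xn.
have xn' : x <= n%:R.
  by apply: le_trans (ltW (truncnS_gt _)) _; rewrite ler_nat.
have [c /andP[xc _] e] := mvt_global df xn'.
rewrite -subr_le0 e; apply: mulr_le0_ge0; last by rewrite subr_ge0.
by apply: f'0; exact: le_trans xc.
Qed.

(** In the variable [u = expR (- x ^+ 2)] the half-line [0 <= x] becomes
    [0 < u <= 1], and [G] becomes a function [w] of [u] that vanishes near
    [u = 0]. *)
Let G x := gamma K x * expR (2 * x ^+ 2).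

(** [G] has the derivative [2 * x * gauss_fun x] times a continuous function of
    compact support, while [gauss_fun] has the derivative
    [- (2 * x) * gauss_fun x]; so [L * gauss_fun + G] and [L * gauss_fun - G] are
    nonincreasing on [0 <= x] for large [L]. *)
Let G_lip : exists2 L : R, 0 <= L & forall x y : R, 0 <= x -> 0 <= y ->
  `|G x - G y| <= L * `|gauss_fun x - gauss_fun y|.
Proof.
have c1 : continuous (fun x : R => (gamma K.+1 x + 2 * gamma K x) * expR (3 * x ^+ 2)).
  have e3 : (fun x : R => expR (3 * x ^+ 2)) = (fun x => expR (- (- 3 * x ^+ 2))).
    by apply/funext => x; rewrite mulNr opprK.
  have ce : continuous (fun x : R => expR (3 * x ^+ 2)).
    by rewrite e3; apply: der_continuous => y; exact: der_gauss.
  move=> x; apply: cvgM; last exact: ce.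
    apply: cvgD; first exact: (der_continuous (gd K.+1)).
    by apply: cvgMr; exact: (der_continuous (gd K)).
have [L L0 hL] := continuous_bounded c1 (ltW A0).
exists L => // x y x0 y0.
have hL' z : `|(gamma K.+1 z + 2 * gamma K z) * expR (3 * z ^+ 2)| <= L.
  have [zA|zA] := leP `|z| A; first exact: hL.
  by rewrite !gs// mulr0 addr0 mul0r normr0.
have dG (z : R) : is_derive z (1 : R) G
    (2 * z * gauss_fun z * ((gamma K.+1 z + 2 * gamma K z) * expR (3 * z ^+ 2))).
  have e2 : (fun x : R => expR (2 * x ^+ 2)) = (fun x => expR (- (- 2 * x ^+ 2))).
    by apply/funext => t; rewrite mulNr opprK.
  have := der_gauss z (- 2); rewrite -e2 => h; apply: (is_derive_eq (derM (gd K z) h)).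
  have -> : expR (2 * z ^+ 2) = gauss_fun z * expR (3 * z ^+ 2).
    by rewrite /gauss_fun -expRD; congr expR; ring.
  have -> : expR (- (- 2 * z ^+ 2)) = gauss_fun z * expR (3 * z ^+ 2).
    by rewrite /gauss_fun -expRD; congr expR; ring.
  by ring.
have dg (z : R) : is_derive z (1 : R) (@gauss_fun R) (- (2 * z) * gauss_fun z).
  have e1 : @gauss_fun R = (fun x => expR (- (1 * x ^+ 2))).
    by apply/funext => t; rewrite mul1r.
  by have := der_gauss z 1; rewrite -e1 mulr1 mul1r.
wlog xy : x y x0 y0 / x <= y.
  move=> h; have [xy|/ltW yx] := leP x y; first exact: h.
  by rewrite distrC [X in L * X]distrC; exact: h.
have mono (s : R) : `|s| = 1 -> s * (G y - G x) <= L * (gauss_fun x - gauss_fun y).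
  move=> s1.
  have dH (z : R) := derD (derZ s (dG z)) (derZ L (dg z)).
  have [c /andP[xc _] e] := mvt_global dH xy.
  have c0 : 0 <= c by exact: le_trans xc.
  have : s * G y + L * gauss_fun y - (s * G x + L * gauss_fun x) <= 0.
    rewrite e; apply: mulr_le0_ge0; last by rewrite subr_ge0.
    have -> : s * (2 * c * gauss_fun c * ((gamma K.+1 c + 2 * gamma K c) * expR (3 * c ^+ 2))) +
      L * (- (2 * c) * gauss_fun c) = (2 * c * gauss_fun c) *
        (s * ((gamma K.+1 c + 2 * gamma K c) * expR (3 * c ^+ 2)) - L) by ring.
    apply: mulr_ge0_le0; first by rewrite !mulr_ge0// gauss_fun_ge0.
    rewrite subr_le0; apply: le_trans (ler_norm _) _.
    by rewrite normrM s1 mul1r.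
  by lra.
have g0 : 0 <= gauss_fun x - gauss_fun y.
  rewrite subr_ge0 ler_expR lerN2 lerXn2r//.
rewrite (ger0_norm g0) distrC ler_norml; apply/andP; split.
  by have := mono (-1); rewrite normrN1 => /(_ erefl); lra.
by have := mono 1; rewrite normr1 => /(_ erefl); lra.
Qed.

Let w (u : R) : R := if u <= 0 then 0 else G (Num.sqrt (- ln u)).

Let w_gauss x : w (gauss_fun x) = G `|x|.
Proof.
by rewrite /w leNgt expR_gt0/= /gauss_fun expRK opprK sqrtr_sqr.
Qed.

Let w_lip : exists2 L : R, 0 <= L & forall u v : R, 0 <= u <= 1 -> 0 <= v <= 1 ->
  `|w u - w v| <= L * `|u - v|.
Proof.
have [L L0 hL] := G_lip; exists L => // u v.
have ug (t : R) : 0 < t <= 1 -> exists2 x, 0 <= x & t = gauss_fun x.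
  move=> /andP[t0 t1]; exists (Num.sqrt (- ln t)); first exact: sqrtr_ge0.
  rewrite /gauss_fun sqr_sqrtr ?opprK ?lnK ?posrE//.
  by rewrite oppr_ge0 ln_le0.
have w0 (t : R) : 0 < t <= 1 -> `|w t| <= L * t.
  move=> /ug[x x0 ->]; rewrite w_gauss (ger0_norm x0).
  pose y := x + A + 1.
  have Ay : A < `|y| by rewrite ger0_norm /y ?addr_ge0 ?(ltW A0)//; lra.
  have y0 : 0 <= y by rewrite /y !addr_ge0 ?(ltW A0).
  have := hL x y x0 y0; rewrite {2}/G gs// mul0r subr0 => /le_trans; apply.
  apply: ler_wpM2l => //; rewrite ger0_norm; first by rewrite gerBl gauss_fun_ge0.
  rewrite subr_ge0 ler_expR lerN2 lerXn2r// /y -addrA lerDl addr_ge0//.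
  exact: ltW.
move=> /andP[u0 u1] /andP[v0 v1].
have w00 : w 0 = 0 by rewrite /w lexx.
move: u0; rewrite le_eqVlt => /predU1P[<-|u0].
  move: v0; rewrite le_eqVlt => /predU1P[<-|v0].
    by rewrite !subrr normr0 mulr0.
  rewrite w00 !sub0r !normrN (gtr0_norm v0); apply: w0.
  by rewrite v0.
move: v0; rewrite le_eqVlt => /predU1P[<-|v0].
  by rewrite w00 !subr0 (gtr0_norm u0); apply: w0; rewrite u0.
have [|x x0 ->] := ug u; first by rewrite u0.
have [|y y0 ->] := ug v; first by rewrite v0.
by rewrite !w_gauss (ger0_norm x0) (ger0_norm y0); exact: hL.
Qed.

(** Differentiating [expR (- (i * x ^+ 2))] with respect to [x ^+ 2] multiplies it
    by [- i], so the functions [gauss_comb c s] form a tower. *)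
Definition gauss_comb (c : {poly R}) (s : nat) (x : R) : R :=
  \sum_(i < size c) c`_i * (- i%:R) ^+ s * gfun i%:R x.

Lemma gauss_comb_derive c s (x : R) :
  is_derive x (1 : R) (gauss_comb c s) (2 * x * gauss_comb c s.+1 x).
Proof.
have -> : gauss_comb c s = \sum_(i < size c) (fun x => c`_i * (- i%:R) ^+ s * gfun i%:R x).
  by apply/funext => y; rewrite fct_sumE.
have -> : 2 * x * gauss_comb c s.+1 x = \sum_(i < size c)
    c`_i * (- i%:R) ^+ s * (- (2 * i%:R * x) * gfun i%:R x).
  by rewrite mulr_sumr; apply: eq_bigr => i _; rewrite exprSr; ring.
elim/big_ind2 : _ => [|f a g b fa gb|i _].
- exact: der_cst.
- exact: derD.
- by apply: derZ; exact: der_gauss.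
Qed.

Lemma gauss_comb_even c s : evenf (gauss_comb c s).
Proof. by move=> x; apply: eq_bigr => i _; rewrite /gfun sqrrN. Qed.

Lemma gauss_comb_cvg0 (c : {poly R}) s : c`_0 = 0 ->
  (fun n : nat => gauss_comb c s (n%:R : R)) @ \oo --> (0 : R).
Proof.
move=> c0; rewrite /gauss_comb; elim: (size c) => [|N IH].
  by under eq_fun do rewrite big_ord0; exact: cvg_cst.
have H2 : (fun n : nat => c`_N * (- N%:R) ^+ s * gfun N%:R (n%:R : R)) @ \oo --> (0 : R).
  have [->|N0] := eqVneq N 0%N.
    by under eq_fun do rewrite c0 !mul0r; exact: cvg_cst.
  pose D := `|c`_N * (- N%:R) ^+ s|.
  apply: (squeeze_cvgr (f := fun n : nat => - (D * gauss_fun (n%:R : R)))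
    (h := fun n : nat => D * gauss_fun (n%:R : R))).
  - apply: nearW => n; rewrite -ler_norml normrM ler_wpM2l// ger0_norm ?expR_ge0//.
    by rewrite ler_expR lerN2 ler_peMl ?sqr_ge0// ler1n lt0n.
  - by rewrite -oppr0; apply: cvgN; exact: gauss_fun_cvg0.
  - exact: gauss_fun_cvg0.
have H3 : (fun n : nat => \sum_(i < N) c`_i * (- i%:R) ^+ s * gfun i%:R (n%:R : R) +
    c`_N * (- N%:R) ^+ s * gfun N%:R (n%:R : R)) @ \oo --> (0 + 0 : R).
  exact: cvgD.
move: H3; rewrite addr0 => H3; apply: (near_eq_lim _ H3).
by apply: nearW => n; rewrite big_ord_recr.
Qed.

(** Only the top function needs an approximation theorem.  The polynomial [Q]
    approximating [w] yields an approximation of [gamma K] by the values of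
    [Q * 'X^2] at [gauss_fun x], and the coefficients of [c] are chosen so that
    [gauss_comb c K] is this function.  For smaller [s] the error tends to 0 at
    infinity and its derivative is bounded by
    [2 * x * e * gfun 2 x], the derivative of [- (e / 2 * gfun 2 x)]; so it is at
    most [e / 2 * gfun 2 x]. *)
Theorem gaussian_density (e : R) : 0 < e -> exists c : {poly R}, [/\ c`_0 = 0, c`_1 = 0 &
  forall s, (s <= K)%N -> forall x, `|gamma s x - gauss_comb c s x| <= e * gfun 2 x].
Proof.
move=> e0; have [L L0 wL] := w_lip.
have [Q hQ] := lipschitz_weierstrass e0 L0 wL.
(* The factor 'X^2 produces the weight gfun 2 and removes the exponents 0 and 1,
   for which the Gaussian does not decay at this rate. *)
pose P := Q * 'X^2.
pose c := \poly_(i < size P) (P`_i / (- i%:R) ^+ K).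
have P0 : P`_0 = 0 by rewrite coefMXn.
have P1 : P`_1 = 0 by rewrite coefMXn.
have c0 : c`_0 = 0 by rewrite coef_poly P0 mul0r if_same.
have c1 : c`_1 = 0 by rewrite coef_poly P1 mul0r if_same.
exists c; split => //.
have cK x : gauss_comb c K x = gfun 2 x * Q.[gauss_fun x].
  transitivity (\sum_(i < size P) c`_i * (- i%:R) ^+ K * gfun i%:R x).
    rewrite /gauss_comb (big_ord_widen (size P) (fun i => c`_i * (- i%:R) ^+ K * gfun i%:R x)).
      rewrite [RHS](bigID (fun i : 'I_(size P) => (i < size c)%N))/=.
      rewrite [X in _ + X]big1 ?addr0// => i; rewrite -leqNgt => ic.
      by rewrite (nth_default 0 ic) !mul0r.
    exact: size_poly.
  have -> : gfun 2 x * Q.[gauss_fun x] = P.[gauss_fun x].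
    rewrite /P hornerM hornerXn mulrC; congr (_ * _).
    by rewrite /gfun /gauss_fun -expRM_natl; congr expR; ring.
  rewrite horner_coef; apply: eq_bigr => i _.
  have -> : gfun i%:R x = gauss_fun x ^+ i.
    by rewrite /gfun /gauss_fun -expRM_natl; congr expR; ring.
  congr (_ * _); rewrite coef_poly ltn_ord.
  have [->|i0] := eqVneq (i : nat) 0%N; first by rewrite P0 !mul0r.
  by rewrite mulfVK// expf_neq0// oppr_eq0 pnatr_eq0.
have baseK x : `|gamma K x - gauss_comb c K x| <= e * gfun 2 x.
  have -> : gamma K x = gfun 2 x * w (gauss_fun x).
    rewrite w_gauss /G.
    have -> : gamma K `|x| = gamma K x.
      by have [x0|x0] := leP 0 x; rewrite ?(ger0_norm x0)// ltr0_norm// ge.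
    rewrite mulrCA real_normK ?num_real// /gfun -expRD addNr expR0 mulr1//.
  rewrite cK -mulrBr normrM (ger0_norm (expR_ge0 _)) mulrC; apply: ler_wpM2r.
    exact: expR_ge0.
  by apply: hQ; rewrite gauss_fun_ge0 gauss_fun_le1.
have step s : (forall x, `|gamma s.+1 x - gauss_comb c s.+1 x| <= e * gfun 2 x) ->
    forall x, `|gamma s x - gauss_comb c s x| <= e * gfun 2 x.
  move=> hs.
  have dd (x : R) := derB (gd s x) (gauss_comb_derive c s x).
  have half (t : R) : `|t| = 1 -> forall x, 0 <= x ->
      0 <= e / 2 * gfun 2 x + t * (gamma s x - gauss_comb c s x).
    move=> t1; apply: (nonincreasing_limit_ge0
      (fun x => derD (derZ (e / 2) (der_gauss x 2)) (derZ t (dd x)))).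
    - move=> x x0 /=.
      have := hs x; move: (gamma s.+1 x) (gauss_comb c s.+1 x) => p q pq.
      have -> : e / 2 * (- (2 * 2 * x) * expR (- (2 * x ^+ 2))) +
        t * (2 * x * p - 2 * x * q) = (2 * x) * (t * (p - q) - e * gfun 2 x).
        by rewrite /gfun; field.
      apply: mulr_ge0_le0; first by rewrite mulr_ge0.
      rewrite subr_le0; apply: le_trans (ler_norm _) _.
      by rewrite normrM t1 mul1r.
    - rewrite -[X in _ --> X]addr0; apply: cvgD.
        apply: (squeeze_cvgr (f := fun=> 0) (h := fun n : nat => e / 2 * gauss_fun (n%:R : R))).
        + apply: nearW => n; rewrite mulr_ge0 ?expR_ge0 ?divr_ge0 ?(ltW e0)//=.
          apply: ler_wpM2l; first by rewrite divr_ge0 ?(ltW e0).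
          by rewrite ler_expR lerN2 ler_peMl ?sqr_ge0// ler1n.
        + exact: cvg_cst.
        + exact: gauss_fun_cvg0.
      rewrite -[X in _ --> X](mulr0 t); apply: cvgMr.
      have h : (fun n : nat => - gauss_comb c s (n%:R : R)) @ \oo --> (0 : R).
        by rewrite -oppr0; apply: cvgN; exact: gauss_comb_cvg0.
      apply: (near_eq_lim _ h); exists (Num.trunc A).+1 => // n /= An.
      rewrite gs ?sub0r// ger0_norm//; apply: lt_le_trans (truncnS_gt _) _.
      by rewrite ler_nat.
  have pos x : 0 <= x -> `|gamma s x - gauss_comb c s x| <= e * gfun 2 x.
    move=> x0; have h1 := half 1 (normr1 _) x x0.
    have := half (-1); rewrite normrN1 => /(_ erefl x x0) h2.
    have g0 : 0 <= e / 2 * gfun 2 x by rewrite mulr_ge0 ?expR_ge0 ?divr_ge0 ?(ltW e0).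
    by rewrite ler_norml; apply/andP; split; lra.
  move=> x; have [x0|x0] := leP 0 x; first exact: pos.
  have := pos (- x); rewrite ge gauss_comb_even oppr_ge0 => /(_ (ltW x0)).
  by rewrite /gfun sqrrN.
move=> s sK; rewrite -(subKn sK); elim: (K - s)%N => [|j IH] x; first by rewrite subn0.
have [jK|Kj] := ltnP j K; last first.
  have -> : (K - j.+1 = K - j)%N by lia.
  exact: IH.
by apply: step => y; have -> : ((K - j.+1).+1 = K - j)%N by lia; exact: IH.
Qed.

End Gaussian_density.

(** * The coefficients beta *)
Section Beta_identity.
Context {R : realType}.

Lemma double_fact_even m : double_fact (2 * m) = (2 ^ m * m`!)%N.
Proof.
elim: m => [//|m IH]; rewrite mulnS /= IH factS expnS.
by rewrite -[(2 * m).+2]/(2 + 2 * m)%N -mulnS; nia.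
Qed.

Definition bcoef (n j : nat) : R := beta_coef j (2 * n + 3).

Lemma bcoefE n j : bcoef n j = (-1) ^+ j * ((2 * n - j)`!)%:R /
  (j`!%:R * (double_fact (2 * (n - j)))%:R) * (1 / (2 * pi)) ^+ n.
Proof.
rewrite /bcoef /beta_coef.
have -> : (2 * n + 3 - j - 3 = 2 * n - j)%N by lia.
have -> : (2 * n + 3 - 2 * j - 3 = 2 * (n - j))%N by lia.
by have -> : ((2 * n + 3 - 3) %/ 2 = n)%N by rewrite addnK mulKn.
Qed.

Lemma fact_neq0 m : m`!%:R != 0 :> R.
Proof. by rewrite pnatr_eq0 -lt0n fact_gt0. Qed.

Lemma bcoef00 : bcoef 0 0 = 1.
Proof. by rewrite bcoefE /= !fact0 !expr0 !mulr1 divr1. Qed.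

Lemma bcoef_closed m j : bcoef (m + j) j = (-1) ^+ j * ((2 * m + j)`!)%:R /
  (j`!%:R * (2 ^+ m * m`!%:R)) * (1 / (2 * pi)) ^+ (m + j).
Proof.
rewrite bcoefE addnK double_fact_even.
have -> : (2 * (m + j) - j = 2 * m + j)%N by lia.
by rewrite [(2 ^ m * m`!)%N%:R]natrM natrX.
Qed.

Lemma fact_succR p : (p.+1`!)%:R = (p%:R + 1) * p`!%:R :> R.
Proof. by rewrite factS natrM natr1. Qed.

(** With [bcoefSS] and [bcoef_last], the recursion for the coefficients of
    [x ^+ j * derive1n j f x] under [(2 pi)^-1 (2 n + 1 - x d/dx)]. *)
Lemma bcoefS0 n : 2 * pi * bcoef n.+1 0 = (2 * n%:R + 1) * bcoef n 0.
Proof.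
have e1 := bcoef_closed n.+1 0; have e2 := bcoef_closed n 0.
rewrite !addn0 in e1 e2; rewrite {}e1 {}e2.
have -> : (2 * n.+1 = (2 * n).+2)%N by lia.
rewrite !fact_succR -[(2 * n).+1%:R]natr1 (natrM _ 2 n).
rewrite [2 ^+ n.+1]exprS [(1 / _) ^+ n.+1]exprS.
have := fact_neq0 (2 * n); have := fact_neq0 n; have := fact_neq0 0; have := pi_gt0 R.
move: ((2 * n)`!%:R) (n`!%:R) (0`!%:R) (@pi R) => a b z p p0 z0 b0 a0.
have n1 : n%:R + 1 != 0 :> R by rewrite natr1 pnatr_eq0.
have q2 : 2 ^+ n != 0 :> R by rewrite expf_neq0.
move: ((1 / (2 * p)) ^+ n) (2 ^+ n) q2 => q t t0.
by rewrite expr0; field; rewrite n1 b0 t0 z0 gt_eqF.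
Qed.

Lemma bcoefSS n j : (j < n)%N ->
  2 * pi * bcoef n.+1 j.+1 = (2 * n%:R - j%:R) * bcoef n j.+1 - bcoef n j.
Proof.
move=> jn; have [m ->] : exists m, n = (m + j.+1)%N by exists (n - j.+1)%N; rewrite subnK.
have e1 := bcoef_closed m.+1 j.+1; have e2 := bcoef_closed m j.+1.
have e3 := bcoef_closed m.+1 j; rewrite addSnnS in e3.
rewrite addSn in e1; rewrite {}e1 {}e2 {}e3.
have -> : (2 * m.+1 + j.+1 = (2 * m + j.+1).+2)%N by lia.
have -> : (2 * m.+1 + j = (2 * m + j.+1).+1)%N by lia.
rewrite !fact_succR -[(2 * m + j.+1).+1%:R]natr1 !(natrD _ _ j.+1) (natrM _ 2 m) -[j.+1%:R]natr1.
rewrite [2 ^+ m.+1]exprS [(1 / _) ^+ (m + j.+1).+1]exprS [(-1) ^+ j.+1]exprS.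
have := fact_neq0 (2 * m + j.+1); have := fact_neq0 m; have := fact_neq0 j.
have := pi_gt0 R; have q2 : 2 ^+ m != 0 :> R by rewrite expf_neq0.
move: ((2 * m + j.+1)`!%:R) (m`!%:R) (j`!%:R) (2 ^+ m) q2 (@pi R) => a b c t t0 p p0 c0 b0 a0.
move: ((1 / (2 * p)) ^+ (m + j.+1)) ((-1) ^+ j) => q s.
have m1 : m%:R + 1 != 0 :> R by rewrite natr1 pnatr_eq0.
have j1 : j%:R + 1 != 0 :> R by rewrite natr1 pnatr_eq0.
by field; rewrite m1 j1 c0 b0 t0 gt_eqF.
Qed.

Lemma bcoef_last n : 2 * pi * bcoef n.+1 n.+1 = - bcoef n n.
Proof.
have e1 := bcoef_closed 0 n.+1; have e2 := bcoef_closed 0 n.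
rewrite !add0n in e1 e2; rewrite {}e1 {}e2.
rewrite [(1 / _) ^+ n.+1]exprS [(-1) ^+ n.+1]exprS.
have := fact_neq0 n; have := fact_neq0 n.+1; have := fact_neq0 0; have := pi_gt0 R.
move: (n`!%:R) (n.+1`!%:R) (0`!%:R) (@pi R) => a b z p p0 z0 b0 a0.
move: ((1 / (2 * p)) ^+ n) ((-1) ^+ n) => q s.
by rewrite !expr0; field; rewrite a0 b0 z0 gt_eqF.
Qed.

Variables (f : R -> R) (gamma : nat -> R -> R).
Hypothesis sf : smooth_real f.
Hypothesis gd : forall i (x : R), is_derive x (1 : R) (gamma i) (2 * x * gamma i.+1 x).
Hypothesis g0 : forall x, x * gamma 0 x = f x.

(** Divided by [x ^+ (2 * n + 1)], both sides are the [n]-th iterate of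
    [- (2 pi x)^-1 d/dx] on [f x / x].  Applied to [x ^- (2 * n + 1) * L x], this
    operator gives [x ^- (2 * n + 3)] times [(2 pi)^-1 ((2 n + 1) L - x L')], whence
    the recursion of the coefficients. *)
Lemma beta_identity n x :
  \sum_(j < n.+1) bcoef n j * (x ^+ j * derive1n j f x) =
  x ^+ (2 * n + 1) * ((- pi^-1) ^+ n * gamma n x).
Proof.
elim: n x => [|n IH] x.
  by rewrite big_ord1 bcoef00 mul1r !expr0 !mul1r expr1 g0.
pose c : R := (- pi^-1) ^+ n.
have dl : is_derive x (1 : R) (fun x => \sum_(j < n.+1) bcoef n j * (x ^+ j * derive1n j f x))
   (\sum_(j < n.+1) bcoef n j * (j%:R * x ^+ j.-1 * derive1n j f x + x ^+ j * derive1n j.+1 f x)).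
  have -> : (fun x => \sum_(j < n.+1) bcoef n j * (x ^+ j * derive1n j f x)) =
     \sum_(j < n.+1) (fun x => bcoef n j * (x ^+ j * derive1n j f x)).
    by apply/funext => y; rewrite fct_sumE.
  elim/big_ind2 : _ => [|? ? ? ? h1 h2|i _]; [exact: der_cst|exact: derD|].
  by apply: derZ; apply: derM; [exact: derX|exact: smooth_derive].
have dr : is_derive x (1 : R) (fun x => x ^+ (2 * n + 1) * (c * gamma n x))
   ((2 * n + 1)%:R * x ^+ (2 * n) * (c * gamma n x) +
    x ^+ (2 * n + 1) * (c * (2 * x * gamma n.+1 x))).
  apply: (is_derive_eq (derM (derX x (2 * n + 1)) (derZ c (gd n x)))).
  by rewrite [in RHS]addn1 addn1.
have e : (fun x => \sum_(j < n.+1) bcoef n j * (x ^+ j * derive1n j f x)) =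
    (fun x => x ^+ (2 * n + 1) * (c * gamma n x)) by apply/funext => y; exact: IH.
rewrite e in dl; have {dl dr e} := der_unique dl dr.
move=> /(congr1 (fun y => x * y)).
have -> : x * ((2 * n + 1)%:R * x ^+ (2 * n) * (c * gamma n x) +
    x ^+ (2 * n + 1) * (c * (2 * x * gamma n.+1 x))) =
   (2 * n%:R + 1) * (x ^+ (2 * n + 1) * (c * gamma n x)) +
   2 * c * (x ^+ (2 * n + 3) * gamma n.+1 x).
  by rewrite natrD natrM !addnS addn0 !exprS; ring.
rewrite -IH => E.
have p0 := pi_gt0 R.
have pn : 2 * pi != 0 :> R by rewrite mulf_neq0// gt_eqF.
have -> : x ^+ (2 * n.+1 + 1) * ((- pi^-1) ^+ n.+1 * gamma n.+1 x) =
    - (2 * pi)^-1 * (2 * c * (x ^+ (2 * n + 3) * gamma n.+1 x)).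
  have -> : (2 * n.+1 + 1 = 2 * n + 3)%N by lia.
  have q (p : R) : 0 < p -> - p^-1 * c = - (2 * p)^-1 * (2 * c).
    by move=> p1; field; rewrite gt_eqF.
  rewrite exprS -/c q//; move: ((2 * pi)^-1) => P; ring.
apply: (mulfI pn); rewrite mulNr mulrN mulrA mulfV// mul1r.
pose y j := x ^+ j * derive1n j f x.
have -> : 2 * c * (x ^+ (2 * n + 3) * gamma n.+1 x) =
    \sum_(j < n.+1) (bcoef n j * (j%:R * y j + y j.+1)) -
    (2 * n%:R + 1) * \sum_(j < n.+1) bcoef n j * y j.
  apply/eqP; rewrite eq_sym subr_eq addrC -E; apply/eqP.
  rewrite mulr_sumr; apply: eq_bigr => j _; rewrite [RHS]mulrCA; congr (_ * _).
  rewrite [RHS]mulrDr /y exprS; congr (_ + _); last by ring.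
  by case: (nat_of_ord j) => [|i]; [rewrite !mul0r ?mulr0|rewrite /= exprS; ring].
rewrite [LHS]mulr_sumr.
have -> : - (\sum_(j < n.+1) bcoef n j * (j%:R * y j + y j.+1) -
    (2 * n%:R + 1) * \sum_(j < n.+1) bcoef n j * y j)
  = \sum_(j < n.+1) (2 * n%:R + 1 - j%:R) * bcoef n j * y j -
    \sum_(j < n.+1) bcoef n j * y j.+1.
  rewrite [X in - (_ - X)]mulr_sumr -!sumrB -sumrN.
  by apply: eq_bigr => j _; ring.
transitivity (\sum_(j < n.+2) 2 * pi * bcoef n.+1 j * y j).
  by apply: eq_bigr => j _; rewrite mulrA.
clearbody y.
rewrite big_ord_recl big_ord_recr [in RHS]big_ord_recl [X in _ - X]big_ord_recr.
rewrite /bump /= bcoefS0 bcoef_last.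
have -> : \sum_(i < n) 2 * pi * bcoef n.+1 i.+1 * y i.+1 =
   \sum_(i < n) (2 * n%:R + 1 - i.+1%:R) * bcoef n i.+1 * y i.+1 -
   \sum_(i < n) bcoef n i * y i.+1.
  rewrite -sumrB; apply: eq_bigr => i _.
  by rewrite bcoefSS// -natr1; ring.
by ring.
Qed.

End Beta_identity.

(** * Poisson summation for odd functions *)
Section Lattice_norms.
Context {R : realType} {k : nat}.
Implicit Types (eta : 'rV[R]_k) (m : 'rV[int]_k).

Lemma coord_le_enorm (u : 'rV[R]_k) i : `|u 0 i| <= enorm u.
Proof.
rewrite -sqrtr_sqr ler_wsqrtr// /dotv (bigD1 i)//= -expr2 lerDl.
by apply: sumr_ge0 => j _; rewrite -expr2 sqr_ge0.
Qed.

(** Some coordinate of [eta] is not an integer, and its distance to the integers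
    is a lower bound. *)
Lemma enorm_gap eta : ~ (exists m : 'rV[int]_k, eta = zvec m) ->
  exists2 d : R, 0 < d & forall m, d <= enorm (zvec m + eta).
Proof.
move=> nint; have [i hi] : exists i, forall n : int, eta 0 i != n%:~R.
  apply/not_existsP => h; apply: nint.
  have h' i : exists n : int, eta 0 i = n%:~R.
    by have /existsNP[n /negP] := h i; rewrite negbK => /eqP; exists n.
  have [f fE] := choice h'.
  by exists (\row_i f i); apply/rowP => j; rewrite !mxE fE.
set a := eta 0 i in hi.
have /andP[f1 f2] := floor_itv a.
have {}f1 : (Num.floor a)%:~R < a by rewrite lt_neqAle f1 andbT eq_sym.
exists (Num.min (a - (Num.floor a)%:~R) ((Num.floor a + 1)%:~R - a)).
  by rewrite lt_min !subr_gt0 f1 f2.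
move=> m; apply: le_trans (coord_le_enorm _ i); rewrite !mxE -/a.
have [mf|mf] := leP (- m 0 i) (Num.floor a).
  rewrite ge_min; apply/orP; left; apply: le_trans (ler_norm _).
  have : (- m 0 i)%:~R <= (Num.floor a)%:~R :> R by rewrite ler_int.
  by rewrite intrN; lra.
rewrite ge_min; apply/orP; right; rewrite -normrN; apply: le_trans (ler_norm _).
have : (Num.floor a + 1)%:~R <= (- m 0 i)%:~R :> R by rewrite ler_int lezD1.
by rewrite intrN; lra.
Qed.

(** In each coordinate, [1 + m_i ^+ 2] is at most a constant times
    [1 + enorm (zvec m + eta) ^+ 2]; multiply over the [k] coordinates. *)
Lemma weight_ge_norm eta : exists2 C : R, 0 <= C &
  forall m, (1 + enorm (zvec m + eta) ^+ 2) ^- k <= C * weight m.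
Proof.
pose C0 : R := 2 + 2 * enorm eta ^+ 2.
have C00 : 0 < C0 by rewrite ltr_wpDr// mulr_ge0// sqr_ge0.
exists (C0 ^+ k); first by rewrite exprn_ge0// ltW.
move=> m; set r := enorm _.
have r1 : 0 < 1 + r ^+ 2 by rewrite ltr_wpDr// sqr_ge0.
have hi i : (1 + r ^+ 2)^-1 <= C0 * zweight (m 0 i).
  have n1 : 0 < 1 + (m 0 i)%:~R ^+ 2 :> R by rewrite ltr_wpDr// sqr_ge0.
  rewrite /zweight -[leLHS]mul1r ler_pdivlMr// mulrAC mul1r ler_pdivrMr//.
  have h1 : `|(zvec m + eta) 0 i| <= r by exact: coord_le_enorm.
  have h2 : `|eta 0 i| <= enorm eta by exact: coord_le_enorm.
  have s1 : ((m 0 i)%:~R + eta 0 i) ^+ 2 <= r ^+ 2.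
    rewrite -real_normK ?num_real// lerXn2r ?nnegrE// ?sqrtr_ge0//.
    by move: h1; rewrite !mxE.
  have s2 : (eta 0 i) ^+ 2 <= enorm eta ^+ 2.
    by rewrite -real_normK ?num_real// lerXn2r ?nnegrE// ?sqrtr_ge0.
  have s3 := sqr_ge0 ((m 0 i)%:~R + 2 * eta 0 i).
  have s4 := mulr_ge0 (sqr_ge0 (enorm eta)) (sqr_ge0 r).
  by rewrite /C0; lra.
have -> : (1 + r ^+ 2) ^- k = \prod_(i < k) (1 + r ^+ 2)^-1.
  by rewrite prodr_const card_ord exprVn.
have -> : C0 ^+ k * weight m = \prod_(i < k) (C0 * zweight (m 0 i)).
  by rewrite big_split/= prodr_const card_ord.
by apply: ler_prod => i _; rewrite hi andbT invr_ge0 ltW.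
Qed.

Lemma inv_pow_weight eta (d : R) : 0 < d -> (forall m, d <= enorm (zvec m + eta)) ->
  exists2 C : R, 0 <= C & forall m, enorm (zvec m + eta) ^- (2 * k) <= C * weight m.
Proof.
move=> d0 hd; have [C C0 hC] := weight_ge_norm eta.
have d2 : 0 < d ^+ 2 by rewrite exprn_gt0.
pose q := (1 + d ^+ 2) / d ^+ 2.
have q0 : 0 < q by rewrite divr_gt0// ltr_wpDl.
exists (q ^+ k * C); first by rewrite mulr_ge0// exprn_ge0// ltW.
move=> m; rewrite -mulrA; apply: (@le_trans _ _ (q ^+ k * (1 + enorm (zvec m + eta) ^+ 2) ^- k)).
  have := hd m; set r := enorm _ => dr.
  have r0 : 0 < r by exact: lt_le_trans dr.
  have r2 : 0 < r ^+ 2 by rewrite exprn_gt0.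
  have r1 : 0 < 1 + r ^+ 2 by rewrite ltr_wpDr// ltW.
  have -> : r ^- (2 * k) = (r ^+ 2)^-1 ^+ k by rewrite exprM exprVn.
  have -> : q ^+ k * (1 + r ^+ 2) ^- k = (q * (1 + r ^+ 2)^-1) ^+ k by rewrite [RHS]exprMn [in RHS]exprVn.
  apply: lerXn2r; rewrite ?nnegrE ?invr_ge0 ?(ltW r2)//.
    by rewrite mulr_ge0 ?invr_ge0 ?(ltW q0) ?(ltW r1).
  rewrite ler_pdivlMr// mulrC ler_pdivrMr// /q mulrAC ler_pdivlMr//.
  have : d ^+ 2 <= r ^+ 2 by rewrite lerXn2r// nnegrE ltW.
  lra.
by rewrite ler_wpM2l ?exprn_ge0 ?(ltW q0).
Qed.

End Lattice_norms.

Section Main_identity.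
Context {R : realType} (n : nat).
Local Notation k := (2 * n + 3)%N.
Local Notation K := (2 * k)%N.
Variables (eta xi : 'rV[R]_k).
Hypothesis eta_nint : ~ (exists m : 'rV[int]_k, eta = zvec m).
Hypothesis xi_nint : ~ (exists m : 'rV[int]_k, xi = zvec m).
Local Notation r m := (enorm (zvec m + eta)).
Local Notation rho m := (enorm (zvec m + xi)).

Definition space_term (F : R -> R) (m : 'rV[int]_k) : R[i] :=
  (sint F (r m) / r m)%:C * e2pi (dotv (zvec m) xi).

Definition freq_term (g : R -> R) (m : 'rV[int]_k) : R[i] :=
  ((- pi^-1) ^+ n * g (rho m))%:C * e2pi (dotv (zvec m) (- eta)).

(** Convergence is part of the relation, so that it passes to linear combinations
    together with the values. *)
Definition poisson_pair (F g : R -> R) (U V : R[i]) :=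
  ccvg (fun N => \sum_(m <- box k N) space_term F m) U /\
  ccvg (fun N => \sum_(m <- box k N) freq_term g m) V.

(** With [t = pi / i], [sint F r / r] is [t * Num.sqrt t * expR (- (pi * t * r ^+ 2))]
    for this [F], and both sums are multiples of theta series in dimension [k].  The
    powers of [t] agree because [t ^+ n * (t * Num.sqrt t) = Num.sqrt t ^+ k]. *)
Lemma poisson_gaussian (i : nat) : (2 <= i)%N -> exists V,
  poisson_pair (fun x => x * gfun i%:R x)
    (fun x => (- i%:R) ^+ n * gfun i%:R x) (e2pi (- dotv eta xi) * V) V.
Proof.
move=> i2; have i0 : 0 < i%:R :> R by rewrite ltr0n (leq_trans _ i2).
have p0 := pi_gt0 R.
pose t : R := pi / i%:R; have t0 : 0 < t by rewrite divr_gt0.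
have st0 : 0 < Num.sqrt t by rewrite sqrtr_gt0.
pose Th := \prod_j clim (theta_sum t^-1 (xi 0 j) ((- eta) 0 j)).
exists ((t ^+ n)^-1%:C * Th); split.
- have h := ccvgZ ((t * Num.sqrt t)%:C) (@mtheta_ccvg R _ t eta xi t0).
  have -> : e2pi (- dotv eta xi) * ((t ^+ n)^-1%:C * Th) = (t * Num.sqrt t)%:C *
      \prod_j clim (theta_sum t (eta 0 j) (xi 0 j)).
    rewrite /Th mtheta_transformation//.
    have -> : t * Num.sqrt t = (t ^+ n)^-1 * Num.sqrt t ^+ k.
      rewrite exprD exprM sqr_sqrtr ?ltW// mulrA mulVf ?expf_neq0 ?gt_eqF// mul1r.
      by rewrite exprS sqr_sqrtr ?ltW// mulrC.
    rewrite rmorphM/= -!mulrA; set P := \prod_j _.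
    rewrite mulrCA; congr (_ * _); rewrite mulrCA; congr (_ * _).
    by rewrite mulrA -e2piD addNr e2pi0 mul1r.
  apply: near_ccvg h; apply: nearW => N; rewrite mulr_sumr; apply: eq_bigr => m _.
  rewrite /mtheta_term /space_term mulrA -rmorphM/=; congr (_%:C * _).
  have rm : enorm (zvec m + eta) != 0.
    by have [d d0 hd] := enorm_gap eta_nint; rewrite gt_eqF// (lt_le_trans d0).
  rewrite sint_gaussian ?ler_nat// -/t.
  have -> : pi ^+ 2 / i%:R = pi * t by rewrite /t expr2 mulrA.
  have aux (x y z w : R) : w != 0 -> x * y * z = w * x * y * z / w.
    by move=> w0; field.
  by apply: aux.
- have ti0 : 0 < t^-1 by rewrite invr_gt0.
  have h := ccvgZ (((t ^+ n)^-1)%:C) (@mtheta_ccvg R _ t^-1 xi (- eta) ti0).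
  apply: near_ccvg h; apply: nearW => N; rewrite mulr_sumr; apply: eq_bigr => m _.
  rewrite /mtheta_term /freq_term mulrA -rmorphM/=; congr (_%:C * _).
  rewrite [RHS]mulrA -[in RHS]exprMn mulrNN -exprVn; congr (_ ^+ _ * expR (- (_ * _))).
    by rewrite /t invf_div mulrC.
  by rewrite /t invf_div mulrCA mulfV ?mulr1// gt_eqF.
Qed.

Lemma poisson_zero : poisson_pair (fun=> 0) (fun=> 0) (e2pi (- dotv eta xi) * 0) 0.
Proof.
have sz (x : R) : sint (fun=> 0) x = 0.
  rewrite /sint; under eq_Rintegral do rewrite mul0r.
  by rewrite Rintegral_cst// mul0r.
split.
- rewrite mulr0; apply: near_ccvg (ccvg_cst 0); apply: nearW => N.
  by rewrite big1// => m _; rewrite /space_term sz mul0r mul0r.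
- apply: near_ccvg (ccvg_cst 0); apply: nearW => N.
  by rewrite big1// => m _; rewrite /freq_term mulr0 mul0r.
Qed.

Lemma poisson_add F g U V F' g' U' V' C C' : gdom F C -> gdom F' C' ->
  poisson_pair F g U V -> poisson_pair F' g' U' V' ->
  poisson_pair (fun x => F x + F' x) (fun x => g x + g' x) (U + U') (V + V').
Proof.
move=> FC FC' [u v] [u' v']; split.
- apply: near_ccvg (ccvgD u u'); apply: nearW => N; rewrite -big_split/=.
  apply: eq_bigr => m _; rewrite /space_term -mulrDl -rmorphD/= -mulrDl.
  congr ((_ / _)%:C * _); rewrite /sint -RintegralD//.
  + by apply: eq_Rintegral => x _; rewrite [RHS]mulrDl.
  + exact: (gdom_integrable (gdom_sin _ FC)).
  + exact: (gdom_integrable (gdom_sin _ FC')).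
- apply: near_ccvg (ccvgD v v'); apply: nearW => N; rewrite -big_split/=.
  by apply: eq_bigr => m _; rewrite /freq_term -mulrDl -rmorphD/= -mulrDr.
Qed.

Lemma poisson_scale (c : R) F g U V C : gdom F C -> poisson_pair F g U V ->
  poisson_pair (fun x => c * F x) (fun x => c * g x) (c%:C * U) (c%:C * V).
Proof.
move=> FC [u v]; split.
- apply: near_ccvg (ccvgZ c%:C u); apply: nearW => N; rewrite mulr_sumr.
  apply: eq_bigr => m _; rewrite /space_term mulrA -rmorphM/= mulrA.
  congr ((_ / _)%:C * _); rewrite /sint -RintegralZl//; last first.
    exact: (gdom_integrable (gdom_sin _ FC)).
  by apply: eq_Rintegral => x _; rewrite mulrA.
- apply: near_ccvg (ccvgZ c%:C v); apply: nearW => N; rewrite mulr_sumr.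
  by apply: eq_bigr => m _; rewrite /freq_term mulrA -rmorphM/= mulrCA.
Qed.

Lemma poisson_comb (c : {poly R}) : c`_0 = 0 -> c`_1 = 0 -> exists C V,
  gdom (fun x => x * gauss_comb c 0 x) C /\
  poisson_pair (fun x => x * gauss_comb c 0 x) (gauss_comb c n) (e2pi (- dotv eta xi) * V) V.
Proof.
move=> c0 c1.
have e0 : (fun x => x * gauss_comb c 0 x) =
    (fun x => \sum_(i < size c) c`_i * (x * gfun i%:R x)).
  by apply/funext => x; rewrite mulr_sumr; apply: eq_bigr => i _; rewrite expr0; ring.
have e1 : gauss_comb c n = (fun x => \sum_(i < size c) c`_i * ((- i%:R) ^+ n * gfun i%:R x)).
  by apply/funext => x; apply: eq_bigr => i _; rewrite mulrA.
rewrite e0 e1; elim: (size c) => [|N [C [V [gC pV]]]].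
  exists 0, 0; split.
    split=> [|x]; last by rewrite big_ord0 normr0 mul0r.
    have -> : (fun x => \sum_(i < 0) c`_i * (x * gfun i%:R x)) = (fun=> 0).
      by apply/funext => x; rewrite big_ord0.
    by move=> x; exact: cvg_cst.
  have -> : (fun x => \sum_(i < 0) c`_i * (x * gfun i%:R x)) = (fun=> 0).
    by apply/funext => x; rewrite big_ord0.
  have -> : (fun x => \sum_(i < 0) c`_i * ((- i%:R) ^+ n * gfun i%:R x)) = (fun=> 0).
    by apply/funext => x; rewrite big_ord0.
  exact: poisson_zero.
have [C' [V' [gC' pV']]] : exists C' V', gdom (fun x => c`_N * (x * gfun N%:R x)) C' /\
    poisson_pair (fun x => c`_N * (x * gfun N%:R x))
      (fun x => c`_N * ((- N%:R) ^+ n * gfun N%:R x)) (e2pi (- dotv eta xi) * V') V'.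
  have [N2|N2] := leqP 2 N.
    have [V' pV'] := poisson_gaussian N2.
    have g1 := @gdom_pow_gfun R 1 N%:R.
    rewrite ler_nat in g1; have {}g1 := g1 N2.
    exists (`|c`_N| * (1 + 1`!%:R)), ((c`_N)%:C * V'); split; first exact: gdomZ.
    by rewrite mulrCA; apply: poisson_scale g1 pV'.
  have -> : c`_N = 0 by case: N N2 {gC pV} => [|[|]].
  exists 0, 0; split.
    split=> [|x]; last by rewrite mul0r normr0 mul0r.
    have -> : (fun x : R => 0 * (x * gfun N%:R x)) = (fun=> 0 : R).
      by apply/funext => x; rewrite mul0r.
    by move=> x; exact: cvg_cst.
  have -> : (fun x : R => 0 * (x * gfun N%:R x)) = (fun=> 0 : R).
    by apply/funext => x; rewrite mul0r.
  have -> : (fun x : R => 0 * ((- N%:R) ^+ n * gfun N%:R x)) = (fun=> 0 : R).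
    by apply/funext => x; rewrite mul0r.
  exact: poisson_zero.
exists (C + C'), (V + V').
have e2 : (fun x => \sum_(i < N.+1) c`_i * (x * gfun i%:R x)) =
   (fun x => \sum_(i < N) c`_i * (x * gfun i%:R x) + c`_N * (x * gfun N%:R x)).
  by apply/funext => x; rewrite big_ord_recr.
have e3 : (fun x => \sum_(i < N.+1) c`_i * ((- i%:R) ^+ n * gfun i%:R x)) =
   (fun x => \sum_(i < N) c`_i * ((- i%:R) ^+ n * gfun i%:R x) +
     c`_N * ((- N%:R) ^+ n * gfun N%:R x)).
  by apply/funext => x; rewrite big_ord_recr.
rewrite e2 e3; split; first exact: gdomD.
by rewrite mulrDr; apply: poisson_add gC gC' pV pV'.
Qed.

(** Both sums are small with the tower: [K] integrations by parts bound the sine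
    transform by a multiple of [e / r ^+ K], which is summable over the lattice. *)
Lemma poisson_small : exists2 D : R, 0 <= D & forall (delta : nat -> R -> R) (e : R),
  0 < e -> tower K delta ->
  (forall i, (i <= K)%N -> forall x, `|delta i x| <= e * gfun 2 x) ->
  exists U V, [/\ gdom (fun x => x * delta 0 x) (2 * e),
    poisson_pair (fun x => x * delta 0 x) (delta n) U V, cabs U <= D * e & cabs V <= D * e].
Proof.
have [d d0 hd] := enorm_gap eta_nint; have [C C0 hC] := inv_pow_weight d0 hd.
have [d' d0' hd'] := enorm_gap xi_nint; have [C' C0' hC'] := inv_pow_weight d0' hd'.
have [M [M0 hM]] := @tower_decay R K 1.
pose D1 := M / d * C; pose D2 := pi^-1 ^+ n * k`!%:R * C'.
have p0 := pi_gt0 R.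
have D10 : 0 <= D1 by rewrite !mulr_ge0 ?invr_ge0 ?(ltW d0).
have D20 : 0 <= D2 by rewrite !mulr_ge0 ?exprn_ge0 ?invr_ge0 ?(ltW p0).
pose W : R := 5 ^+ k.
have W0 : 0 <= W by rewrite exprn_ge0.
exists (2 * ((D1 + D2) * W)); first by rewrite !mulr_ge0 ?addr_ge0.
move=> delta e e0 td hdelta.
have b1 m : cabs (space_term (fun x => x * delta 0 x) m) <= (D1 * e) * weight m.
  have rd := hd m; have r0 : 0 < r m by exact: lt_le_trans rd.
  rewrite cabsM cabs_e2pi mulr1 cabsR normrM normfV (gtr0_norm r0).
  have [h _] := hM K delta e td (ltW e0) hdelta 0%N (r m) (leqnn _) r0.
  have {}h : `|sint (fun x => x * delta 0 x) (r m)| <= M * e / r m ^+ K by exact: h.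
  apply: (@le_trans _ _ (M * e / r m ^+ K / d)).
    by apply: ler_pM; rewrite ?invr_ge0 ?(ltW r0)// lef_pV2.
  have -> : M * e / r m ^+ K / d = (M / d * e) * r m ^- K by ring.
  have -> : D1 * e * weight m = (M / d * e) * (C * weight m) by rewrite /D1; ring.
  by apply: ler_wpM2l; rewrite ?hC// !mulr_ge0 ?invr_ge0 ?(ltW d0) ?(ltW e0).
have nK : (n <= K)%N by lia.
have b2 m : cabs (freq_term (delta n) m) <= (D2 * e) * weight m.
  have rd := hd' m; have r0 : 0 < rho m by exact: lt_le_trans rd.
  rewrite cabsM cabs_e2pi mulr1 cabsR normrM normrX normrN normfV (gtr0_norm p0).
  have h := hdelta n nK (rho m).
  have g1 : gfun 2 (rho m) <= k`!%:R * rho m ^- K.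
    rewrite ler_pdivlMr ?exprn_gt0// mulrC.
    apply: (@le_trans _ _ (k`!%:R * expR (rho m ^+ 2) * gfun 2 (rho m))).
      rewrite ler_wpM2r ?expR_ge0//; move: (rho m) => z.
      by rewrite [(2 * k)%N]mul2n sqr_pow_le_expR.
    rewrite -[leLHS]mulrA -[leRHS]mulr1 ler_wpM2l// /gfun -expRD expR_le1.
    by move: (rho m) => z; have := sqr_ge0 z; lra.
  have -> : D2 * e * weight m = pi^-1 ^+ n * (e * (k`!%:R * (C' * weight m))) by rewrite /D2; ring.
  apply: ler_wpM2l; first by rewrite exprn_ge0// invr_ge0 ltW.
  apply: (le_trans h); apply: ler_wpM2l; first exact: ltW.
  by apply: (le_trans g1); apply: ler_wpM2l.
have bu := @box_uniq k; have bi := @box_incr k.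
have wg := @weight_ge0 R k; have ws := @weight_sum R k.
have c1 := dominated_ccvg bu bi wg ws b1.
have c2 := dominated_ccvg bu bi wg ws b2.
have l1 := dominated_clim_bound bu bi wg ws b1.
have l2 := dominated_clim_bound bu bi wg ws b2.
exists (clim (fun N => \sum_(m <- box k N) space_term (fun x => x * delta 0 x) m)).
exists (clim (fun N => \sum_(m <- box k N) freq_term (delta n) m)).
have fin (x y : R) : 0 <= y -> 0 <= x -> 2 * (`|x * e| * W) <= 2 * ((x + y) * W) * e.
  move=> y0 x0; rewrite ger0_norm ?mulr_ge0 ?(ltW e0)//.
  have : 0 <= y * W * e by rewrite !mulr_ge0 ?(ltW e0).
  lra.
split => //.
- have := @gdom_pow_mul R 1 (delta 0) e (tower_continuous td (leq0n _)) (hdelta 0%N (leq0n _)).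
  by have -> : 2 * e = (1 + 1`!%:R) * e by [].
- exact: le_trans l1 (fin _ _ D20 D10).
- by apply: (le_trans l2); rewrite addrC; exact: fin.
Qed.

(** Up to an error proportional to [e], the two sums are those of a combination of
    Gaussians, for which the identity is known. *)
Theorem poisson_identity (f : R -> R) (gamma : nat -> R -> R) (A : R) :
  (forall i (x : R), is_derive x (1 : R) (gamma i) (2 * x * gamma i.+1 x)) ->
  (forall i, evenf (gamma i)) -> 0 < A -> (forall i x, A < `|x| -> gamma i x = 0) ->
  (forall x, x * gamma 0 x = f x) ->
  exists V, poisson_pair f (gamma n) (e2pi (- dotv eta xi) * V) V.
Proof.
move=> gd ge A0 gs gf; have [D D0 hD] := poisson_small.
have fE : f = (fun x => x * gamma 0 x) by apply/funext => x; rewrite gf.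
have approx (e : R) : 0 < e -> exists U V V', [/\ poisson_pair f (gamma n) U V,
    cabs (U - e2pi (- dotv eta xi) * V') <= D * e & cabs (V - V') <= D * e].
  move=> e0; have [c [c0 c1 hc]] := gaussian_density K gd ge A0 gs e0.
  pose delta i x := gamma i x - gauss_comb c i x.
  have td : tower K delta.
    have dd i (x : R) : is_derive x (1 : R) (delta i) (2 * x * delta i.+1 x).
      apply: (is_derive_eq (derB (gd i x) (gauss_comb_derive c i x))).
      by rewrite /delta mulrBr.
    by split=> [i _|]; [exact: dd|exact: (der_continuous (dd K))].
  have [U [V [gC pUV cU cV]]] := hD delta e e0 td hc.
  have [C [V' [gC' pV']]] := poisson_comb c0 c1.
  exists (e2pi (- dotv eta xi) * V' + U), (V' + V), V'; split.
  - have := poisson_add gC' gC pV' pUV.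
    have -> : (fun x => x * gauss_comb c 0 x + x * delta 0 x) = f.
      by apply/funext => x; rewrite fE /delta; ring.
    have -> : (fun x => gauss_comb c n x + delta n x) = gamma n.
      by apply/funext => x; rewrite /delta addrC subrK.
    by [].
  - by rewrite addrAC subrr add0r.
  - by rewrite addrAC subrr add0r.
have [U [V [_ [[u v] _ _]]]] := approx 1 ltr01.
exists V; split => //; suff -> : e2pi (- dotv eta xi) * V = U by [].
apply/eqP; rewrite eq_sym -subr_eq0; apply/eqP; apply: cabs_eq0; apply/eqP.
rewrite eq_le cabs_ge0 andbT; apply/ler_addgt0Pr => e e0.
have D2 : 0 < 2 * D + 1 by rewrite ltr_wpDl// mulr_ge0.
have [U' [V' [V'' [[u' v'] h1 h2]]]] := approx (e / (2 * D + 1)) (divr_gt0 e0 D2).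
rewrite (ccvg_unique u u') (ccvg_unique v v').
have -> : U' - e2pi (- dotv eta xi) * V' = (U' - e2pi (- dotv eta xi) * V'') -
    e2pi (- dotv eta xi) * (V' - V'') by ring.
apply: (le_trans (cabsB _ _)); rewrite cabsM cabs_e2pi mul1r add0r.
apply: (le_trans (lerD h1 h2)).
have x0 := ltW (divr_gt0 e0 D2).
have -> : e = e / (2 * D + 1) * (2 * D + 1) by rewrite mulfVK// gt_eqF.
rewrite mulfK ?gt_eqF//; move: x0; set x := e / _; lra.
Qed.

End Main_identity.

(** * Fourier transforms of test functions *)
Section Compact_support.
Context {R : realType}.

Lemma test_support (phi : R -> R[i]) : test_function phi ->
  exists2 A : R, 0 < A & forall x, A < `|x| -> phi x = 0.
Proof.
move=> [_ /compact_bounded [M [_ hM]]].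
exists (`|M| + 1); first by rewrite ltr_wpDl.
move=> x xA; apply/eqP; apply/negP => /negP px.
have hM' := hM (`|M| + 1) (le_lt_trans (ler_norm _) (ltr_pwDr ltr01 (lexx _))).
have : `|x| <= `|M| + 1 by apply: hM'; exact: subset_closure.
by rewrite leNgt xA.
Qed.

Lemma gdom_compact (u : R -> R) (A : R) : continuous u -> 0 < A ->
  (forall x, A < `|x| -> u x = 0) -> exists C, gdom u C.
Proof.
move=> cu A0 uA; have [M M0 hM] := continuous_bounded cu (ltW A0).
exists (M * expR (A ^+ 2)); split => // x.
have [xA|Ax] := leP `|x| A; last first.
  by rewrite uA// normr0 !mulr_ge0 ?expR_ge0.
apply: (le_trans (hM x xA)); rewrite -mulrA ler_peMr// /gauss_fun -expRD.
rewrite -expR0 ler_expR subr_ge0 -[x ^+ 2]real_normK ?num_real//.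
by rewrite lerXn2r// nnegrE ltW.
Qed.

Definition antisym (u : R -> R) (x : R) : R := u x - u (- x).

Lemma antisym_derive1n (u : R -> R) j x : smooth_real u ->
  derive1n j (antisym u) x = derive1n j u x - (-1) ^+ j * derive1n j u (- x).
Proof.
move=> su; elim: j x => [|j IH] x; first by rewrite expr0 mul1r.
have -> : derive1n j.+1 (antisym u) x = derive1 (derive1n j (antisym u)) x by rewrite derive1nS.
have -> : derive1n j (antisym u) = (fun x => derive1n j u x - (-1) ^+ j * derive1n j u (- x)).
  exact/funext.
apply: der_val; have h := derB (smooth_derive j x su)
  (derZ ((-1) ^+ j) (der_reflect (smooth_derive j (- x) su))).
by apply: (is_derive_eq h); rewrite exprS; ring.
Qed.

Lemma antisym_smooth (u : R -> R) : smooth_real u -> smooth_real (antisym u).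
Proof.
move=> su j x.
have -> : derive1n j (antisym u) = (fun x => derive1n j u x - (-1) ^+ j * derive1n j u (- x)).
  by apply/funext => y; exact: antisym_derive1n.
have h := derB (smooth_derive j x su)
  (derZ ((-1) ^+ j) (der_reflect (smooth_derive j (- x) su))).
exact: der_derivable h.
Qed.

Lemma antisym_odd (u : R -> R) : oddf (antisym u).
Proof. by move=> x; rewrite /antisym opprK opprB. Qed.

Lemma antisym_supp (u : R -> R) (A : R) : (forall x, A < `|x| -> u x = 0) ->
  forall x, A < `|x| -> antisym u x = 0.
Proof. by move=> uA x Ax; rewrite /antisym !uA ?normrN// subr0. Qed.

Lemma sint_odd (u : R -> R) (C t : R) : gdom u C -> sint u (- t) = - sint u t.
Proof.
move=> uC; rewrite -[RHS]mulN1r /sint -RintegralZl//; last first.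
  exact: (gdom_integrable (gdom_sin _ uC)).
apply: eq_Rintegral => x _.
by rewrite mulrN mulNr sinN mulN1r mulrN.
Qed.

Lemma cost_even (u : R -> R) (t : R) : cost u (- t) = cost u t.
Proof. by apply: eq_Rintegral => x _; rewrite mulrN mulNr cosN. Qed.

Lemma sint_antisym (u : R -> R) (C t : R) : gdom u C -> sint (antisym u) t = 2 * sint u t.
Proof.
move=> uC; have [cu hu] := uC.
have uC' : gdom (fun x => u (- x)) C.
  split=> [x|x]; first by apply: continuous_comp; [exact: oppr_continuous|exact: cu].
  by apply: (le_trans (hu _)); rewrite /gauss_fun sqrrN.
have e : sint (antisym u) t = sint u t - sint (fun x => u (- x)) t.
  rewrite /sint -RintegralB//.
  + by apply: eq_Rintegral => x _; rewrite [LHS]mulrBl.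
  + exact: (gdom_integrable (gdom_sin _ uC)).
  + exact: (gdom_integrable (gdom_sin _ uC')).
have e2 : sint (fun x => u (- x)) t = - sint u t.
  have := integral_reflection (gdom_sin (2 * pi * t) uC); rewrite -/(sint u t) => <-.
  rewrite -[RHS]mulN1r -RintegralZl//.
    by apply: eq_Rintegral => x _; rewrite mulrN sinN; ring.
  have g : gdom (fun x => u (- x) * sin (- (2 * pi * t) * x)) C by exact: gdom_sin.
  have -> : (fun x => u (- x) * sin (2 * pi * t * - x)) =
      (fun x => u (- x) * sin (- (2 * pi * t) * x)).
    by apply/funext => x; rewrite mulrN mulNr.
  exact: (gdom_integrable g).
by rewrite e e2 opprK mulr_natl mulr2n.
Qed.

Lemma fourierE (phi : R -> R[i]) (C C' t : R) :
  let u := fun x => complex.Re (phi x) in let v := fun x => complex.Im (phi x) in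
  gdom u C -> gdom v C' ->
  fourier phi t = (cost u t + sint v t) +i* (cost v t - sint u t).
Proof.
move=> u v uC vC; rewrite /fourier /cintegral; congr (_ +i* _).
- rewrite /cost /sint -RintegralD//.
  + apply: eq_Rintegral => x _; rewrite /u /v /expi cosN sinN.
    by case: (phi x) => a b /=; rewrite mulrN opprK.
  + exact: (gdom_integrable (gdom_cos _ uC)).
  + exact: (gdom_integrable (gdom_sin _ vC)).
- rewrite /cost /sint -RintegralB//.
  + apply: eq_Rintegral => x _; rewrite /u /v /expi cosN sinN.
    by case: (phi x) => a b /=; rewrite mulrN addrC.
  + exact: (gdom_integrable (gdom_cos _ vC)).
  + exact: (gdom_integrable (gdom_sin _ uC)).
Qed.

(** The cosine transforms cancel, being even in [t]; this is how the difference of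
    the masses at [t] and [- t] selects the odd part of [phi]. *)
Lemma fourier_antisym (phi : R -> R[i]) (C C' t : R) :
  let u := fun x => complex.Re (phi x) in let v := fun x => complex.Im (phi x) in
  gdom u C -> gdom v C' ->
  fourier phi t - fourier phi (- t) =
    - 'i%C * ((sint (antisym u) t)%:C + 'i%C * (sint (antisym v) t)%:C).
Proof.
move=> u v uC vC; rewrite !(fourierE _ uC vC) !cost_even.
rewrite (sint_odd _ uC) (sint_odd _ vC) (sint_antisym _ uC) (sint_antisym _ vC).
apply/eqP; rewrite eq_complex /=; apply/andP; split; apply/eqP; ring.
Qed.

End Compact_support.

(** * The distribution sigma and its transform *)
Section Lattice_sums.
Context {R : realType} {k : nat}.

Lemma box_exhausts (eta : 'rV[R]_k) (A : R) : exists N0 : nat, forall N (m : 'rV[int]_k),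
  (N0 <= N)%N -> m \notin box k N -> A < enorm (zvec m + eta).
Proof.
exists (Num.trunc (A + enorm eta)).+1 => N m N0N.
rewrite mem_box => mN; have [i mi] : exists i, N%:Z < `|m 0 i|.
  apply: contrapT => /forallNP h; move/negP: mN; apply; apply/forallP => i.
  by rewrite mem_zbox leNgt; apply/negP; exact: h.
apply: lt_le_trans (coord_le_enorm _ i); rewrite !mxE.
have h1 : `|eta 0 i| <= enorm eta by exact: coord_le_enorm.
have h2 : N%:R < `|(m 0 i)%:~R| :> R.
  by rewrite -intr_norm -[N%:R]/(N%:Z%:~R) ltr_int.
have h3 := truncnS_gt (A + enorm eta).
have h4 : (Num.trunc (A + enorm eta)).+1%:R <= N%:R :> R by rewrite ler_nat.
have h5 := ler_normB ((m 0 i)%:~R + eta 0 i) (eta 0 i); rewrite addrK in h5.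
move: h1 h2 h3 h4 h5; move: (N%:R : R) (enorm eta) `|eta 0 i| => a b c.
move: `|(m 0 i)%:~R : R| `|_ + _ : R| (_%:R) => d e f; lra.
Qed.

Lemma dsum_box (S : 'rV[int]_k -> functional R) (phi : R -> R[i]) (N : nat) :
  (forall m : 'rV[int]_k, m \notin box k N -> S m phi = 0) ->
  dsum S phi = \sum_(m <- box k N) S m phi.
Proof.
move=> S0; rewrite /dsum (fsbigE (box k N) _ (box_uniq k N))//; last first.
  by move=> m _; exact: S0.
by apply: eq_bigl => m; rewrite in_setT.
Qed.

Lemma cderiv0 (phi : R -> R[i]) x : cderiv 0 phi x = phi x.
Proof. by rewrite /cderiv /=; case: (phi x). Qed.

Variables (eta xi : 'rV[R]_k).

Definition sigma_term (psi : R -> R[i]) (m : 'rV[int]_k) : R[i] :=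
  let r := enorm (zvec m + eta) in
  e2pi (dotv (zvec m) xi) / r%:C * (psi r - psi (- r)).

(** On a Schwartz function infinitely many terms may differ from zero, so the value
    is a limit over boxes. *)
Definition sigma_extension : functional R :=
  fun psi => clim (fun N => \sum_(m <- box k N) sigma_term psi m).

Lemma schwartz_weight (psi : R -> R[i]) a x : schwartz psi ->
  `|x| ^+ a * cabs (psi x) <= schwartz_seminorm a 0 psi.
Proof.
move=> [_ hs]; have -> : `|x| ^+ a * cabs (psi x) = weighted_deriv a 0 psi x.
  by rewrite /weighted_deriv cderiv0.
by apply: ub_le_sup; [exact: hs|exists x].
Qed.

Lemma schwartz_seminorm_ge0 (psi : R -> R[i]) a b : schwartz psi ->
  0 <= schwartz_seminorm a b psi.
Proof.
move=> [_ hs]; apply: (@le_trans _ _ (weighted_deriv a b psi 0)).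
  exact: (mulr_ge0 (exprn_ge0 a (normr_ge0 (0 : R))) (cabs_ge0 (cderiv b psi 0))).
by apply: ub_le_sup; [exact: hs|exists 0].
Qed.

Hypothesis eta_nint : ~ (exists m : 'rV[int]_k, eta = zvec m).

Lemma sigma_term_bound : exists2 C : R, 0 <= C & forall psi m, schwartz psi ->
  cabs (sigma_term psi m) <= (C * schwartz_seminorm (2 * k) 0 psi) * weight m.
Proof.
have [d d0 hd] := enorm_gap eta_nint; have [C C0 hC] := inv_pow_weight d0 hd.
exists (2 / d * C); first by rewrite !mulr_ge0 ?invr_ge0 ?(ltW d0).
move=> psi m sp; have rd := hd m; have hCm := hC m; rewrite /sigma_term.
move: rd hCm; move: (enorm (zvec m + eta)) => r rd hCm.
have r0 : 0 < r by exact: lt_le_trans rd.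
set s := schwartz_seminorm _ _ _.
have s0 : 0 <= s by exact: schwartz_seminorm_ge0.
have hp x : `|x| = r -> cabs (psi x) <= s * r ^- (2 * k).
  move=> xr; rewrite ler_pdivlMr ?exprn_gt0// mulrC -xr; exact: schwartz_weight.
rewrite !cabsM cabs_e2pi mul1r.
have -> : cabs (r%:C^-1) = r^-1.
  by rewrite -fmorphV cabsR ger0_norm ?invr_ge0 ?ltW.
apply: (@le_trans _ _ (d^-1 * (s * r ^- (2 * k) + s * r ^- (2 * k)))).
  apply: ler_pM; rewrite ?cabs_ge0 ?invr_ge0 ?(ltW r0)//; first by rewrite lef_pV2.
  apply: (le_trans (cabsB _ _)); apply: lerD; apply: hp.
    by rewrite ger0_norm ?ltW.
  by rewrite normrN ger0_norm ?ltW.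
have -> : d^-1 * (s * r ^- (2 * k) + s * r ^- (2 * k)) = (2 / d * s) * r ^- (2 * k) by ring.
have -> : 2 / d * C * s * weight m = (2 / d * s) * (C * weight m) by ring.
by apply: ler_wpM2l => //; rewrite !mulr_ge0 ?invr_ge0 ?(ltW d0).
Qed.

Lemma sigma_extension_temperate : temperate sigma_extension.
Proof.
have [C C0 hC] := sigma_term_bound.
have bu := @box_uniq k; have bi := @box_incr k.
have wg := @weight_ge0 R k; have ws := @weight_sum R k.
have cv psi : schwartz psi -> ccvg (fun N => \sum_(m <- box k N) sigma_term psi m)
    (sigma_extension psi).
  by move=> sp; apply: (dominated_ccvg bu bi wg ws (fun m => hC psi m sp)).
split.
- move=> a phi psi sp sq; apply: ccvg_clim.
  apply: near_ccvg (ccvgD (ccvgZ a (cv phi sp)) (cv psi sq)).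
  apply: nearW => N; rewrite mulr_sumr -big_split/=; apply: eq_bigr => m _.
  by rewrite /sigma_term; ring.
- exists (2 * (C * 5 ^+ k)), (2 * k).+1 => psi sp.
  have s0 := schwartz_seminorm_ge0 (2 * k) 0 sp.
  apply: (le_trans (dominated_clim_bound bu bi wg ws (fun m => hC psi m sp))).
  have -> : 2 * (`|C * schwartz_seminorm (2 * k) 0 psi| * 5 ^+ k) =
     2 * (C * 5 ^+ k) * schwartz_seminorm (2 * k) 0 psi.
    by rewrite ger0_norm ?mulr_ge0//; ring.
  apply: ler_wpM2l; first by rewrite !mulr_ge0// exprn_ge0.
  have p (a : 'I_(2 * k).+1) : 0 <= \sum_(b < (2 * k).+1) schwartz_seminorm a b psi.
    by apply: sumr_ge0 => b _; exact: schwartz_seminorm_ge0.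
  rewrite (bigD1 ord_max)//= (bigD1 ord0)//= -addrA lerDl addr_ge0//.
    by apply: sumr_ge0 => b _; exact: schwartz_seminorm_ge0.
  by apply: sumr_ge0 => a _.
Qed.

Lemma sigma_extension_eq : eq_distribution sigma_extension (sigma eta xi).
Proof.
move=> phi tphi; have [A A0 hA] := test_support tphi.
have [N0 hN0] := box_exhausts eta A.
have tE m : ((e2pi (dotv (zvec m) xi) / (enorm (zvec m + eta))%:C) *:
    (delta 0 (enorm (zvec m + eta)) - delta 0 (- enorm (zvec m + eta))) : functional R) phi =
    sigma_term phi m.
  by rewrite /sigma_term !fctE /delta !expr0 !mul1r !cderiv0.
have e0 m : A < enorm (zvec m + eta) -> sigma_term phi m = 0.
  move=> Am; have n1 : A < `|enorm (zvec m + eta)| by rewrite (lt_le_trans Am)// ler_norm.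
  by rewrite /sigma_term !hA ?normrN// subrr mulr0.
apply: ccvg_clim; apply: (near_ccvg _ (ccvg_cst (sigma eta xi phi))).
exists N0 => // N /= N0N; rewrite /sigma (dsum_box (N := N)).
  by apply: eq_bigr => m _; rewrite -tE.
by move=> m mN; rewrite -[LHS]/(_ phi) tE e0//; exact: hN0 mN.
Qed.

End Lattice_sums.

Section Assembly.
Context {R : realType} (n : nat).
Local Notation k := (2 * n + 3)%N.
Variables (eta xi : 'rV[R]_k).
Hypothesis eta_nint : ~ (exists m : 'rV[int]_k, eta = zvec m).
Hypothesis xi_nint : ~ (exists m : 'rV[int]_k, xi = zvec m).

Lemma poisson_antisym (u : R -> R) (A : R) : smooth_real u -> 0 < A ->
  (forall x, A < `|x| -> u x = 0) ->
  exists V, poisson_pair eta xi (antisym u) (ftower (antisym u) n) (e2pi (- dotv eta xi) * V) V.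
Proof.
move=> su A0 uA; have sf := antisym_smooth su; have fo := @antisym_odd R u.
have fs := antisym_supp uA.
apply: (poisson_identity eta_nint xi_nint (A := A)) => //.
- by move=> i x; exact: ftower_derive.
- by move=> i; exact: ftower_even.
- by move=> i x; exact: ftower_supp.
- by move=> x; exact: ftower0.
Qed.

Lemma sum_functional (I : Type) (s : seq I) (F : I -> functional R) (phi : R -> R[i]) :
  (\sum_(i <- s) F i) phi = \sum_(i <- s) F i phi.
Proof.
elim: s => [|i s IH]; first by rewrite !big_nil.
by rewrite !big_cons -IH.
Qed.

Lemma dotvN (u v : 'rV[R]_k) : dotv u (- v) = - dotv u v.
Proof. by rewrite /dotv -sumrN; apply: eq_bigr => i _; rewrite mxE mulrN. Qed.

Lemma delta_pair (phi : R -> R[i]) j (x : R) : smooth phi ->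
  ((-1) ^+ j *: delta j x - delta j (- x) : functional R) phi =
  (derive1n j (antisym (fun y => complex.Re (phi y))) x)%:C +
  'i%C * (derive1n j (antisym (fun y => complex.Im (phi y))) x)%:C.
Proof.
move=> [su sv]; rewrite !antisym_derive1n//.
have -> : ((-1) ^+ j *: delta j x - delta j (- x) : functional R) phi =
    (-1) ^+ j * ((-1) ^+ j * cderiv j phi x) - (-1) ^+ j * cderiv j phi (- x) by [].
rewrite mulrA -expr2 sqrr_sign mul1r /cderiv.
have -> : (-1) ^+ j = ((-1) ^+ j)%:C :> R[i] by rewrite rmorphXn rmorphN1.
by apply/eqP; rewrite eq_complex /=; apply/andP; split; apply/eqP; ring.
Qed.

(** [beta_identity], for the real and imaginary parts of [phi], collapses the sum
    over [j] into the [n]-th function of the tower of the odd part. *)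
Lemma sigma_hat_term (phi : R -> R[i]) (m : 'rV[int]_k) (A : R) : smooth phi ->
  0 < A -> (forall x, A < `|x| -> phi x = 0) ->
  let r := enorm (zvec m + xi) in
  ((expi (- (2 * pi * dotv (zvec m) eta)) / r%:C ^+ (k - 2)%N) *:
    \sum_(0 <= j < ((k - 3) %/ 2)%N.+1)
      (beta_coef j k * r ^+ j)%:C *:
        ((-1) ^+ j *: delta j r - delta j (- r)) : functional R) phi =
  freq_term eta xi (ftower (antisym (fun x => complex.Re (phi x))) n) m +
  'i%C * freq_term eta xi (ftower (antisym (fun x => complex.Im (phi x))) n) m.
Proof.
move=> sphi A0 hA r; have [su sv] := sphi.
have r0 : 0 < r.
  by have [d d0 hd] := enorm_gap xi_nint; exact: lt_le_trans d0 (hd m).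
pose u x := complex.Re (phi x); pose v x := complex.Im (phi x).
have uA x : A < `|x| -> u x = 0 by move=> Ax; rewrite /u hA.
have vA x : A < `|x| -> v x = 0 by move=> Ax; rewrite /v hA.
have id w : smooth_real w -> (forall x, A < `|x| -> w x = 0) ->
    \sum_(j < n.+1) beta_coef j k * (r ^+ j * derive1n j (antisym w) r) =
    r ^+ (2 * n + 1) * ((- pi^-1) ^+ n * ftower (antisym w) n r).
  move=> sw wA; have sf := antisym_smooth sw; have fo := @antisym_odd R w.
  have fs := antisym_supp wA.
  apply: beta_identity => //.
  - by move=> i x; exact: ftower_derive.
  - by move=> x; exact: ftower0.
have -> : (k - 2 = 2 * n + 1)%N by lia.
have -> : ((k - 3) %/ 2 = n)%N by rewrite addnK mulKn.
rewrite big_mkord.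
transitivity (expi (- (2 * pi * dotv (zvec m) eta)) / r%:C ^+ (2 * n + 1) *
  \sum_(j < n.+1) (beta_coef j k * r ^+ j)%:C *
     ((derive1n j (antisym u) r)%:C + 'i%C * (derive1n j (antisym v) r)%:C)).
  rewrite -[LHS]/(_ * _ phi) sum_functional; congr (_ * _); apply: eq_bigr => j _.
  by rewrite -(delta_pair j r sphi).
have -> : \sum_(j < n.+1) (beta_coef j k * r ^+ j)%:C *
     ((derive1n j (antisym u) r)%:C + 'i%C * (derive1n j (antisym v) r)%:C) =
   (r ^+ (2 * n + 1) * ((- pi^-1) ^+ n * ftower (antisym u) n r))%:C +
   'i%C * (r ^+ (2 * n + 1) * ((- pi^-1) ^+ n * ftower (antisym v) n r))%:C.
  rewrite -!id// !rmorph_sum mulr_sumr -big_split/=; apply: eq_bigr => j _.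
  rewrite !mulrA !rmorphM/=; ring.
have rC : r%:C ^+ (2 * n + 1) != 0 :> R[i].
  rewrite expf_neq0//; apply/eqP => /(congr1 (@complex.Re R)) /= h.
  by rewrite h ltxx in r0.
have eE : expi (- (2 * pi * dotv (zvec m) eta)) = e2pi (dotv (zvec m) (- eta)) :> R[i].
  by rewrite /e2pi dotvN mulrN.
rewrite eE /freq_term -/r -/u -/v.
move: (e2pi _) (ftower (antisym u) n r) (ftower (antisym v) n r) => e a b.
have cE (y : R) : (r ^+ (2 * n + 1) * y)%:C = r%:C ^+ (2 * n + 1) * y%:C.
  by rewrite rmorphM rmorphXn.
rewrite !cE.
move: (r%:C ^+ (2 * n + 1)) rC (((- pi^-1) ^+ n * a)%:C) (((- pi^-1) ^+ n * b)%:C).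
by move=> q q0 x y; field.
Qed.

(** Both sides are linear in the real and imaginary parts of [phi], and
    [poisson_identity] applies to the odd part of each. *)
Theorem sigma_fourier_transform : has_fourier_transform (sigma eta xi) (sigma_hat eta xi).
Proof.
exists (sigma_extension eta xi); split.
- exact: sigma_extension_temperate.
- exact: sigma_extension_eq.
move=> phi tphi; have [A A0 hA] := test_support tphi; have sphi := tphi.1.
have [su sv] := sphi.
pose u x := complex.Re (phi x); pose v x := complex.Im (phi x).
have uA x : A < `|x| -> u x = 0 by move=> Ax; rewrite /u hA.
have vA x : A < `|x| -> v x = 0 by move=> Ax; rewrite /v hA.
have cu : continuous u by exact: (smooth_continuous (n := 0) su).
have cv : continuous v by exact: (smooth_continuous (n := 0) sv).
have [Cu gu] := gdom_compact cu A0 uA; have [Cv gv] := gdom_compact cv A0 vA.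
have [Vu [su1 fu]] := poisson_antisym su A0 uA.
have [Vv [sv1 fv]] := poisson_antisym sv A0 vA.
have lhs : fourier_distribution (sigma_extension eta xi) phi =
    - 'i%C * (e2pi (- dotv eta xi) * Vu + 'i%C * (e2pi (- dotv eta xi) * Vv)).
  apply: ccvg_clim.
  apply: near_ccvg (ccvgZ (- 'i%C) (ccvgD su1 (ccvgZ 'i%C sv1))).
  apply: nearW => N; rewrite mulr_sumr -big_split/= mulr_sumr.
  apply: eq_bigr => m _; rewrite /sigma_term /space_term.
  rewrite (fourier_antisym _ gu gv) -/u -/v.
  move: (e2pi _) (enorm _) => e r.
  by rewrite ![(_ / r)%:C]rmorphM /= !fmorphV; ring.
rewrite lhs.
have [N0 hN0] := box_exhausts xi A.
pose S (m : 'rV[int]_k) : functional R := let r := enorm (zvec m + xi) in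
  (expi (- (2 * pi * dotv (zvec m) eta)) / r%:C ^+ (k - 2)%N) *:
    \sum_(0 <= j < ((k - 3) %/ 2)%N.+1)
      (beta_coef j k * r ^+ j)%:C *: ((-1) ^+ j *: delta j r - delta j (- r)).
have S0 m : A < enorm (zvec m + xi) -> S m phi = 0.
  move=> Am; have n1 : A < `|enorm (zvec m + xi)| by rewrite (lt_le_trans Am)// ler_norm.
  apply: (etrans (sigma_hat_term m sphi A0 hA)); rewrite /freq_term.
  have fs w : smooth_real w -> (forall x, A < `|x| -> w x = 0) ->
      ftower (antisym w) n (enorm (zvec m + xi)) = 0.
    move=> sw wA; apply: (ftower_supp (antisym_smooth sw) _ A0 (antisym_supp wA)) => //.
    exact: antisym_odd.
  by rewrite !fs// !mulr0 !mul0r mulr0 addr0.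
have rhs : dsum S phi = Vu + 'i%C * Vv.
  apply: ccvg_unique (ccvgD fu (ccvgZ 'i%C fv)).
  apply: (near_ccvg _ (ccvg_cst (dsum S phi))).
  exists N0 => // N /= N0N; rewrite (dsum_box (N := N)); last first.
    by move=> m mN; apply: S0; exact: hN0 mN.
  rewrite mulr_sumr -big_split/=; apply: eq_bigr => m _.
  exact: (sigma_hat_term m sphi A0 hA).
have -> : sigma_hat eta xi phi = (- 'i%C * expi (- (2 * pi * dotv eta xi))) * dsum S phi by [].
rewrite rhs.
have -> : expi (- (2 * pi * dotv eta xi)) = e2pi (- dotv eta xi) :> R[i] by rewrite /e2pi mulrN.
by ring.
Qed.

End Assembly.

Theorem corollary2p4 (R : realType) (k : nat) (eta xi : 'rV[R]_k) :
  (3 <= k)%N -> odd k ->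
  ~ (exists m : 'rV[int]_k, eta = zvec m) ->
  ~ (exists m : 'rV[int]_k, xi = zvec m) ->
  has_fourier_transform (sigma eta xi) (sigma_hat eta xi).
Proof.
move=> k3 ok; have [n kE] : exists n, k = (2 * n + 3)%N.
  by exists ((k - 3) %/ 2)%N; lia.
by subst k; exact: sigma_fourier_transform.
Qed.
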